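(* Let $p$ be a prime and $\Gamma'\cong\prod_{i=1}^r\mathbb{Z}/p^{e_i}\mathbb{Z}$ with $e_1\le e_2\le\cdots\le e_r$. Then \[ \int_{(\Gamma,\delta)\in\mathcal{A}_p}\#\mathrm{Sur}(\Gamma,\Gamma')\,d\mu=p^{(r-1)e_1+(r-2)e_2+\cdots+e_{r-1}}. \]
   Context: $\mathrm{Sur}(\Gamma,\Gamma')$ is the set of surjective homomorphisms $\Gamma\to\Gamma'$. A duality pairing on a finite abelian group $\Gamma$ is a symmetric bilinear map $\delta:\Gamma\times\Gamma\to\mathbb{Q}/\mathbb{Z}$ such that $g\mapsto\delta(g,\cdot)$ is an isomorphism onto $\mathrm{Hom}(\Gamma,\mathbb{Q}/\mathbb{Z})$; $\mathrm{Aut}(\Gamma,\delta)$ is the group of pairing-preserving automorphisms. $\mathcal{A}_p$ is the set of isomorphism classes of pairs $(\Gamma,\delta)$ with $\Gamma$ a finite abelian $p$-group and $\delta$ a duality pairing on it. $\mu$ is the measure on $\mathcal{A}_p$ with $\mu(\Gamma,\delta)=\prod_{i=1}^\infty(1-p^{1-2i})/(\#\Gamma\cdot\#\mathrm{Aut}(\Gamma,\delta))$. *)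

(* Defs.v *)
From HB Require Import structures.
From mathcomp Require Import all_boot all_order all_algebra.
From mathcomp Require Import all_fingroup generic_quotient ring_quotient.
From mathcomp Require Import all_classical all_reals all_analysis.
From mathcomp Require Import zify.

Set Implicit Arguments.
Unset Strict Implicit.
Unset Printing Implicit Defensive.

Import Order.TTheory GRing.Theory Num.Theory.
Import numFieldNormedType.Exports.

Local Open Scope ring_scope.
Local Open Scope quotient_scope.

(* [Num.int_num_subdef] is the predicate underlying the qualifier [Num.int].  *)
Definition QmodZ : zmodType :=
  Quotient.quot (GRing.ZmodClosed.clone rat Num.int_num_subdef _).

Section Maps.
Variables G H : finZmodType.

Definition Sur : {set {ffun G -> H}} :=
  [set f : {ffun G -> H} |
    [forall x, forall y, f (x + y) == f x + f y] &&
    [forall y, exists x, f x == y]]%SET.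

(* In [duality_perfect], [{additive G -> QmodZ}] is Hom(G, Q/Z), and the      *)
(* condition says that g |-> delta(g, -) is a bijection onto it.              *)
Record duality_pairing (delta : G -> G -> QmodZ) : Prop := DualityPairing {
  duality_sym : forall x y, delta x y = delta y x;
  duality_addl : forall x y z, delta (x + y) z = delta x z + delta y z;
  duality_addr : forall x y z, delta x (y + z) = delta x y + delta x z;
  duality_perfect : forall phi : {additive G -> QmodZ},
    exists! g : G, forall x, delta g x = phi x }.

Definition pairing_Aut (delta : G -> G -> QmodZ) : {set {perm G}} :=
  [set s : {perm G} |
    [forall x, forall y, s (x + y) == s x + s y] &&
    [forall x, forall y, delta (s x) (s y) == delta x y]]%SET.

(* [m i] is meant to be positive: 'I_(m i).-1.+1 is then the additive group   *)
(* Z/(m i)Z, including the trivial group when m i = 1 (unlike 'Z_(m i)).      *)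
Definition isog_prod_cyclic (r : nat) (m : 'I_r -> nat) : Prop :=
  exists f : G -> {dffun forall i : 'I_r, 'I_(m i).-1.+1},
    bijective f /\ forall x y i, f (x + y) i = f x i + f y i.

End Maps.

Definition isometric (G H : finZmodType)
    (dG : G -> G -> QmodZ) (dH : H -> H -> QmodZ) : Prop :=
  exists f : G -> H, [/\ bijective f, {morph f : x y / x + y} &
    forall x y, dH (f x) (f y) = dG x y].

Section IsometricEquiv.
Variables G H K : finZmodType.
Variables (dG : G -> G -> QmodZ) (dH : H -> H -> QmodZ) (dK : K -> K -> QmodZ).

Lemma isometric_refl : isometric dG dG.
Proof. by exists id; split => //; exists id. Qed.

Lemma isometric_sym : isometric dG dH -> isometric dH dG.
Proof.
move=> [f [[g fK gK] fD fP]]; exists g; split; first by exists f.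
- by move=> x y; apply: (can_inj fK); rewrite fD !gK.
- by move=> x y; rewrite -fP !gK.
Qed.

Lemma isometric_trans :
  isometric dG dH -> isometric dH dK -> isometric dG dK.
Proof.
move=> [f [fb fD fP]] [g [gb gD gP]]; exists (g \o f); split.
- exact: bij_comp.
- by move=> x y /=; rewrite fD gD.
- by move=> x y /=; rewrite gP fP.
Qed.

End IsometricEquiv.

(* Isomorphism classes have to be taken over a small type of structures, as   *)
(* universe constraints rule out a quotient of a type of pairs with a         *)
(* [finZmodType] component. So we use the abelian group laws on the sets      *)
(* {0, ..., n - 1}; [exists_paired_pgroup] below shows that every finite      *)
(* abelian p-group with a duality pairing is isomorphic to one of these.      *)
Record abelian_law (n : nat) := AbelianLaw {
  law_add : 'I_n -> 'I_n -> 'I_n;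
  law_zero : 'I_n;
  law_opp : 'I_n -> 'I_n;
  law_addA : associative law_add;
  law_addC : commutative law_add;
  law_add0 : left_id law_zero law_add;
  law_addN : left_inverse law_zero law_opp law_add }.

Definition law_group (n : nat) (L : abelian_law n) : Type := 'I_n.
HB.instance Definition _ n (L : abelian_law n) := Finite.on (law_group L).
HB.instance Definition _ n (L : abelian_law n) :=
  GRing.isZmodule.Build (law_group L)
    (law_addA L) (law_addC L) (law_add0 L) (law_addN L).

Record paired_pgroup (p : nat) := PairedPGroup {
  group_order : nat;
  group_law : abelian_law group_order;
  pairing : law_group group_law -> law_group group_law -> QmodZ;
  carrier_pgroup : p.-nat #|{: law_group group_law}|;
  pairing_duality : duality_pairing pairing }.

Coercion carrier (p : nat) (A : paired_pgroup p) : finZmodType :=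
  law_group (group_law A).

HB.instance Definition _ p := gen_eqMixin (paired_pgroup p).
HB.instance Definition _ p := gen_choiceMixin (paired_pgroup p).

Section ExistsPairedPGroup.
Variables (p : nat) (G : finZmodType) (delta : G -> G -> QmodZ).
Hypotheses (pG : p.-nat #|G|) (dualG : duality_pairing delta).

Local Notation er := (@enum_rank G).
Local Notation ev := (@enum_val G G).

Let add (i j : 'I_#|G|) : 'I_#|G| := er (ev i + ev j).
Let opp (i : 'I_#|G|) : 'I_#|G| := er (- ev i).

Let addA : associative add.
Proof. by move=> i j k; rewrite /add !enum_rankK addrA. Qed.
Let addC : commutative add.
Proof. by move=> i j; rewrite /add addrC. Qed.
Let add0 : left_id (er 0) add.
Proof. by move=> i; rewrite /add enum_rankK add0r enum_valK. Qed.
Let addN : left_inverse (er 0) opp add.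
Proof. by move=> i; rewrite /add /opp enum_rankK addNr. Qed.

Let L : abelian_law #|G| := AbelianLaw addA addC add0 addN.
Let d (i j : law_group L) : QmodZ := delta (ev i) (ev j).

Let pL : p.-nat #|{: law_group L}|.
Proof. by rewrite card_ord. Qed.

Let evD (i j : law_group L) : ev (i + j) = ev i + ev j.
Proof. exact: enum_rankK. Qed.

Let dualL : duality_pairing d.
Proof.
case: dualG => dsym daddl daddr dperf; split.
- by move=> x y; exact: dsym.
- by move=> x y z; rewrite /d evD daddl.
- by move=> x y z; rewrite /d evD daddr.
- move=> phi; pose psi (x : G) : QmodZ := phi (er x : law_group L).
  have psi_add : zmod_morphism psi.
    move=> x y; rewrite /psi -raddfB; congr (phi _).
    apply: enum_val_inj; apply: (addIr y); rewrite enum_rankK subrK.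
    have := evD ((er x : law_group L) - (er y : law_group L)) (er y).
    by rewrite subrK !enum_rankK.
  pose psiM := GRing.isZmodMorphism.Build _ _ psi psi_add.
  pose Psi : {additive G -> QmodZ} := HB.pack psi psiM.
  have [g [gP gU]] := dperf Psi; exists (er g); split.
    by move=> x; rewrite /d enum_rankK gP /= /psi enum_valK.
  move=> h hP; rewrite (gU (ev h)) ?enum_valK // => x.
  by rewrite /= /psi -hP /d enum_rankK.
Qed.

Lemma exists_paired_pgroup :
  exists A : paired_pgroup p, isometric (@pairing p A) delta.
Proof.
exists (PairedPGroup pL dualL), ev; split.
- by exists er; [exact: enum_valK | exact: enum_rankK].
- by move=> x y; rewrite evD.
- by [].
Qed.

End ExistsPairedPGroup.

Section Classes.
Variable p : nat.

Definition isometricb (A B : paired_pgroup p) : bool :=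
  `[< isometric (@pairing p A) (@pairing p B) >].

Lemma isometricb_equiv : equiv_class_of isometricb.
Proof.
split=> [A|A B|B A C].
- exact/asboolP/isometric_refl.
- by apply/asboolP/asboolP; exact: isometric_sym.
- by move=> /asboolP AB /asboolP BC; apply/asboolP/isometric_trans/BC.
Qed.

Canonical isometricb_equivRel := EquivRelPack isometricb_equiv.
Canonical isometricb_encModRel := defaultEncModRel isometricb.

Definition Ap := {eq_quot isometricb}.
HB.instance Definition _ := EqQuotient.on Ap.
HB.instance Definition _ := Choice.on Ap.

End Classes.

Section TrivialGroup.
Variable p : nat.

Let triv_pairing : 'I_1 -> 'I_1 -> QmodZ := fun _ _ => 0.

Let triv_pgroup : p.-nat #|('I_1 : finZmodType)|.
Proof. by rewrite card_ord. Qed.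

Let triv_duality : duality_pairing triv_pairing.
Proof.
split => // [x y z|x y z|phi]; rewrite ?addr0 //.
exists 0; split => [x|y _]; last by rewrite [LHS]ord1 [RHS]ord1.
by rewrite [x]ord1 raddf0.
Qed.

Lemma paired_pgroup_inhabited : exists A : paired_pgroup p, True.
Proof. by have [A _] := exists_paired_pgroup triv_pgroup triv_duality; exists A. Qed.

End TrivialGroup.

HB.instance Definition _ p :=
  isPointed.Build (Ap p) (\pi_(Ap p) (projT1 (cid (paired_pgroup_inhabited p)))).

HB.instance Definition _ p := @isMeasurable.Build default_measure_display
  (Ap p) discrete_measurable discrete_measurable0
  discrete_measurableC discrete_measurableU.

Section Measure.
Variables (R : realType) (p : nat).

(* The infinite product of the 1 - p^(1 - 2i), i >= 1, with an integer        *)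
(* exponent 1 - 2i.                                                           *)
Definition weight_const : R :=
  limn (fun n => \prod_(1 <= i < n.+1) (1 - (p%:R : R) ^ (1 - 2 * i%:Z))).

Definition weight (A : paired_pgroup p) : R :=
  weight_const / (#|A|%:R * #|pairing_Aut (@pairing p A)|%:R).

Definition mu (X : set (Ap p)) : \bar R :=
  (\esum_(x in X) (weight (repr x))%:E)%E.

Lemma weight_const_ge0 : 0 <= weight_const.
Proof.
rewrite /weight_const; set u := (fun n => _).
have Hfac i : (0 < i)%N -> 0 <= 1 - (p%:R : R) ^ (1 - 2 * i%:Z) <= 1.
  case: i => // i _.
  have -> : (1 - 2 * (i.+1)%:Z = - ((2 * i).+1)%:Z)%R by lia.
  rewrite -exprnN; case: (posnP p) => [->|p0].
    by rewrite expr0n /= invr0 subr0 ler01 lexx.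
  have p1 : 1 <= (p%:R : R) ^+ (2 * i).+1 by rewrite exprn_ege1 // ler1n.
  have H0 : 0 <= ((p%:R : R) ^+ (2 * i).+1)^-1 by rewrite invr_ge0 exprn_ge0.
  have H1 : ((p%:R : R) ^+ (2 * i).+1)^-1 <= 1 by rewrite invf_le1 // (lt_le_trans ltr01).
  by rewrite subr_ge0 H1 lerBlDr lerDl H0.
have u0 n : 0 <= u n.
  rewrite /u big_nat; apply: prodr_ge0 => i /andP[i0 _].
  by have /andP[] := Hfac i i0.
apply: limr_ge; last exact: nearW.
apply: nonincreasing_is_cvgn; last by exists 0 => _ [n _ <-].
apply/nonincreasing_seqP => n; rewrite /u [leLHS]big_nat_recr //=.
by apply: ler_piMr; [exact: u0 | have /andP[] := Hfac n.+1 isT].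
Qed.

Lemma weight_ge0 A : 0 <= weight A.
Proof. by rewrite divr_ge0 ?weight_const_ge0 // mulr_ge0. Qed.

Let mu0 : mu set0 = 0%E.
Proof. exact: esum_set0. Qed.

Let mu_ge0 X : (0 <= mu X)%E.
Proof. by apply: esum_ge0 => x _; rewrite lee_fin weight_ge0. Qed.

Let mu_semi_sigma_additive : semi_sigma_additive mu.
Proof.
move=> F mF tF mUF; rewrite /mu nneseries_sum_bigcup //; last first.
  by move=> x; rewrite lee_fin weight_ge0.
by apply: is_cvg_nneseries => n _ _; exact: mu_ge0.
Qed.

HB.instance Definition _ :=
  isMeasure.Build _ _ _ mu mu0 mu_ge0 mu_semi_sigma_additive.

End Measure.

Lemma card_Sur_isometric p (A B : paired_pgroup p) (H : finZmodType) :
  isometric (@pairing p A) (@pairing p B) -> #|Sur A H| = #|Sur B H|.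
Proof.
suff le (C D : paired_pgroup p) :
    isometric (@pairing p C) (@pairing p D) -> (#|Sur C H| <= #|Sur D H|)%N.
  by move=> AB; apply/eqP; rewrite eqn_leq !le //; exact: isometric_sym.
move=> [f [[g fK gK] fD _]].
pose h (k : {ffun C -> H}) : {ffun D -> H} := [ffun x => k (g x)].
have hinj : injective h.
  move=> k1 k2 /ffunP E; apply/ffunP => x.
  by have := E (f x); rewrite !ffunE fK.
rewrite -(card_imset _ hinj); apply/subset_leq_card/fintype.subsetP => _ /imsetP[k + ->].
rewrite !inE => /andP[/forallP kD /forallP kS]; apply/andP; split.
  apply/forallP => x; apply/forallP => y; rewrite !ffunE.
  have -> : g (x + y) = g x + g y by apply: (can_inj fK); rewrite fD !gK.
  exact: (forallP (kD _)).
apply/forallP => y; have /existsP[x xy] := kS y.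
by apply/existsP; exists (f x); rewrite ffunE fK.
Qed.

Lemma card_pairing_Aut_isometric p (A B : paired_pgroup p) :
  isometric (@pairing p A) (@pairing p B) ->
  #|pairing_Aut (@pairing p A)| = #|pairing_Aut (@pairing p B)|.
Proof.
suff le (C D : paired_pgroup p) : isometric (@pairing p C) (@pairing p D) ->
    (#|pairing_Aut (@pairing p C)| <= #|pairing_Aut (@pairing p D)|)%N.
  by move=> AB; apply/eqP; rewrite eqn_leq !le //; exact: isometric_sym.
move=> [f [[g fK gK] fD fP]].
have gD x y : g (x + y) = g x + g y by apply: (can_inj fK); rewrite fD !gK.
have cinj (s : {perm C}) : injective (fun x => f (s (g x))).
  by move=> x y /(can_inj fK) /perm_inj /(can_inj gK).
pose h s := perm (cinj s).
have hinj : injective h.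
  move=> s t /permP E; apply/permP => x.
  by have := E (f x); rewrite !permE fK => /(can_inj fK).
rewrite -(card_imset _ hinj); apply/subset_leq_card/fintype.subsetP => _ /imsetP[s + ->].
rewrite !inE => /andP[/forallP sD /forallP sP]; apply/andP; split.
  apply/forallP => x; apply/forallP => y; rewrite !permE gD.
  by rewrite (eqP (forallP (sD _) _)) fD.
apply/forallP => x; apply/forallP => y; rewrite !permE fP.
by rewrite (eqP (forallP (sP _) _)) -fP !gK.
Qed.

Lemma isometric_repr p (A : paired_pgroup p) :
  isometric (@pairing p (repr (\pi_(Ap p) A))) (@pairing p A).
Proof. by apply/asboolP; have /eqmodP := reprK (\pi_(Ap p) A). Qed.

Lemma card_isometric p (A B : paired_pgroup p) :
  isometric (@pairing p A) (@pairing p B) -> #|A| = #|B|.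
Proof. by move=> [f [fb _ _]]; exact: bij_eq_card fb. Qed.

Lemma mu_class (R : realType) p (A : paired_pgroup p) :
  mu R [set \pi_(Ap p) A]%classic = (weight R A)%:E.
Proof.
rewrite /mu esum_set1 ?lee_fin ?weight_ge0 // /weight.
by rewrite (card_isometric (isometric_repr A))
  (card_pairing_Aut_isometric (isometric_repr A)).
Qed.

Definition num_Sur p (H : finZmodType) (x : Ap p) : nat := #|Sur (repr x) H|.

Lemma num_Sur_class p (H : finZmodType) (A : paired_pgroup p) :
  num_Sur H (\pi_(Ap p) A) = #|Sur A H|.
Proof. exact/card_Sur_isometric/isometric_repr. Qed.

(* Main.v *)
Require Import Defs.
From HB Require Import structures.
From mathcomp Require Import all_boot all_order all_algebra.
From mathcomp Require Import all_fingroup.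
From mathcomp Require Import all_classical all_reals all_analysis.
From mathcomp Require Import zify ring lra.

Set Implicit Arguments.
Unset Strict Implicit.
Unset Printing Implicit Defensive.

Import Order.TTheory GRing.Theory Num.Theory.
Import numFieldNormedType.Exports.

Local Open Scope ring_scope.

(** Write a p-group of rank r as the cokernel of a symmetric r x r matrix X over
    Z_p divisible by p, with the pairing given by X^-1. A fixed generating family
    of (Gamma, delta) determines X^-1 modulo Z_p, and X -> X^-1 multiplies volumes
    by #Gamma^(r+1), so that the X presenting (Gamma, delta) form a set whose measure
    is proportional to 1/(#Gamma #Aut(Gamma, delta)). Hence the part of the integral
    over groups of rank r is an expectation over such X of the number of surjections
    F : Z_p^r -> Gamma' with F X = 0. Up to a change of basis F is standard, and the
    expectation is read off entrywise: for Gamma' of rank g and r = g + k it equals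
    p^((r-1)e_1 + ...) x^(k(k+1)/2) / ((1-x)...(1-x^k)) with x = 1/p. Summing over k,
    Euler's identity turns the result into a multiple of prod (1 + x^i), which is
    inverse to prod (1 - x^(2i-1)).

    Haar measure is replaced by counting over Z/p^(2e): a symmetric X with a
    symmetric Y such that X Y = p^e presents a group of exponent dividing p^e, with
    Gram matrix Y/p^e, and the proportion of symmetric X without such a Y tends to 0
    as e grows. *)

(** * Matrices over Z/p^N *)

(** The modulus is p^(2e) because X is inverted only up to p^e. If X Y = p^e over Z/p^(2e), then X
    determines Y modulo p^e, which is exactly what the Gram matrix Y/p^e sees modulo 1, and the rows
    of X generate exactly the relations of the presented group. At precision p^e the equation would
    only say X Y = 0.

    Inversion is not a bijection at finite level, so its Jacobian is replaced by a double count of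
    the pairs (X, Y). The partners of X, resp. of Y, are as many as the symmetric Z with X Z = 0,
    resp. Y Z = 0; in Smith coordinates the ratio of these numbers is #Gamma^(r+1) up to a power of
    p depending only on e and r.

    A given e sees only the groups killed by p^e, and matrices that are not invertible up to p^e
    blur the count. For a fixed rank this bounds the contribution from above by the full
    expectation, and from below with an error of order p^-(e+1), so e can be sent to infinity. All
    terms being nonnegative, the ranks are evaluated separately and then added. *)

Section PrimePowerRing.
Variables (p N : nat).
Hypotheses (p_pr : prime p) (N_gt0 : (0 < N)%N).

Local Notation q := (p ^ N)%N.
Local Notation A := 'Z_q.

Lemma expp_gt1 : (1 < q)%N.
Proof. by rewrite -(exp1n N) ltn_exp2r // prime_gt1. Qed.

Lemma card_Zpow : #|{: A}| = q.
Proof. by rewrite card_ord Zp_cast // expp_gt1. Qed.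

Lemma ltn_Zpow (a : A) : (a < q)%N.
Proof. by have := ltn_ord a; rewrite [X in (_ < X)%N]Zp_cast // expp_gt1. Qed.

Lemma val_natZ n : (n%:R : A) = (n %% q)%N :> nat.
Proof. by rewrite val_Zp_nat // expp_gt1. Qed.

Lemma natZ_val (a : A) : (a : nat)%:R = a.
Proof. exact: natr_Zp. Qed.

Lemma natZ_eq0 n : ((n%:R : A) == 0) = (q %| n)%N.
Proof. by rewrite -val_eqE /= val_natZ. Qed.

Lemma val_addZ (a b : A) : (a + b : A) = ((a + b) %% q)%N :> nat.
Proof. by rewrite -val_natZ natrD !natZ_val. Qed.

Lemma val_mulZ (a b : A) : (a * b : A) = ((a * b) %% q)%N :> nat.
Proof. by rewrite -val_natZ natrM !natZ_val. Qed.

(** Read on the canonical representative; for [k <= N] the choice of representative is immaterial,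
    since [p ^ k] then divides the modulus. *)
Definition pdvd k (a : A) : bool := (p ^ k %| a)%N.

Lemma pdvd_nat k n : (k <= N)%N -> pdvd k n%:R = (p ^ k %| n)%N.
Proof. by move=> kN; rewrite /pdvd val_natZ /dvdn modn_dvdm // dvdn_exp2l. Qed.

Lemma pdvdP k (a : A) : (k <= N)%N ->
  reflect (exists b, a = (p ^ k)%:R * b) (pdvd k a).
Proof.
move=> kN; apply: (iffP idP) => [/dvdnP[c ac]|[b ->]].
  by exists c%:R; rewrite -natrM mulnC -ac natZ_val.
by rewrite -[b]natZ_val -natrM pdvd_nat // dvdn_mulr.
Qed.

(** Turns divisibility into a linear equation, so that elements known only up to an annihilator can
    be controlled. *)
Lemma pdvd_ann k (a : A) : (k <= N)%N -> pdvd k a = ((p ^ (N - k))%:R * a == 0).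
Proof.
move=> kN; rewrite -[a in RHS]natZ_val -natrM natZ_eq0.
have qE : q = (p ^ (N - k) * p ^ k)%N by rewrite -expnD subnK.
by rewrite [X in (X %| _)%N]qE dvdn_pmul2l // expn_gt0 prime_gt0.
Qed.

Lemma pdvd0 k : pdvd k 0. Proof. exact: dvdn0. Qed.

Lemma pdvdD k a b : (k <= N)%N -> pdvd k a -> pdvd k b -> pdvd k (a + b).
Proof.
by move=> kN /(pdvdP _ kN)[c ->] /(pdvdP _ kN)[d ->]; apply/pdvdP => //;
  exists (c + d); rewrite mulrDr.
Qed.

Lemma pdvdMl k a b : (k <= N)%N -> pdvd k b -> pdvd k (a * b).
Proof.
move=> kN /(pdvdP _ kN)[c ->]; apply/pdvdP => //.
by exists (a * c); rewrite mulrCA.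
Qed.

Lemma pdvdN k a : (k <= N)%N -> pdvd k (- a) = pdvd k a.
Proof. by move=> kN; rewrite !pdvd_ann // mulrN oppr_eq0. Qed.

Lemma pdvd_sum k (I : finType) (F : I -> A) : (k <= N)%N ->
  (forall i, pdvd k (F i)) -> pdvd k (\sum_i F i).
Proof.
move=> kN FP; apply: (big_ind (fun x => pdvd k x)) => //; first exact: pdvd0.
by move=> x y; apply: pdvdD.
Qed.

Lemma pdvd_leq k l a : (k <= l)%N -> pdvd l a -> pdvd k a.
Proof. by move=> kl; apply: dvdn_trans; rewrite dvdn_exp2l. Qed.

Lemma card_pdvd k : (k <= N)%N -> #|[set a : A | pdvd k a]%SET| = (p ^ (N - k))%N.
Proof.
move=> kN; have pk0 : (0 < p ^ k)%N by rewrite expn_gt0 prime_gt0.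
have qE : q = (p ^ (N - k) * p ^ k)%N by rewrite -expnD subnK.
pose f (i : 'I_(p ^ (N - k))) : A := (p ^ k * i)%:R.
have fv i : f i = (p ^ k * i)%N :> nat.
  by rewrite /f val_natZ modn_small // [ltnRHS]qE mulnC ltn_pmul2r.
have finj : injective f.
  move=> i j /(congr1 (@nat_of_ord _)); rewrite !fv => /eqP.
  by rewrite eqn_pmul2l // => /eqP/val_inj.
rewrite -[RHS]card_ord -(card_imset _ finj); apply: eq_card => a.
rewrite inE; apply/idP/imsetP => [/dvdnP[c ac]|[i _ ->]]; last first.
  by rewrite /pdvd fv dvdn_mulr.
have cl : (c < p ^ (N - k))%N.
  have := ltn_Zpow a; by rewrite ac [ltnRHS]qE ltn_pmul2r.
by exists (Ordinal cl) => //; apply: ord_inj; rewrite fv /= mulnC.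
Qed.

Lemma unitZpow (a : A) : (a \is a GRing.unit) = ~~ pdvd 1 a.
Proof.
rewrite -[a]natZ_val unitZpE ?expp_gt1 // pdvd_nat // expn1.
by rewrite coprime_pexpl // prime_coprime.
Qed.

Lemma Zpow_unit_exp (a : A) : exists k (u : A),
  [/\ (k <= N)%N, u \is a GRing.unit & a = (p ^ k)%:R * u].
Proof.
have [->|a0] := eqVneq a 0.
  exists N, 1; split=> //; first exact: unitr1.
  rewrite mulr1; apply/esym/eqP.
  by rewrite natZ_eq0.
have an0 : (0 < a)%N by rewrite lt0n.
have [c pc ac] := pfactor_coprime p_pr an0.
exists (logn p a), c%:R; split.
- rewrite leqNgt; apply/negP => NL.
  have: (q %| a)%N by rewrite ac dvdn_mull // dvdn_exp2l // ltnW.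
  by move/(dvdn_leq an0); rewrite leqNgt ltn_Zpow.
- by rewrite unitZpE ?expp_gt1 // coprime_pexpl.
- by rewrite -natrM mulnC -ac natZ_val.
Qed.

Definition red (a : A) : 'F_p := (a : nat)%:R.

Lemma natF_mod n : ((n %% q)%N%:R : 'F_p) = n%:R.
Proof.
apply: val_inj; rewrite /= !val_Fp_nat // modn_dvdm //.
by rewrite -{1}(expn1 p) dvdn_exp2l.
Qed.

Lemma red_is_zmod_morphism : zmod_morphism red.
Proof.
move=> a b; apply/eqP; rewrite -(inj_eq (addIr (red b))) subrK.
by rewrite /red -natrD -natF_mod -val_addZ subrK.
Qed.

Lemma red_is_monoid_morphism : monoid_morphism red.
Proof.
split; first by rewrite /red [nat_of_ord _](val_natZ 1) natF_mod.
by move=> a b; rewrite /red val_mulZ natF_mod natrM.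
Qed.

HB.instance Definition _ :=
  GRing.isZmodMorphism.Build A 'F_p red red_is_zmod_morphism.
HB.instance Definition _ :=
  GRing.isMonoidMorphism.Build A 'F_p red red_is_monoid_morphism.

Lemma red_eq0 a : (red a == 0) = pdvd 1 a.
Proof.
rewrite /red /pdvd expn1 -val_eqE /= val_Fp_nat //.
Qed.

Definition pdvdmx k (m n : nat) (M : 'M[A]_(m, n)) : bool :=
  [forall i, forall j, pdvd k (M i j)].

Lemma pdvdmxP k (m n : nat) (M : 'M[A]_(m, n)) :
  reflect (forall i j, pdvd k (M i j)) (pdvdmx k M).
Proof. by apply: (iffP forallP) => H i; [apply/forallP | apply/forallP]. Qed.

Lemma pdvdmx_mull k (m n s : nat) (B : 'M[A]_(m, n)) (M : 'M[A]_(n, s)) :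
  (k <= N)%N -> pdvdmx k M -> pdvdmx k (B *m M).
Proof.
move=> kN /pdvdmxP MP; apply/pdvdmxP => i j; rewrite mxE.
by apply: pdvd_sum => // l; apply: pdvdMl.
Qed.

Lemma pdvdmx_mulr k (m n s : nat) (B : 'M[A]_(m, n)) (M : 'M[A]_(s, m)) :
  (k <= N)%N -> pdvdmx k M -> pdvdmx k (M *m B).
Proof.
move=> kN /pdvdmxP MP; apply/pdvdmxP => i j; rewrite mxE.
by apply: pdvd_sum => // l; rewrite mulrC; apply: pdvdMl.
Qed.

Lemma red_mx_eq0 (m n : nat) (M : 'M[A]_(m, n)) :
  (map_mx red M == 0) = pdvdmx 1 M.
Proof.
apply/eqP/pdvdmxP => [/matrixP M0 i j|MP].
  by have := M0 i j; rewrite !mxE => /eqP; rewrite red_eq0.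
by apply/matrixP => i j; rewrite !mxE; apply/eqP; rewrite red_eq0.
Qed.

(** The ring is local with residue field F_p, and the determinant commutes with reduction. *)
Lemma unitmx_red n (M : 'M[A]_n) : (M \in unitmx) = (map_mx red M \in unitmx).
Proof.
by rewrite !unitmxE det_map_mx unitZpow -red_eq0 unitfE.
Qed.

Lemma unitmx_congr1 n (M : 'M[A]_n) : pdvdmx 1 (M - 1%:M) -> M \in unitmx.
Proof.
rewrite -red_mx_eq0 unitmx_red map_mxB map_mx1 subr_eq0 => /eqP ->.
exact: unitmx1.
Qed.

(** Modulo [p] the matrix is block upper triangular with the identity in the upper left corner, so
    the lower right block decides. *)
Lemma unitmx_congr_block g k (M : 'M[A]_(g + k)) :
  pdvdmx 1 (lsubmx M - col_mx 1%:M 0) -> (M \in unitmx) = (dsubmx (rsubmx M) \in unitmx).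
Proof.
rewrite -red_mx_eq0 map_mxB subr_eq0 map_col_mx map_mx1 map_mx0 => /eqP ME.
rewrite !unitmx_red -[M in LHS]hsubmxK map_row_mx ME -[rsubmx M]vsubmxK map_col_mx.
by rewrite -block_mxEh unitmxE det_ublock det1 mul1r -unitmxE vsubmxK.
Qed.

Lemma redK (b : 'F_p) : red (b : nat)%:R = b.
Proof. by rewrite /red val_natZ natF_mod natr_Zp. Qed.

(** Each fibre is a coset of the matrices divisible by [p], which leave [p ^ N.-1] choices per
    entry. *)
Lemma card_red_fiber n (B : 'M['F_p]_n) :
  #|[set M : 'M[A]_n | map_mx red M == B]%SET| = (p ^ (N.-1 * (n * n)))%N.
Proof.
pose C : 'M[A]_n := map_mx (fun b : 'F_p => (b : nat)%:R : A) B.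
have CB : map_mx red C = B by apply/matrixP => i j; rewrite !mxE redK.
have inj : injective (fun M : 'M[A]_n => M + C) by apply: addIr.
pose S : {set A} := [set a : A | pdvd 1 a]%SET.
have -> : [set M : 'M[A]_n | map_mx red M == B]%SET =
    [set M + C | M in [set M : 'M[A]_n | pdvdmx 1 M]]%SET.
  apply/setP => M; rewrite inE; apply/eqP/imsetP => [MB|[L]].
    exists (M - C); last by rewrite subrK.
    by rewrite inE -red_mx_eq0 map_mxB MB CB subrr.
  by rewrite inE -red_mx_eq0 => /eqP L0 ->; rewrite map_mxD L0 CB add0r.
rewrite card_imset //.
pose f (M : 'M[A]_n) : {ffun 'I_n * 'I_n -> A} := [ffun x => M x.1 x.2].
have finj : injective f.
  by move=> M L /ffunP ML; apply/matrixP => i j; have := ML (i, j); rewrite !ffunE.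
rewrite -(card_imset _ finj).
have -> : f @: [set M : 'M[A]_n | pdvdmx 1 M]%SET =
    [set g in ffun_on (mem S)]%SET.
  apply/setP => g; apply/imsetP/idP => [[M]|].
    rewrite !inE => /pdvdmxP MP ->; apply/ffun_onP => x.
    by rewrite ffunE inE.
  rewrite inE => /ffun_onP gP; exists (\matrix_(i, j) g (i, j)).
    by rewrite inE; apply/pdvdmxP => i j; rewrite mxE; have := gP (i, j); rewrite inE.
  by apply/ffunP => -[i j]; rewrite ffunE mxE.
rewrite cardsE card_ffun_on card_prod !card_ord card_pdvd // -expnM.
by rewrite subn1.
Qed.

Definition cardGL n : nat := #|[set M : 'M[A]_n | M \in unitmx]%SET|.

Lemma card_unitmx_Fp n : #|[set M : 'M['F_p]_n | M \in unitmx]%SET| =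
  (p ^ 'C(n, 2) * \prod_(1 <= i < n.+1) (p ^ i - 1))%N.
Proof.
case: n => [|n].
  rewrite big_geq // muln1 expn0; apply/eqP/cards1P; exists 0.
  apply/setP => M; rewrite !inE [M]flatmx0 eqxx unitmxE det_mx00 unitr1 //.
have := @card_GL 'F_p n.+1 isT; rewrite card_Fp // => <-.
have vinj : injective (fun u : {'GL_n.+1['F_p]} => FinRing.uval u : 'M['F_p]_n.+1).
  exact: val_inj.
rewrite -(card_imset _ vinj); apply: eq_card => M.
rewrite inE; apply/idP/imsetP => [MU|[u _ ->]]; last exact: (valP u).
by exists (FinRing.unit _ MU) => //; rewrite inE.
Qed.

Lemma card_unitmx n : cardGL n =
  (p ^ (N.-1 * (n * n) + 'C(n, 2)) * \prod_(1 <= i < n.+1) (p ^ i - 1))%N.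
Proof.
rewrite /cardGL -sum1_card.
rewrite (partition_big (fun M : 'M[A]_n => map_mx red M)
  (fun B => B \in [set B : 'M['F_p]_n | B \in unitmx]%SET)) /=; last first.
  by move=> M; rewrite !inE unitmx_red.
rewrite (eq_bigr (fun=> p ^ (N.-1 * (n * n)))%N); last first.
  move=> B; rewrite inE => BU; rewrite -(card_red_fiber B) -sum1_card.
  apply: eq_bigl => M; rewrite !inE; case: eqP => [MB|]; last by rewrite andbF.
  by rewrite unitmx_red MB BU.
by rewrite sum_nat_const card_unitmx_Fp mulnC mulnA expnD.
Qed.

End PrimePowerRing.

(** * Smith forms and symmetric matrices *)

Lemma card_symmetric (T : finZmodType) r (S : 'I_r -> 'I_r -> {set T}) :
  (forall i j, S i j = S j i) ->
  #|[set M : 'M[T]_r | (M^T == M) && [forall i, forall j, M i j \in S i j]]%SET|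
  = (\prod_(i < r) \prod_(j < r | (i <= j)%N) #|S i j|)%N.
Proof.
move=> Ssym.
(* Entries below the diagonal are forced to [0], so that the upper triangles fill a full product of
   sets. *)
pose F (x : 'I_r * 'I_r) : {set T} := if (x.1 <= x.2)%N then S x.1 x.2 else [set 0]%SET.
pose f (M : 'M[T]_r) : {ffun 'I_r * 'I_r -> T} :=
  [ffun x : 'I_r * 'I_r => if (x.1 <= x.2)%N then M x.1 x.2 else 0].
set D := [set M | _]%SET.
have finj : {in D &, injective f}.
  move=> M L; rewrite !inE => /andP[/eqP Ms _] /andP[/eqP Ls _] /ffunP ML.
  apply/matrixP => i j; case/orP: (leq_total i j) => ij.
    by have := ML (i, j); rewrite !ffunE /= ij.
  by rewrite -Ms -Ls !mxE; have := ML (j, i); rewrite !ffunE /= ij.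
rewrite -(card_in_imset finj).
have -> : f @: D = [set g | g \in family (fun x => [pred y in F x])]%SET.
  apply/setP => g; rewrite inE; apply/imsetP/familyP => [[M]|gP].
    rewrite inE => /andP[_ /forallP MP] -> [i j]; rewrite ffunE inE /F /=.
    by case: ifP => _; [apply: (forallP (MP i) j) | rewrite inE].
  exists (\matrix_(i, j) if (i <= j)%N then g (i, j) else g (j, i)).
    rewrite inE; apply/andP; split.
      apply/eqP/matrixP => i j; rewrite !mxE; case: (ltngtP i j) => // ij.
      by rewrite (val_inj ij).
    apply/forallP => i; apply/forallP => j; rewrite mxE; case: leqP => ij.
      by have /= := gP (i, j); rewrite inE /F /= ij.
    by have /= := gP (j, i); rewrite inE /F /= (ltnW ij) Ssym.
  apply/ffunP => -[i j]; rewrite ffunE /=; case: ifP => ij; first by rewrite mxE ij.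
  by have /= := gP (i, j); rewrite inE /F /= ij => /set1P.
transitivity #|(family (fun x => [pred y in F x]) : simpl_pred {ffun 'I_r * 'I_r -> T})|.
  by apply: eq_card => g; rewrite inE.
rewrite card_family /image_mem foldrE big_map big_enum /=.
rewrite -(pair_big xpredT xpredT (fun i j => #|[pred y in F (i, j)]|)) /=.
apply: eq_bigr => i _; rewrite [RHS]big_mkcond /=; apply: eq_bigr => j _.
by rewrite /F /=; case: ifP => _; [apply: eq_card | rewrite -(cards1 (0 : T)); apply: eq_card].
Qed.

Section SmithForm.
Variables (p N : nat).
Hypotheses (p_pr : prime p) (N_gt0 : (0 < N)%N).
Local Notation A := 'Z_(p ^ N).

Lemma map_unitmx_int (R : comUnitRingType) n (M : 'M[int]_n) :
  M \in unitmx -> map_mx (intr : int -> R) M \in unitmx.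
Proof. by rewrite !unitmxE det_map_mx; apply: rmorph_unit. Qed.

Lemma intr_Zpow_val (a : A) : ((a : nat)%:Z)%:~R = a.
Proof. by rewrite -pmulrn natZ_val. Qed.

(** The Smith form of an integer lift, reduced modulo [p ^ N]: integral invertible matrices stay
    invertible over any commutative ring. *)
Lemma smith_diag r s (M : 'M[A]_(r, s)) :
  exists (U : 'M[A]_r) (V : 'M[A]_s) (d : nat -> A),
  [/\ U \in unitmx, V \in unitmx &
      M = U *m (\matrix_(i, j) (d i *+ (i == j :> nat))) *m V].
Proof.
have [L LU [R RU [d _ dM]]] :=
  int_Smith_normal_form (\matrix_(i, j) ((M i j : nat)%:Z)).
exists (map_mx intr L), (map_mx intr R), (fun i => (d`_i)%:~R).
split; [exact: map_unitmx_int | exact: map_unitmx_int |].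
have -> : M = map_mx intr (\matrix_(i, j) ((M i j : nat)%:Z)).
  by apply/matrixP => i j; rewrite !mxE intr_Zpow_val.
rewrite dM !map_mxM; congr (_ *m _ *m _).
by apply/matrixP => i j; rewrite !mxE rmorphMn.
Qed.

Lemma smith_pdiag r (M : 'M[A]_r) :
  exists (U V : 'M[A]_r) (k : 'I_r -> nat),
  [/\ U \in unitmx, V \in unitmx, forall i, (k i <= N)%N &
      M = U *m diag_mx (\row_i (p ^ k i)%:R) *m V].
Proof.
have [U [V [d [UU VU MD]]]] := smith_diag M.
have dk (i : 'I_r) : exists ku : nat * A, [/\ (ku.1 <= N)%N,
    ku.2 \is a GRing.unit & d i = (p ^ ku.1)%:R * ku.2].
  by have [k [u ku]] := Zpow_unit_exp p_pr N_gt0 (d i); exists (k, u).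
have [f fP] := fin_all_exists dk.
pose W : 'M[A]_r := diag_mx (\row_i (f i).2).
exists U, (W *m V), (fun i => (f i).1); split=> //.
- rewrite unitmx_mul VU andbT unitmxE det_diag unitr_prod // => i _.
  by rewrite mxE; have [] := fP i.
- by move=> i; have [] := fP i.
- rewrite MD -!mulmxA; congr (_ *m _); rewrite mulmxA; congr (_ *m _).
  rewrite mul_diag_mx; apply/matrixP => i j; rewrite !mxE val_eqE.
  by have [_ _ ->] := fP i; rewrite mulrnAr.
Qed.

(* Over [int] an inverse up to a scalar of a symmetric matrix is symmetric, since
   the ring has no zero divisors; this is why the Smith form is taken of an
   integer lift rather than over [A] directly. *)
Lemma symmetric_quasi_inverse r e (Y : 'M[A]_r) : (e < N)%N -> Y^T = Y ->
  (forall v : 'cV[A]_r, pdvdmx e.+1 (Y *m v) -> pdvdmx 1 v) ->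
  exists2 X : 'M[A]_r, X^T = X & X *m Y = ((p ^ e)%:R)%:M.
Proof.
move=> eN Ysym Yp; pose Z : 'M[int]_r := \matrix_(i, j) ((Y i j : nat)%:Z).
have ZY : map_mx intr Z = Y.
  by apply/matrixP => i j; rewrite !mxE intr_Zpow_val.
have Zsym : Z^T = Z by apply/matrixP => i j; rewrite !mxE -[in LHS]Ysym mxE.
have [L LU [R RU [d' _ dM]]] := int_Smith_normal_form Z.
pose d (i : nat) : int := d'`_i.
pose D : 'M[int]_r := diag_mx (\row_i d i).
have {}dM : Z = L *m D *m R.
  by rewrite dM; congr (_ *m _ *m _); apply/matrixP => i j; rewrite !mxE.
have dP (i : 'I_r) : exists kc : nat * int, [/\ (kc.1 <= e)%N,
    coprime p `|kc.2|%N & d i = (p ^ kc.1)%:Z * kc.2].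
  (* Otherwise the vector v with R v = e_i satisfies the hypothesis on [Y], hence is divisible by
     [p], and so is e_i. *)
  have nd : ~~ (p ^ e.+1 %| `|d i|)%N.
    apply/negP => dvd.
    have RA : map_mx (intr : int -> A) R \in unitmx by apply: map_unitmx_int.
    have /Yp : pdvdmx e.+1 (Y *m (invmx (map_mx intr R) *m delta_mx i (0 : 'I_1))).
      rewrite -ZY dM !map_mxM mulmxA mulmxK // -mulmxA.
      apply: pdvdmx_mull => //; rewrite map_diag_mx mul_diag_mx.
      apply/pdvdmxP => k j; rewrite !mxE mulrC.
      have [ki|ki] := eqVneq k i; last by rewrite mul0r; exact: pdvd0.
      apply: pdvdMl => //; rewrite ki; case: (d i) dvd => n /= dvd; first by rewrite -pmulrn pdvd_nat.
      by rewrite NegzE rmorphN /= pdvdN // -pmulrn pdvd_nat.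
    move/(pdvdmx_mull p_pr N_gt0 (map_mx intr R) N_gt0); rewrite mulKVmx //.
    move/pdvdmxP/(_ i 0); rewrite mxE !eqxx /= => p1.
    by have := unitr1 A; rewrite unitZpow // p1.
  have d0 : (0 < `|d i|)%N by rewrite lt0n; apply: contraNneq nd => ->.
  have [c pc ac] := pfactor_coprime p_pr d0.
  exists (logn p `|d i|, Num.sg (d i) * c%:Z) => /=; split.
  - rewrite leqNgt; apply: contra nd => le.
    by rewrite ac dvdn_mull // dvdn_exp2l.
  - rewrite abszM absz_sg.
    have -> : (d i != 0) by rewrite -absz_gt0.
    by rewrite mul1n.
  - rewrite {1}[d i]numEsg -abszE {1}ac PoszM; lia.
have [f fP] := fin_all_exists dP.
pose c := \prod_j (f j).2.
(* The inverse of [D] with denominators cleared: [p ^ e] makes up for the powers of [p] and [c] for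
   the parts prime to [p]. Modulo [p ^ N] the factor [c] is a unit and is divided out at the end. *)
pose E : 'M[int]_r := diag_mx (\row_i ((p ^ (e - (f i).1))%:Z * \prod_(j | j != i) (f j).2)).
have ED : E *m D = ((p ^ e)%:Z * c)%:M.
  rewrite mulmx_diag; apply/matrixP => i j; rewrite !mxE; congr (_ *+ _).
  have [ke _ ->] := fP i; rewrite /c [RHS](congr1 _ (bigD1 i isT)) /=.
  rewrite mulrACA -PoszM -expnD subnK //; congr (_ * _); exact: mulrC.
have DE : D *m E = ((p ^ e)%:Z * c)%:M by rewrite diag_mxC.
pose X := invmx R *m E *m invmx L.
have XZ : X *m Z = ((p ^ e)%:Z * c)%:M.
  rewrite /X dM !mulmxA mulmxKV // -(mulmxA _ E) ED.
  by rewrite mul_mx_scalar -scalemxAl mulVmx // scalemx1.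
have ZX : Z *m X = ((p ^ e)%:Z * c)%:M.
  rewrite /X dM !mulmxA mulmxK // -(mulmxA _ D) DE.
  by rewrite mul_mx_scalar -scalemxAl mulmxV // scalemx1.
clearbody X.
have cp : coprime p `|c|.
  rewrite /c; elim/big_ind: _ => [|x y cx cy|i _]; first by rewrite coprimen1.
    by rewrite abszM coprimeMr cx cy.
  by have [] := fP i.
have c0 : c != 0.
  apply: contraTneq cp => ->; rewrite absz0 /coprime gcdn0.
  by rewrite neq_ltn prime_gt1 ?orbT.
have Xsym : X^T = X.
  have XTZ : X^T *m Z = ((p ^ e)%:Z * c)%:M.
    by rewrite -[Z]Zsym -trmx_mul ZX tr_scalar_mx.
  have : (X^T - X) *m Z *m X = 0 by rewrite mulmxBl XTZ XZ subrr mul0mx.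
  rewrite -mulmxA ZX mul_mx_scalar => /matrixP H0.
  apply/matrixP => i j; have := H0 i j; rewrite !mxE => /eqP.
  rewrite !mulf_eq0 (negbTE c0) orbF subr_eq0 eqz_nat expn_eq0.
  by rewrite -leqn0 leqNgt prime_gt0 //= => /eqP.
have cU : (c%:~R : A) \is a GRing.unit.
  have nU (n : nat) : coprime p n -> (n%:R : A) \is a GRing.unit.
    by move=> pn; rewrite unitZpE ?expp_gt1 // coprime_pexpl.
  case: (c) cp => n /= cp; first by rewrite -pmulrn nU.
  by rewrite NegzE rmorphN /= unitrN -pmulrn nU.
exists ((c%:~R)^-1 *: map_mx intr X).
  by apply/matrixP => i j; rewrite !mxE -[in LHS]Xsym mxE.
rewrite -scalemxAl -{1}ZY -map_mxM XZ map_scalar_mx /= rmorphM /= mulrC.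
by rewrite scale_scalar_mx mulKr // -pmulrn.
Qed.

End SmithForm.

(** * Generating families of finite abelian p-groups *)

Section LinearCombinations.
Variables (p N : nat).
Hypotheses (p_pr : prime p) (N_gt0 : (0 < N)%N).
Local Notation q := (p ^ N)%N.
Local Notation A := 'Z_q.

(** The coefficients act through their integer representatives, so [H] needs no module structure;
    additivity in [u] holds once [H] is killed by the modulus. *)
Definition lin (H : zmodType) r (h : 'I_r -> H) (u : 'rV[A]_r) : H :=
  \sum_i h i *+ (u 0 i : nat).

Definition gens (H : finZmodType) r (h : 'I_r -> H) : bool :=
  [forall y, exists u, lin h u == y].

Lemma gensP (H : finZmodType) r (h : 'I_r -> H) :
  reflect (forall y, exists u, lin h u = y) (gens h).
Proof.
apply: (iffP forallP) => hP y.
  by have /existsP[u /eqP] := hP y; exists u.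
by have [u hu] := hP y; apply/existsP; exists u; apply/eqP.
Qed.

Lemma addmorph0 (H K : zmodType) (f : H -> K) : {morph f : x y / x + y} -> f 0 = 0.
Proof. by move=> fD; apply: (addrI (f 0)); rewrite -fD !addr0. Qed.

Lemma addmorphMn (H K : zmodType) (f : H -> K) : {morph f : x y / x + y} ->
  forall x n, f (x *+ n) = f x *+ n.
Proof.
by move=> fD x; elim=> [|n IH]; rewrite ?mulr0n ?addmorph0 // !mulrS fD IH.
Qed.

Lemma addmorph_lin (H K : zmodType) (f : H -> K) r (h : 'I_r -> H) (u : 'rV[A]_r) :
  {morph f : x y / x + y} -> f (lin h u) = lin (f \o h) u.
Proof.
move=> fD; rewrite /lin (big_morph f fD (addmorph0 fD)).
by apply: eq_bigr => i _; rewrite addmorphMn.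
Qed.

Lemma eq_lin (H : zmodType) r (h k : 'I_r -> H) : h =1 k -> lin h =1 lin k.
Proof. by move=> hk u; apply: eq_bigr => i _; rewrite hk. Qed.

Section Killed.
Variable H : finZmodType.
Hypothesis Hq : forall x : H, x *+ q = 0.

Lemma mulrn_modq (x : H) n : x *+ (n %% q) = x *+ n.
Proof. by rewrite [in RHS](divn_eq n q) mulrnDr mulnC mulrnA Hq mul0rn add0r. Qed.

Lemma mulrn_addZ (x : H) (a b : A) : x *+ ((a + b)%R : A) = x *+ a + x *+ b.
Proof. by rewrite val_addZ // mulrn_modq mulrnDr. Qed.

Lemma mulrn_mulZ (x : H) (a b : A) : x *+ ((a * b)%R : A) = x *+ a *+ b.
Proof. by rewrite val_mulZ // mulrn_modq mulrnA. Qed.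

Lemma mulrn_natZ (x : H) n : x *+ (n%:R : A) = x *+ n.
Proof. by rewrite val_natZ // mulrn_modq. Qed.

Lemma lin0 r (h : 'I_r -> H) : lin h 0 = 0.
Proof. by rewrite /lin big1 // => i _; rewrite mxE mulr0n. Qed.

Lemma linD r (h : 'I_r -> H) u v : lin h (u + v) = lin h u + lin h v.
Proof.
by rewrite /lin -big_split; apply: eq_bigr => i _; rewrite mxE mulrn_addZ.
Qed.

Lemma linN r (h : 'I_r -> H) u : lin h (- u) = - lin h u.
Proof. by apply/eqP; rewrite -addr_eq0 -linD addNr lin0. Qed.

Lemma linB r (h : 'I_r -> H) u v : lin h (u - v) = lin h u - lin h v.
Proof. by rewrite linD linN. Qed.

Lemma linZ r (h : 'I_r -> H) a u : lin h (a *: u) = lin h u *+ (a : A).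
Proof.
rewrite /lin -sumrMnl; apply: eq_bigr => i _.
by rewrite mxE mulrC mulrn_mulZ.
Qed.

Lemma lin_sum r (h : 'I_r -> H) (I : finType) (F : I -> 'rV[A]_r) :
  lin h (\sum_i F i) = \sum_i lin h (F i).
Proof. by apply: (big_morph (lin h)); [exact: linD | exact: lin0]. Qed.

Lemma lin_delta r (h : 'I_r -> H) i : lin h (delta_mx 0 i) = h i.
Proof.
rewrite /lin (bigD1 i) //= mxE !eqxx /= (mulrn_natZ _ 1) big1 ?addr0 // => j ji.
by rewrite mxE (negbTE ji) andbF mulr0n.
Qed.

Definition linmx r s (M : 'M[A]_(r, s)) (h : 'I_s -> H) : 'I_r -> H :=
  fun i => lin h (row i M).

Lemma lin_mul r s (h : 'I_s -> H) (u : 'rV[A]_r) (M : 'M[A]_(r, s)) :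
  lin h (u *m M) = lin (linmx M h) u.
Proof.
rewrite mulmx_sum_row lin_sum /lin; apply: eq_bigr => i _.
by rewrite -/(lin h _) linZ.
Qed.

Lemma linmx_mul r s t (h : 'I_s -> H) (L : 'M[A]_(t, r)) (M : 'M[A]_(r, s)) :
  linmx (L *m M) h =1 linmx L (linmx M h).
Proof. by move=> i; rewrite /linmx row_mul lin_mul. Qed.

Lemma linmx1 r (h : 'I_r -> H) : linmx 1%:M h =1 h.
Proof. by move=> i; rewrite /linmx row1 lin_delta. Qed.

Lemma eq_linmx r s (M : 'M[A]_(r, s)) (h k : 'I_s -> H) :
  h =1 k -> linmx M h =1 linmx M k.
Proof. by move=> hk i; apply: eq_lin. Qed.

Lemma gens_linmx r s (h : 'I_s -> H) (M : 'M[A]_(r, s)) (L : 'M[A]_(s, r)) :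
  linmx (L *m M) h =1 h -> gens h -> gens (linmx M h).
Proof.
move=> LM /gensP hP; apply/gensP => y; have [u <-] := hP y.
by exists (u *m L); rewrite -lin_mul -mulmxA lin_mul (eq_lin LM).
Qed.

Lemma gens_coord r s (h : 'I_s -> H) (k : 'I_r -> H) : gens h ->
  exists M : 'M[A]_(r, s), k =1 linmx M h.
Proof.
move=> /gensP hP; have [f fP] := fin_all_exists (fun i => hP (k i)).
by exists (\matrix_i f i) => i; rewrite /linmx rowK.
Qed.

(** Equivalently, the family maps to a basis of H/pH. *)
Definition mingens r (h : 'I_r -> H) : Prop :=
  gens h /\ forall u, lin h u = 0 -> pdvdmx 1 u.

Lemma card_lin_fiber r (h : 'I_r -> H) y : gens h ->
  (#|[set u : 'rV[A]_r | lin h u == y]%SET| * #|H| = q ^ r)%N.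
Proof.
move=> /gensP hP; pose n := #|[set u : 'rV[A]_r | lin h u == 0]%SET|.
have fib z : #|[set u : 'rV[A]_r | lin h u == z]%SET| = n.
  have [v <-] := hP z.
  have inj : injective (fun u : 'rV[A]_r => u + v) by apply: addIr.
  rewrite /n -[RHS](card_imset _ inj); apply: eq_card => u; rewrite inE.
  apply/eqP/imsetP => [uv|[w]].
    by exists (u - v); rewrite ?subrK // inE linB uv subrr.
  by rewrite inE => /eqP w0 ->; rewrite linD w0 add0r.
have := card_mx A 1 r; rewrite card_Zpow // mul1n => <-.
rewrite -[RHS]cardsT -[RHS]sum1_card (partition_big (lin h) xpredT) //=.
rewrite (eq_bigr (fun=> n)) ?sum_nat_const ?fib; first by rewrite mulnC.
by move=> z _; rewrite -(fib z) -sum1_card; apply: eq_bigl => u; rewrite !inE.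
Qed.

Lemma card_linmx_fiber r s (h : 'I_s -> H) (k : 'I_r -> H) : gens h ->
  (#|[set M : 'M[A]_(r, s) | [forall i, linmx M h i == k i]]%SET| * #|H| ^ r
    = q ^ (s * r))%N.
Proof.
move=> hP; pose f (M : 'M[A]_(r, s)) : {ffun 'I_r -> 'rV[A]_s} := [ffun i => row i M].
have finj : injective f.
  by move=> M L /ffunP ML; apply/row_matrixP => i; have := ML i; rewrite !ffunE.
rewrite -(card_imset _ finj).
have -> : #|f @: [set M : 'M[A]_(r, s) | [forall i, linmx M h i == k i]]%SET| =
    #|(family (fun i => [pred u | lin h u == k i]) : simpl_pred {ffun 'I_r -> 'rV[A]_s})|.
  apply: eq_card => g; apply/imsetP/familyP => [[M]|gP].
    by rewrite inE => /forallP MP -> i; rewrite ffunE inE; apply: MP.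
  exists (\matrix_i g i); last by apply/ffunP => i; rewrite ffunE rowK.
  rewrite inE; apply/forallP => i; rewrite /linmx rowK.
  by have /= := gP i; rewrite inE.
rewrite card_family /image_mem foldrE big_map big_enum /=.
rewrite -[X in (#|H| ^ X)%N]card_ord -prod_nat_const -big_split /=.
rewrite (eq_bigr (fun=> q ^ s)%N) ?prod_nat_const ?card_ord ?expnM // => i _.
by rewrite -(card_lin_fiber (k i) hP); congr (_ * _)%N; apply: eq_card => u; rewrite !inE.
Qed.

(** Nakayama's argument: if [k] generates, going from [h] to [k] and back is the identity up to
    relations of [h], hence modulo [p]. *)
Lemma mingens_unit r (h k : 'I_r -> H) (M : 'M[A]_r) : mingens h -> k =1 linmx M h ->
  gens k = (M \in unitmx).
Proof.
move=> [hg hr] kM; apply/idP/idP => [kg|MU].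
  have [L hL] := gens_coord h kg.
  have LM : L *m M \in unitmx.
    apply: unitmx_congr1 => //; apply/pdvdmxP => i j.
    have /hr/pdvdmxP/(_ 0 j) : lin h (row i (L *m M - 1%:M)) = 0.
      rewrite linearB /= linB row1 lin_delta -[lin h _]/(linmx _ h i) linmx_mul.
      by rewrite -(eq_linmx L kM) -hL subrr.
    by rewrite !mxE.
  by move: LM; rewrite unitmx_mul => /andP[].
have : gens (linmx M h).
  apply: (gens_linmx (L := invmx M)) => //.
  by rewrite mulVmx //; apply: linmx1.
move=> /gensP gM; apply/gensP => y; have [u <-] := gM y.
by exists u; apply: eq_lin.
Qed.

Lemma mingens_all r (h k : 'I_r -> H) : mingens h -> gens k -> mingens k.
Proof.
move=> hm kg; split=> // u; have [M kM] := gens_coord k (proj1 hm).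
have MU : M \in unitmx by rewrite -(mingens_unit hm kM).
rewrite (eq_lin kM) -lin_mul => /(proj2 hm).
move/(pdvdmx_mulr p_pr N_gt0 (invmx M) N_gt0).
by rewrite mulmxK.
Qed.

Definition stdmx g k : 'M[A]_(g + k, g) := col_mx 1%:M 0.

(** Normal form of a surjection: up to a change of basis every generating family is (b_1, ..., b_g,
    0, ..., 0). The coordinate matrix has a left inverse, so its Smith form has a unit diagonal. *)
Lemma gens_std g r (b : 'I_g -> H) (F : 'I_r -> H) : mingens b -> gens F ->
  exists k (E : r = (g + k)%N), exists2 U : 'M[A]_(g + k), U \in unitmx &
    forall i, F i = lin b (row (cast_ord E i) (U *m stdmx g k)).
Proof.
move=> [bg br] Fg; have [M FM] := gens_coord F bg; have [L bL] := gens_coord b Fg.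
have LM : L *m M \in unitmx.
  apply: unitmx_congr1 => //; apply/pdvdmxP => i j.
  have /br/pdvdmxP/(_ 0 j) : lin b (row i (L *m M - 1%:M)) = 0.
    rewrite linearB /= linB row1 lin_delta -[lin b _]/(linmx _ b i) linmx_mul.
    by rewrite -(eq_linmx L FM) -bL subrr.
  by rewrite !mxE.
have [U [V [d [UU VU MD]]]] := smith_diag M.
set S := (\matrix_(i, j) _) in MD.
(* A left inverse of the diagonal form [S]. Its existence rules out zero columns, whence [g <= r],
   and makes each diagonal entry a unit. *)
pose T := V *m invmx (L *m M) *m L *m U.
have TS : T *m S = 1%:M.
  have : V *m (invmx (L *m M) *m (L *m M)) *m invmx V = 1%:M.
    by rewrite mulVmx // mulmx1 mulmxV.
  by rewrite {2}MD /T !mulmxA mulmxK.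
clearbody T.
have TSE j : \sum_i T j i * S i j = 1.
  by have /matrixP/(_ j j) := TS; rewrite !mxE eqxx.
have gr : (g <= r)%N.
  rewrite leqNgt; apply/negP => rg; have := TSE (Ordinal rg).
  rewrite big1 => [/eqP|i _]; first by rewrite eq_sym oner_eq0.
  by rewrite mxE /= (ltn_eqF (ltn_ord i)) mulr0n mulr0.
exists (r - g)%N, (esym (subnKC gr)).
move: (r - g)%N (esym (subnKC gr)) => k E; subst r.
have dU (j : 'I_g) : d j \is a GRing.unit.
  have := TSE j; rewrite (bigD1 (lshift k j)) //= big1 => [|i ij].
    rewrite addr0 mxE eqxx mulr1n => Td; apply/unitrPr.
    by exists (T j (lshift k j)); rewrite mulrC.
  have /negbTE ij' : i != j :> nat by apply: contra ij => /eqP ?; apply/eqP/val_inj.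
  by rewrite mxE ij' mulr0n mulr0.
(* The unit diagonal and [V] touch only the first [g] coordinates, so they pass to the left factor
   as an invertible block. *)
pose Q : 'M[A]_g := diag_mx (\row_j d j) *m V.
have QU : Q \in unitmx.
  rewrite unitmx_mul VU andbT unitmxE det_diag unitr_prod // => i _.
  by rewrite mxE.
exists (U *m block_mx Q 0 0 1%:M).
  rewrite unitmx_mul UU unitmxE det_ublock det1 mulr1 -unitmxE //.
move=> i; rewrite cast_ord_id FM /linmx; congr (lin b (row i _)).
rewrite MD -!mulmxA; congr (_ *m _).
rewrite /stdmx mul_block_col !mulmx0 !mul0mx mulmx1 !addr0 /Q.
apply/matrixP => i' j'; rewrite !mxE; case: splitP => i1 i1E.
  rewrite mxE; apply: eq_bigr => l _; rewrite !mxE i1E -val_eqE /=.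
  by case: eqVneq.
rewrite mxE big1 // => l _; rewrite mxE i1E.
by rewrite gtn_eqF ?mulr0n ?mul0r // ltn_addr.
Qed.

Lemma stdmx_mul g k n (U : 'M[A]_(n, g + k)) : U *m stdmx g k = lsubmx U.
Proof.
by rewrite -{1}[U]hsubmxK /stdmx mul_row_col mulmx1 mulmx0 addr0.
Qed.

(** Orbit-stabilizer: by [gens_std] the invertible matrices act transitively on the generating
    families. *)
Lemma card_gens g k (b : 'I_g -> H) : mingens b ->
  (#|[set F : {ffun 'I_(g + k) -> H} | gens F]%SET| *
    (q ^ (g * (g + k)) * q ^ (g * k) * cardGL p N k) =
   cardGL p N (g + k) * #|H| ^ (g + k))%N.
Proof.
move=> bm; have [bg br] := bm.
pose f (U : 'M[A]_(g + k)) : {ffun 'I_(g + k) -> H} :=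
  [ffun i => lin b (row i (U *m stdmx g k))].
have fE U : f U =1 linmx (U *m stdmx g k) b by move=> i; rewrite ffunE.
have fgen U : U \in unitmx -> gens (f U).
  move=> UU; apply/gensP => y; have /gensP/(_ y)[u <-] := bg.
  exists (row_mx u 0 *m invmx U); rewrite (eq_lin (fE U)) -lin_mul.
  by rewrite mulmxA mulmxKV // stdmx_mul row_mxKl.
have fsurj (F : {ffun 'I_(g + k) -> H}) : gens F -> exists2 U, U \in unitmx & f U = F.
  move=> Fg; have [k' [E [U UU FU]]] := gens_std bm Fg.
  have kk : k = k' by apply: (@addnI g).
  subst k'; exists U => //; apply/ffunP => i.
  by rewrite ffunE FU; congr (lin b (row _ _)); apply: val_inj.
pose F0 : {ffun 'I_(g + k) -> H} := f 1%:M.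
pose n := #|[set U | (U \in unitmx) && (f U == F0)]%SET|.
have fib (F : {ffun 'I_(g + k) -> H}) : gens F -> #|[set U | (U \in unitmx) && (f U == F)]%SET| = n.
  move=> /fsurj[V VU <-].
  have inj : injective (mulmx V : 'M[A]_(g + k) -> _).
    by apply: (can_inj (g := mulmx (invmx V))) => M; rewrite mulKmx.
  rewrite /n -[RHS](card_imset _ inj); apply: eq_card => U; rewrite inE.
  have fM (L : 'M[A]_(g + k)) (M : 'M[A]_(g + k)) : f (L *m M) =1 linmx L (f M).
    by move=> i; rewrite fE -mulmxA linmx_mul (eq_linmx L (fE M)).
  apply/andP/imsetP => [[UU /eqP UV]|[W]].
    exists (invmx V *m U); last by rewrite mulKVmx.
    rewrite inE unitmx_mul unitmx_inv VU UU /=; apply/eqP/ffunP => i.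
    by rewrite fM UV -fM mulVmx.
  rewrite inE => /andP[WU /eqP W0] ->; split; first by rewrite unitmx_mul VU.
  by apply/eqP/ffunP => i; rewrite fM W0 /F0 -fM mulmx1.
have cGL : cardGL p N (g + k) = (#|[set F : {ffun 'I_(g + k) -> H} | gens F]%SET| * n)%N.
  rewrite /cardGL -sum1_card (partition_big f (fun F : {ffun 'I_(g + k) -> H} => gens F)).
    rewrite /= (eq_bigr (fun=> n)) ?sum_nat_const ?cardsE // => F Fg.
    by rewrite -(fib F Fg) -sum1_card; apply: eq_bigl => U; rewrite !inE.
  by move=> U; rewrite !inE => /fgen.
suff nE : (n * #|H| ^ (g + k) = q ^ (g * (g + k)) * q ^ (g * k) * cardGL p N k)%N.
  by rewrite cGL -nE mulnA.
(* The stabilizer of the standard surjection: its left columns are determined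
   modulo the relations, hence congruent to a unit column block modulo p, so
   that only the lower right corner has to be invertible. *)
pose b0 : {ffun 'I_(g + k) -> H} := [ffun i => linmx (stdmx g k) b i].
pose P1 : {set 'M[A]_(g + k, g)} := [set M | [forall i, linmx M b i == b0 i]]%SET.
pose P2 : {set 'M[A]_k} := [set M | M \in unitmx]%SET.
pose h (x : 'M[A]_(g + k, g) * ('M[A]_(g, k) * 'M[A]_k)) : 'M[A]_(g + k) :=
  row_mx x.1 (col_mx x.2.1 x.2.2).
have hinj : injective h.
  by move=> [a [c d]] [a' [c' d']] /eq_row_mx /= [-> /eq_col_mx[-> ->]].
have -> : n = #|finset.setX P1 (finset.setX [set: 'M[A]_(g, k)]%SET P2)|.
  rewrite -[RHS](card_imset _ hinj); apply: eq_card => U; rewrite inE.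
  have key (M : 'M[A]_(g + k)) : lsubmx M \in P1 -> (M \in unitmx) = (dsubmx (rsubmx M) \in unitmx).
    rewrite inE => /forallP MP.
    have M1 : pdvdmx 1 (lsubmx M - stdmx g k).
      apply/pdvdmxP => i j.
      have /br/pdvdmxP/(_ 0 j) : lin b (row i (lsubmx M - stdmx g k)) = 0.
        rewrite linearB /= linB; apply/eqP; rewrite subr_eq0.
        by have := MP i; rewrite ffunE.
      by rewrite !mxE.
    exact: unitmx_congr_block.
  have Ul : (f U == F0) = (lsubmx U \in P1).
    rewrite inE; apply/eqP/forallP => [/ffunP UF i|UP].
      by have := UF i; rewrite !ffunE /linmx stdmx_mul mul1mx => ->.
    by apply/ffunP => i; have := eqP (UP i); rewrite !ffunE /linmx stdmx_mul mul1mx.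
  rewrite Ul; apply/andP/imsetP => [[UU UP]|[[M [c d]]]].
    exists (lsubmx U, (usubmx (rsubmx U), dsubmx (rsubmx U))); last by rewrite /h /= vsubmxK hsubmxK.
    by rewrite finset.in_setX UP finset.in_setX finset.in_setT inE -key.
  rewrite finset.in_setX => /andP[MP]; rewrite finset.in_setX => /andP[_].
  rewrite inE => dU ->; rewrite /h /= row_mxKl; split=> //.
  by rewrite key ?row_mxKl // row_mxKr col_mxKd.
rewrite !cardsX cardsT card_mx card_Zpow // mulnAC (card_linmx_fiber b0 bg).
by rewrite -!mulnA expnM.
Qed.

End Killed.
End LinearCombinations.

(** * Pairs of symmetric matrices with product p^e *)

Lemma card_rows (T : finType) r (S : 'I_r -> {set T}) :
  #|[set u : 'rV[T]_r | [forall i, u 0 i \in S i]]%SET| = (\prod_(i < r) #|S i|)%N.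
Proof.
pose f (u : 'rV[T]_r) : {ffun 'I_r -> T} := [ffun i => u 0 i].
have finj : injective f.
  by move=> u v /ffunP uv; apply/rowP => i; have := uv i; rewrite !ffunE.
rewrite -(card_imset _ finj).
transitivity #|(family (fun i => [pred y in S i]) : simpl_pred {ffun 'I_r -> T})|.
  apply: eq_card => g; apply/imsetP/familyP => [[u]|gP].
    by rewrite inE => /forallP uP -> i; rewrite ffunE inE; apply: uP.
  exists (\row_i g i); last by apply/ffunP => i; rewrite ffunE mxE.
  by rewrite inE; apply/forallP => i; rewrite mxE; have /= := gP i; rewrite inE.
rewrite card_family /image_mem foldrE big_map big_enum /=.
by apply: eq_bigr => i _; apply: eq_card.
Qed.

(** An index lies in [r - 1] off-diagonal pairs and counts twice on the diagonal, [r + 1] times in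
    all. This is the origin of the exponent in the Jacobian of inversion. *)
Lemma sum_pairs_add r (x : 'I_r -> nat) :
  (\sum_(i < r) \sum_(j < r | i <= j) (x i + x j) = r.+1 * \sum_(i < r) x i)%N.
Proof.
transitivity (\sum_(i < r) \sum_(j < r) ((i <= j) * x i + (j <= i) * x i))%N.
  transitivity (\sum_(i < r) \sum_(j < r) (i <= j) * x i +
                \sum_(i < r) \sum_(j < r) (i <= j) * x j)%N.
    rewrite -big_split; apply: eq_bigr => i _; rewrite -big_split big_mkcond /=.
    by apply: eq_bigr => j _; case: ifP => _; rewrite ?mul1n ?mul0n.
  rewrite [X in (_ + X)%N]exchange_big /= -big_split; apply: eq_bigr => i _.
  by rewrite -big_split.
rewrite big_distrr /=; apply: eq_bigr => i _.
rewrite (eq_bigr (fun j : 'I_r => x i + (j == i) * x i)%N); last first.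
  move=> j _; rewrite -mulnDl -[X in _ = (X + _)%N]mul1n -mulnDl; congr (_ * _)%N.
  by rewrite -val_eqE /=; case: ltngtP.
rewrite big_split /= sum_nat_const card_ord mulSn addnC; congr (_ + _)%N.
rewrite (bigD1 i) //= eqxx mul1n big1 ?addn0 // => j /negbTE ->.
by rewrite mul0n.
Qed.

(** The number r(r+1)/2 of free entries of a symmetric matrix, kept as a double sum so that
    exponents can be compared entry by entry. *)
Definition npairs r : nat := (\sum_(i < r) \sum_(j < r | i <= j) 1)%N.

(** * Fractions in Q/Z *)

Section QuotientQZ.
Local Open Scope quotient_scope.

Definition qz (x : rat) : QmodZ := \pi_QmodZ x.

Lemma qzD x y : qz (x + y) = qz x + qz y.
Proof. exact: raddfD. Qed.

Lemma qzMn x n : qz (x *+ n) = qz x *+ n.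
Proof. exact: raddfMn. Qed.

Lemma qz_eq0 x : (qz x == 0) = (x \is a Num.int).
Proof.
have := @Quotient.idealrBE _ (GRing.ZmodClosed.clone rat Num.int_num_subdef _) x 0.
rewrite subr0 => E; have <- : qz 0 = 0 by exact: raddf0.
exact: esym E.
Qed.

Lemma qz_surj y : exists x, y = qz x.
Proof. by exists (generic_quotient.repr y); rewrite /qz reprK. Qed.

End QuotientQZ.

Section Fractions.
Variable m : nat.
Hypothesis m_gt0 : (0 < m)%N.

Definition frac (n : nat) : QmodZ := qz (n%:R / m%:R).

Lemma fracD a b : frac (a + b) = frac a + frac b.
Proof. by rewrite /frac natrD mulrDl qzD. Qed.

Lemma fracM a b : frac (a * b) = frac a *+ b.
Proof. by rewrite /frac -qzMn natrM mulrAC mulr_natr. Qed.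

Lemma frac_eq0 n : (frac n == 0) = (m %| n)%N.
Proof.
have m0 : (m%:R : rat) != 0 by rewrite pnatr_eq0 -lt0n.
rewrite /frac qz_eq0; apply/idP/idP => [/intrP[z zE]|/dvdnP[k ->]]; last first.
  by rewrite natrM mulfK // intr_nat.
have : (n%:Z)%:~R = (z * m%:Z)%:~R :> rat.
  by rewrite intrM -zE -!pmulrn divfK.
by move/intr_inj => nz; apply/dvdnP; exists `|z|%N; lia.
Qed.

Lemma frac_surj (y : QmodZ) : y *+ m = 0 -> exists n, y = frac n.
Proof.
have [x ->] := qz_surj y.
have m0 : (m%:R : rat) != 0 by rewrite pnatr_eq0 -lt0n.
rewrite -qzMn => /eqP; rewrite qz_eq0 => /intrP[z zE].
exists `|(z %% m%:Z)%Z|%N; apply/eqP; rewrite -subr_eq0 /frac.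
have mz0 : m%:Z != 0 by rewrite eqz_nat -lt0n.
(* With x = z/m, Euclidean division of z splits off the integer part, which vanishes in Q/Z. *)
have -> : qz x = qz ((z %/ m%:Z)%Z%:~R) + frac `|(z %% m%:Z)%Z|%N.
  rewrite /frac -qzD; congr qz; apply: (mulIf m0); rewrite mulrDl divfK //.
  rewrite mulr_natr zE {1}(divz_eq z m%:Z) intrD intrM; congr (_ * _ + _).
  have := modz_ge0 z mz0; case: (z %% m%:Z)%Z => // n _.
rewrite /frac addrK; have := qz_eq0 ((z %/ m%:Z)%Z%:~R) => ->.
exact: intr_int.
Qed.

End Fractions.

Section Pairings.
Variables (p e : nat).
Hypotheses (p_pr : prime p) (e_gt0 : (0 < e)%N).
Local Notation N := (e + e)%N.
Local Notation m := (p ^ e)%N.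
Local Notation A := 'Z_(p ^ (e + e)).

Let N_gt0 : (0 < N)%N. Proof. by rewrite addn_gt0 e_gt0. Qed.
Let eN : (e <= N)%N. Proof. exact: leq_addr. Qed.
Let eSN : (e < N)%N. Proof. by rewrite -addn1 leq_add2l. Qed.
Let m_gt0 : (0 < m)%N. Proof. by rewrite expn_gt0 prime_gt0. Qed.

(** The denominator is p^e although [a] lives modulo p^(2e): exactly the multiples of p^e are
    lost. *)
Definition zfrac (a : A) : QmodZ := frac m a.

Lemma frac_modq n : frac m (n %% p ^ (e + e)) = frac m n.
Proof.
rewrite [in RHS](divn_eq n (p ^ (e + e))) fracD -[LHS]add0r; congr (_ + _).
apply/esym/eqP; rewrite frac_eq0 // dvdn_mull //.
by rewrite dvdn_exp2l.
Qed.

Lemma zfracD a b : zfrac (a + b) = zfrac a + zfrac b.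
Proof. by rewrite /zfrac val_addZ // frac_modq fracD. Qed.

Lemma zfracM a b : zfrac (a * b) = zfrac a *+ (b : A).
Proof. by rewrite /zfrac val_mulZ // frac_modq fracM. Qed.

Lemma zfrac_eq0 a : (zfrac a == 0) = pdvd e a.
Proof. by rewrite /zfrac frac_eq0. Qed.

Lemma zfrac_sum (I : finType) (F : I -> A) : zfrac (\sum_i F i) = \sum_i zfrac (F i).
Proof.
apply: (big_morph zfrac zfracD); apply/eqP; rewrite zfrac_eq0; exact: pdvd0.
Qed.

Lemma zfrac_eq a b : (zfrac a == zfrac b) = pdvd e (a - b).
Proof.
have -> : zfrac a = zfrac (a - b) + zfrac b by rewrite -zfracD subrK.
by rewrite -[X in _ == X]add0r (inj_eq (addIr _)) zfrac_eq0.
Qed.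

Lemma zfrac_surj y : y *+ m = 0 -> exists a, y = zfrac a.
Proof.
by move=> /(frac_surj m_gt0)[n ->]; exists n%:R; rewrite /zfrac val_natZ // frac_modq.
Qed.

Lemma pdvdmx_scale k r s (M : 'M[A]_(r, s)) : (k <= N)%N -> pdvdmx k M ->
  exists M', M = (p ^ k)%:R *: M'.
Proof.
move=> kN /pdvdmxP MP.
have H i : exists g : 'I_s -> A, forall j, M i j = (p ^ k)%:R * g j.
  by apply: (fin_all_exists (P := fun j b => M i j = (p ^ k)%:R * b)) => j; apply/pdvdP.
have [f fP] := fin_all_exists H.
by exists (\matrix_(i, j) f i j); apply/matrixP => i j; rewrite !mxE.
Qed.

Lemma scale_ann r s (M : 'M[A]_(r, s)) : m%:R *: M = 0 -> pdvdmx e M.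
Proof.
move=> /matrixP M0; apply/pdvdmxP => i j; rewrite pdvd_ann // addKn.
by have := M0 i j; rewrite !mxE => ->.
Qed.

(** [Y] stands for p^e X^-1. *)
Definition quasi_inv r (X Y : 'M[A]_r) : Prop :=
  [/\ X^T = X, Y^T = Y & X *m Y = (m%:R)%:M].

Lemma quasi_invC r (X Y : 'M[A]_r) : quasi_inv X Y -> Y *m X = (m%:R)%:M.
Proof.
by move=> [Xs Ys XY]; rewrite -Xs -Ys -trmx_mul XY tr_scalar_mx.
Qed.

(** The radical of the form with Gram matrix Y/p^e is the row space of [X]. If u Y = p^e w,
    multiplying by [X] gives p^e (u - w X) = 0, and what p^e kills is a multiple of p^e = Y X. *)
Lemma quasi_inv_rel r (X Y : 'M[A]_r) (u : 'rV_r) : quasi_inv X Y ->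
  pdvdmx e (u *m Y) <-> exists w, u = w *m X.
Proof.
move=> XYP; have YX := quasi_invC XYP; have [_ _ XY] := XYP.
split=> [|[w ->]]; last first.
  rewrite -mulmxA XY mul_mx_scalar; apply/pdvdmxP => i j; rewrite mxE.
  by apply/pdvdP => //; exists (w i j).
move=> /(pdvdmx_scale eN)[w uw].
have /scale_ann/(pdvdmx_scale eN)[z uz] : m%:R *: (u - w *m X) = 0.
  by rewrite scalerBr -mul_mx_scalar -YX mulmxA uw scalemxAl subrr.
exists (w + z *m Y); rewrite mulmxDl -mulmxA YX mul_mx_scalar -uz.
by rewrite addrC subrK.
Qed.

(** By symmetry the entry (i, j) has to be killed by both p^(k_i) and p^(k_j). *)
Lemma card_diag_ann r (k : 'I_r -> nat) : (forall i, (k i <= N)%N) ->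
  #|[set Z : 'M[A]_r | (Z^T == Z) && (diag_mx (\row_i (p ^ k i)%:R) *m Z == 0)]%SET|
  = (p ^ (\sum_(i < r) \sum_(j < r | i <= j) minn (k i) (k j)))%N.
Proof.
move=> kN.
pose S i j := [set a : A | pdvd (N - minn (k i) (k j)) a]%SET.
have cS i j : #|S i j| = (p ^ minn (k i) (k j))%N.
  by rewrite card_pdvd ?leq_subr // subKn // geq_min kN.
rewrite expn_sum; under eq_bigr do rewrite expn_sum.
under eq_bigr do under eq_bigr do rewrite -cS.
rewrite -card_symmetric; last by move=> i j; rewrite /S minnC.
apply: eq_card => Z; rewrite !inE; have [Zs|//] := eqVneq Z^T Z; rewrite /=.
have ann i j : (diag_mx (\row_i (p ^ k i)%:R) *m Z) i j = 0 <-> pdvd (N - k i) (Z i j).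
  rewrite mul_diag_mx !mxE pdvd_ann ?leq_subr // subKn //.
  by split=> /eqP.
apply/eqP/forallP => [/matrixP H i|H].
  apply/forallP => j; rewrite inE; case: (leqP (k i) (k j)) => _.
    by apply/ann; rewrite H mxE.
  by rewrite -Zs mxE; apply/ann; rewrite H mxE.
apply/matrixP => i j; rewrite [RHS]mxE; apply/ann.
have := forallP (H i) j; rewrite inE; apply: pdvd_leq.
by rewrite leq_sub2l // geq_minl.
Qed.

(** The number of symmetric quasi-inverses of [X] as soon as there is one, since they form a
    coset. *)
Definition annsym r (X : 'M[A]_r) : nat :=
  #|[set Z : 'M[A]_r | (Z^T == Z) && (X *m Z == 0)]%SET|.

(** Only the right factor acts on the solutions, by Z -> U Z U^T, which preserves symmetry. *)
Lemma annsym_equiv r (X P U W : 'M[A]_r) : U \in unitmx -> W \in unitmx ->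
  X = W *m P *m U -> annsym X = annsym P.
Proof.
move=> UU WU XE.
pose f (Z : 'M[A]_r) := U *m Z *m U^T.
have UTU : U^T \in unitmx by rewrite unitmx_tr.
have finj : injective f.
  by move=> Z Z' /(can_inj (mulmxK UTU)) /(can_inj (mulKmx UU)).
rewrite /annsym -(card_imset _ finj); apply: eq_card => Z; rewrite inE.
have fT Z' : (f Z')^T = f Z'^T by rewrite /f !trmx_mul trmxK mulmxA.
apply/imsetP/andP => [[Z']|[/eqP Zs /eqP PZ]].
  rewrite inE => /andP[/eqP Zs /eqP XZ] ->; rewrite fT Zs; split=> //.
  apply/eqP; rewrite /f !mulmxA -[RHS](mul0mx _ U^T) -[0 in RHS](mulmx0 _ (invmx W)) -XZ XE.
  by rewrite !mulmxA mulVmx // mul1mx.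
exists (invmx U *m Z *m invmx U^T); last first.
  by rewrite /f !mulmxA mulmxV // mul1mx mulmxKV.
rewrite inE !trmx_mul !trmx_inv trmxK Zs mulmxA eqxx /= XE !mulmxA.
by rewrite mulmxK // -(mulmxA W) PZ mulmx0 mul0mx.
Qed.

(** The Jacobian of inversion at finite level, [n] being the order of the presented group. With [Y]
    equivalent to diag(p^(k_i)) and [X] to diag(p^(e-k_i)), it is the identity min(k_i, k_j) + (e -
    k_i) + (e - k_j) = e + min(e - k_i, e - k_j), summed over pairs. *)
Lemma annsym_pair r (X Y : 'M[A]_r) (n : nat) : quasi_inv X Y ->
  (#|[set u : 'rV[A]_r | pdvdmx e (u *m Y)]%SET| * n = (p ^ N) ^ r)%N ->
  (annsym Y * n ^ r.+1 = m ^ npairs r * annsym X)%N.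
Proof.
move=> XYP nE; have [Xs Ys XY] := XYP.
have [U [V [k [UU VU kN YE]]]] := smith_pdiag p_pr N_gt0 Y.
set P := diag_mx _ in YE.
have [X1 X1D] : exists X1, X1 = V *m X *m U by exists (V *m X *m U).
have X1P : X1 *m P = (m%:R)%:M.
  have : V *m (X *m Y) *m invmx V = (m%:R)%:M.
    by rewrite XY mul_mx_scalar -scalemxAl mulmxV // scalemx1.
  by rewrite YE X1D !mulmxA mulmxK.
have X1E i j : X1 i j * (p ^ k j)%:R = m%:R *+ (i == j).
  by have /matrixP/(_ i j) := X1P; rewrite mul_mx_diag !mxE => <-.
have ke i : (k i <= e)%N.
  rewrite leqNgt; apply/negP => ek; have := X1E i i; rewrite eqxx mulr1n => E.
  have : pdvd e.+1 (m%:R : A).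
    rewrite -E; apply: pdvd_leq ek _; apply: pdvdMl => //.
    by rewrite pdvd_nat.
  by rewrite pdvd_nat // dvdn_Pexp2l ?prime_gt1 // ltnn.
pose P' : 'M[A]_r := diag_mx (\row_i (p ^ (e - k i))%:R).
(* [X1P] fixes [X1] only up to the annihilator of [P]; that ambiguity amounts to a left factor
   congruent to 1 modulo p^e, collected in [W]. *)
have X1Q i j : exists c, X1 i j = (1%:M i j + m%:R * c) * (p ^ (e - k j))%:R.
  have : pdvd (N - k j) (X1 i j - 1%:M i j * (p ^ (e - k j))%:R).
    rewrite pdvd_ann ?leq_subr // subKn // mulrC mulrBl X1E mxE.
    rewrite mulrnAl mul1r mulrnAl -natrM -expnD subnK //.
    by rewrite subrr.
  move/(pdvdP p_pr N_gt0 _ (leq_subr _ _)) => [c cE]; exists c.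
  rewrite mulrDl -mulrA [c * _]mulrC mulrA -natrM -expnD.
  by rewrite addnBA // -cE addrC subrK.
have Q1 i : exists g : 'I_r -> A, forall j,
    X1 i j = (1%:M i j + m%:R * g j) * (p ^ (e - k j))%:R.
  exact: fin_all_exists (X1Q i).
have [Q QE] := fin_all_exists Q1.
pose W : 'M[A]_r := 1%:M + m%:R *: (\matrix_(i, j) Q i j).
have X1W : X1 = W *m P'.
  by apply/matrixP => i j; rewrite QE mul_mx_diag !mxE.
have WU : W \in unitmx.
  apply: unitmx_congr1 => //; rewrite /W addrAC subrr add0r; apply/pdvdmxP => i j.
  rewrite mxE mulrC; apply: pdvdMl => //; rewrite pdvd_nat //.
  by rewrite dvdn_exp2l.
have aX : annsym X = annsym P'.
  apply: (annsym_equiv (U := invmx U) (W := invmx V *m W)).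
  - by rewrite unitmx_inv.
  - by rewrite unitmx_mul unitmx_inv VU.
  by rewrite -(mulmxA _ W) -X1W X1D !mulmxA mulVmx // mul1mx mulmxK.
have aY : annsym Y = annsym P by apply: (annsym_equiv (U := V) (W := U)).
have k'N i : (e - k i <= N)%N by apply: leq_trans (leq_subr _ _) eN.
have cU : #|[set u : 'rV[A]_r | pdvdmx e (u *m Y)]%SET| =
    (\prod_(i < r) p ^ (N - (e - k i)))%N.
  have finj : injective (fun u : 'rV[A]_r => u *m U) by apply: (can_inj (mulmxK UU)).
  rewrite -(card_imset _ finj).
  under eq_bigr do rewrite -card_pdvd //.
  rewrite -card_rows; apply: eq_card => v; rewrite inE.
  have vP (w : 'rV[A]_r) : pdvdmx e (w *m invmx U *m Y) = [forall i, w 0 i \in [set a : A | pdvd (e - k i) a]%SET].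
    have -> : pdvdmx e (w *m invmx U *m Y) = pdvdmx e (w *m P).
      rewrite YE !mulmxA mulmxKV //; apply/idP/idP; last exact: pdvdmx_mulr.
      by move/(pdvdmx_mulr p_pr N_gt0 (invmx V) eN); rewrite mulmxK.
    apply/pdvdmxP/forallP => H i; last first.
      move=> j; rewrite (ord1 i) mul_mx_diag !mxE; have := H j; rewrite inE.
      rewrite !pdvd_ann // [_ * (p ^ k j)%:R]mulrC mulrA -natrM -expnD.
      by rewrite (_ : (N - (e - k j) = N - e + k j)%N) //; have := ke j; lia.
    have := H 0 i; rewrite mul_mx_diag !mxE inE.
    rewrite !pdvd_ann // [_ * (p ^ k i)%:R]mulrC mulrA -natrM -expnD.
    by rewrite (_ : (N - (e - k i) = N - e + k i)%N) //; have := ke i; lia.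
  apply/imsetP/idP => [[u]|H].
    by rewrite inE => uY ->; rewrite -vP mulmxK.
  by exists (v *m invmx U); rewrite ?mulmxKV // inE vP.
have nE' : n = (p ^ \sum_i (e - k i))%N.
  apply/eqP; rewrite -(@eqn_pmul2l #|[set u : 'rV[A]_r | pdvdmx e (u *m Y)]%SET|).
    rewrite nE cU expn_sum -big_split /=; apply/eqP.
    under eq_bigr do rewrite -expnD subnK //.
    by rewrite prod_nat_const card_ord.
  by rewrite cU prodn_gt0 // => i; rewrite expn_gt0 prime_gt0.
rewrite aX aY /annsym !card_diag_ann // nE' -!expnM -!expnD; congr (p ^ _)%N.
rewrite [(_ * r.+1)%N]mulnC -sum_pairs_add /npairs big_distrr /= -!big_split /=.
apply: eq_bigr => i _; rewrite big_distrr /= -!big_split /=; apply: eq_bigr => j _.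
by have := ke i; have := ke j; rewrite /minn; do 2 case: ifP; lia.
Qed.

End Pairings.

(** * Presentations of groups with a pairing *)

Section Extension.
Variables (p N : nat).
Hypotheses (p_pr : prime p) (N_gt0 : (0 < N)%N).
Local Notation q := (p ^ N)%N.
Variables (H K : finZmodType).
Hypotheses (Hq : forall x : H, x *+ q = 0) (Kq : forall x : K, x *+ q = 0).

Lemma extend_gens r (h : 'I_r -> H) (F : 'I_r -> K) : gens p N h ->
  (forall u : 'rV['Z_q]_r, lin h u = 0 -> lin F u = 0) ->
  exists2 f : H -> K, {morph f : x y / x + y} &
    forall u : 'rV['Z_q]_r, f (lin h u) = lin F u.
Proof.
move=> /gensP hP hF.
have [g gP] := fin_all_exists hP.
have fE (u : 'rV['Z_q]_r) : lin F (g (lin h u)) = lin F u.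
  apply/eqP; rewrite -subr_eq0 -(linB p_pr N_gt0 Kq); apply/eqP/hF.
  by rewrite (linB p_pr N_gt0 Hq) gP subrr.
exists (fun y => lin F (g y)); last exact: fE.
move=> x y; rewrite -(linD p_pr N_gt0 Kq) -[RHS]fE; congr (lin F (g _)).
by rewrite (linD p_pr N_gt0 Hq) !gP.
Qed.

End Extension.

Section Compatible.
Variables (p e : nat).
Hypotheses (p_pr : prime p) (e_gt0 : (0 < e)%N).
Local Notation N := (e + e)%N.
Local Notation m := (p ^ e)%N.
Local Notation A := 'Z_(p ^ (e + e)).

Let N_gt0 : (0 < N)%N. Proof. by rewrite addn_gt0 e_gt0. Qed.
Let eN : (e <= N)%N. Proof. exact: leq_addr. Qed.
Let eSN : (e < N)%N. Proof. by rewrite -addn1 leq_add2l. Qed.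

Lemma killed_sq (G : zmodType) : (forall x : G, x *+ m = 0) ->
  forall x : G, x *+ (p ^ N) = 0.
Proof. by move=> Gm x; rewrite expnD mulrnA Gm. Qed.

Definition gram (G : finZmodType) (d : G -> G -> QmodZ) r (h : 'I_r -> G)
    (Y : 'M[A]_r) : bool :=
  [forall i, forall j, d (h i) (h j) == zfrac (Y i j)].

(** [X] presents the pairing through [h]: some symmetric quasi-inverse of [X] is a Gram matrix of
    [h]. It is a boolean so that such [X] and [h] can be counted. *)
Definition compat (G : finZmodType) (d : G -> G -> QmodZ) r (X : 'M[A]_r)
    (h : 'I_r -> G) : bool :=
  [exists Y : 'M[A]_r, [&& X^T == X, Y^T == Y, X *m Y == (m%:R)%:M & gram d h Y]].

Lemma compatP (G : finZmodType) (d : G -> G -> QmodZ) r (X : 'M[A]_r) (h : 'I_r -> G) :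
  reflect (exists2 Y, quasi_inv X Y & gram d h Y) (compat d X h).
Proof.
apply: (iffP existsP) => [[Y /and4P[/eqP Xs /eqP Ys /eqP XY hY]]|[Y [Xs Ys XY] hY]].
  by exists Y.
by exists Y; rewrite Xs Ys XY !eqxx.
Qed.

Lemma gramP (G : finZmodType) (d : G -> G -> QmodZ) r (h : 'I_r -> G) (Y : 'M[A]_r) :
  reflect (forall i j, d (h i) (h j) = zfrac (Y i j)) (gram d h Y).
Proof.
apply: (iffP forallP) => H i.
  by move=> j; apply/eqP; apply: (forallP (H i)).
by apply/forallP => j; apply/eqP.
Qed.

Section OnePairing.
Variables (G : finZmodType) (d : G -> G -> QmodZ).
Hypotheses (dd : duality_pairing d) (Gm : forall x : G, x *+ m = 0).

Let Gq := killed_sq Gm.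

Lemma pairing0l y : d 0 y = 0.
Proof. by apply: (addrI (d 0 y)); rewrite addr0 -(duality_addl dd) addr0. Qed.

Lemma pairingMnl x y n : d (x *+ n) y = d x y *+ n.
Proof.
elim: n => [|n IH]; first by rewrite !mulr0n pairing0l.
by rewrite !mulrS (duality_addl dd) IH.
Qed.

Lemma pairing_lin r (h : 'I_r -> G) (u : 'rV[A]_r) y :
  d (lin h u) y = \sum_i d (h i) y *+ (u 0 i : nat).
Proof.
rewrite /lin (big_morph (d^~ y) (fun a b => duality_addl dd a b y) (pairing0l y)).
by apply: eq_bigr => i _; rewrite pairingMnl.
Qed.

(** Both [x] and [0] represent the zero homomorphism, and the representative is unique. *)
Lemma pairing_nondeg x : (forall y, d x y = 0) -> x = 0.
Proof.
move=> x0; have zP : zmod_morphism (fun _ : G => (0 : QmodZ)).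
  by move=> a b; rewrite subrr.
pose zM := GRing.isZmodMorphism.Build _ _ _ zP.
pose z : {additive G -> QmodZ} := HB.pack (fun _ : G => (0 : QmodZ)) zM.
have [g [_ gU]] := duality_perfect dd z.
by rewrite -(gU x x0); apply: gU => y; rewrite pairing0l.
Qed.

Lemma pairing_gens_eq0 r (h : 'I_r -> G) x : gens p N h ->
  (forall j, d x (h j) = 0) -> x = 0.
Proof.
move=> /gensP hP xh; apply: pairing_nondeg => y; have [u <-] := hP y.
rewrite (duality_sym dd) pairing_lin big1 // => i _.
by rewrite (duality_sym dd) xh mul0rn.
Qed.

Lemma gram_rel r (h : 'I_r -> G) Y (u : 'rV[A]_r) : gens p N h -> gram d h Y ->
  lin h u = 0 <-> pdvdmx e (u *m Y).
Proof.
move=> hg /gramP hY.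
have E j : d (lin h u) (h j) = zfrac ((u *m Y) 0 j).
  rewrite pairing_lin mxE zfrac_sum //; apply: eq_bigr => i _.
  by rewrite hY mulrC zfracM.
split=> [u0|/pdvdmxP uY].
  apply/pdvdmxP => i j; rewrite (ord1 i) -zfrac_eq0 // -E u0.
  by apply/eqP/pairing0l.
by apply: (pairing_gens_eq0 hg) => j; apply/eqP; rewrite E zfrac_eq0.
Qed.

Lemma compat_rel r (h : 'I_r -> G) X (u : 'rV[A]_r) : gens p N h -> compat d X h ->
  lin h u = 0 <-> exists w, u = w *m X.
Proof.
move=> hg /compatP[Y XY hY].
by rewrite (gram_rel u hg hY) (quasi_inv_rel p_pr e_gt0 u XY).
Qed.

Lemma compat_mingens r (h : 'I_r -> G) X : gens p N h -> compat d X h ->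
  mingens p N h <-> pdvdmx 1 X.
Proof.
move=> hg hX; split=> [[_ hr]|X1].
  apply/pdvdmxP => i j; have /hr/pdvdmxP/(_ 0 j) : lin h (row i X) = 0.
    by apply/(compat_rel _ hg hX); exists (delta_mx 0 i); rewrite rowE.
  by rewrite mxE.
by split=> // u /(compat_rel _ hg hX)[w ->]; apply: pdvdmx_mull.
Qed.

(** The pairing takes values killed by p^e, that is, fractions with denominator p^e; numerators are
    chosen above the diagonal and reflected. *)
Lemma gram_exists r (h : 'I_r -> G) : exists2 Y, Y^T = Y & gram d h Y.
Proof.
have H i : exists g : 'I_r -> A, forall j, d (h i) (h j) = zfrac (g j).
  apply: (fin_all_exists (P := fun j a => d (h i) (h j) = zfrac a)) => j.
  by apply: zfrac_surj => //; rewrite -pairingMnl Gm pairing0l.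
have [f fP] := fin_all_exists H.
exists (\matrix_(i, j) if (i <= j)%N then f i j else f j i).
  apply/matrixP => i j; rewrite !mxE; case: (ltngtP i j) => // ij.
  by rewrite (val_inj ij).
apply/gramP => i j; rewrite mxE; case: ifP => _; first exact: fP.
by rewrite (duality_sym dd) fP.
Qed.

Lemma card_gram r (h : 'I_r -> G) :
  #|[set Y : 'M[A]_r | (Y^T == Y) && gram d h Y]%SET| = (m ^ npairs r)%N.
Proof.
have [Y0 Ys hY0] := gram_exists h.
pose S i j := [set a : A | pdvd e (a - Y0 i j)]%SET.
have cS i j : #|S i j| = m.
  have inj : injective (fun a : A => a + Y0 i j) by apply: addIr.
  rewrite -[RHS](_ : #|[set a : A | pdvd e a]%SET| = m); last first.
    by rewrite card_pdvd // addKn.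
  rewrite -[RHS](card_imset _ inj); apply: eq_card => a; rewrite inE.
  apply/idP/imsetP => [aP|[b]].
    by exists (a - Y0 i j); rewrite ?subrK // inE.
  by rewrite inE => bP ->; rewrite addrK.
transitivity (\prod_(i < r) \prod_(j < r | (i <= j)%N) #|S i j|)%N; last first.
  rewrite /npairs expn_sum; apply: eq_bigr => i _; rewrite expn_sum.
  by apply: eq_bigr => j _; rewrite cS expn1.
rewrite -card_symmetric; last by move=> i j; rewrite /S -[in LHS]Ys mxE.
apply: eq_card => Y; rewrite !inE; congr (_ && _).
apply: eq_forallb => i; apply: eq_forallb => j.
by rewrite inE (gramP _ _ _ hY0) eq_sym zfrac_eq.
Qed.

(** p^e (Z - Y) = Y X (Z - Y) = 0: a presentation determines the Gram matrix modulo 1. *)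
Lemma compat_uniq_gram r (X Y Z : 'M[A]_r) : quasi_inv X Y -> quasi_inv X Z ->
  pdvdmx e (Z - Y).
Proof.
move=> XY [_ _ XZ]; apply: scale_ann => //.
rewrite -mul_scalar_mx -(quasi_invC XY) -mulmxA mulmxBr XZ.
by have [_ _ ->] := XY; rewrite subrr mulmx0.
Qed.

Lemma card_quasi_inv_r r (X Y : 'M[A]_r) : quasi_inv X Y ->
  #|[set Z : 'M[A]_r | (Z^T == Z) && (X *m Z == (m%:R)%:M)]%SET| = annsym X.
Proof.
move=> [Xs Ys XY].
have inj : injective (fun Z : 'M[A]_r => Z + Y) by apply: addIr.
rewrite /annsym -[RHS](card_imset _ inj); apply: eq_card => Z; rewrite inE.
apply/andP/imsetP => [[/eqP Zs /eqP XZ]|[W]].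
  exists (Z - Y); rewrite ?subrK // inE linearB /= Zs Ys eqxx /=.
  by rewrite mulmxBr XZ XY subrr.
rewrite inE => /andP[/eqP Ws /eqP XW] ->.
by rewrite linearD /= Ws Ys mulmxDr XW XY add0r !eqxx.
Qed.

(* Double counting of the pairs of symmetric matrices [(X, Y)] with [X Y = m]
   and [Y] a Gram matrix of [h]. *)
Lemma card_compat r (h : 'I_r -> G) : mingens p N h ->
  (#|[set X : 'M[A]_r | compat d X h]%SET| * #|G| ^ r.+1
    = m ^ npairs r * m ^ npairs r)%N.
Proof.
move=> hm; have [hg hr] := hm.
pose E (X Y : 'M[A]_r) : bool :=
  [&& X^T == X, Y^T == Y, X *m Y == (m%:R)%:M & gram d h Y].
have EP X Y : reflect (quasi_inv X Y /\ gram d h Y) (E X Y).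
  apply: (iffP and4P) => [[/eqP ? /eqP ? /eqP ? ?]|[[-> -> ->] ?]].
    by split.
  by rewrite !eqxx; split.
set C := [set X | _]%SET.
pose D : {set 'M[A]_r} := [set Y : 'M[A]_r | (Y^T == Y) && gram d h Y]%SET.
have sumY X : X \in C -> (\sum_(Y | E X Y) 1)%N = annsym X.
  rewrite inE => /compatP[Y XY hY]; have [Xs _ _] := XY.
  rewrite -(card_quasi_inv_r XY) -sum1_card; apply: eq_bigl => Z.
  rewrite inE /E Xs eqxx /=; apply/and3P/andP => [[-> ->]|[Zs XZ]] //; split=> //.
  have XZ' : quasi_inv X Z by split=> //; apply/eqP.
  apply/gramP => i j; rewrite (gramP _ _ _ hY); apply/eqP.
  rewrite eq_sym zfrac_eq //; have /pdvdmxP/(_ i j) := compat_uniq_gram XY XZ'.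
  by rewrite !mxE.
have sumX Y : Y \in D -> (\sum_(X | E X Y) 1)%N = annsym Y.
  rewrite inE => /andP[/eqP Ys hY].
  (* Minimality of [h] enters here: a vector killed by [Y] modulo p^(e+1) is a relation of [h],
     hence divisible by [p]. *)
  have [X Xs XY] : exists2 X : 'M[A]_r, X^T = X & X *m Y = (m%:R)%:M.
    apply: symmetric_quasi_inverse => // v vP.
    have /hr/pdvdmxP v1 : lin h v^T = 0.
      apply/(gram_rel _ hg hY); rewrite -Ys -trmx_mul.
      apply/pdvdmxP => i j; rewrite mxE; have /pdvdmxP/(_ j i) := vP.
      exact: pdvd_leq.
    by apply/pdvdmxP => i j; have := v1 j i; rewrite mxE.
  have YX : quasi_inv Y X by split=> //; apply: (quasi_invC (X := X)).
  rewrite -(card_quasi_inv_r YX) -sum1_card; apply: eq_bigl => Z.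
  rewrite inE /E Ys eqxx hY andbT /=; have [Zs|//] := eqVneq Z^T Z.
  rewrite /= -[X in _ = (X == _)](trmxK) trmx_mul Zs Ys.
  by rewrite -[in RHS](tr_scalar_mx _ (m%:R)) (inj_eq (@trmx_inj _ _ _)).
have EC X Y : E X Y -> X \in C by move=> EXY; rewrite inE; apply/existsP; exists Y.
have ED X Y : E X Y -> Y \in D by case/EP => -[_ Ys _] hY; rewrite inE Ys eqxx.
have key X Y : E X Y -> (annsym Y * #|G| ^ r.+1 = m ^ npairs r * annsym X)%N.
  case/EP => XY hY; apply: annsym_pair => //.
  rewrite -(card_lin_fiber p_pr N_gt0 Gq 0 hg); congr (_ * _)%N.
  apply: eq_card => u; rewrite !inE; apply/idP/eqP => uP.
    by apply/(gram_rel u hg hY).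
  by apply/(gram_rel u hg hY).
have a0 (X : 'M[A]_r) : ((annsym X)%:R : rat) != 0.
  rewrite pnatr_eq0 -lt0n; apply/card_gt0P; exists 0.
  by rewrite inE trmx0 mulmx0 !eqxx.
suff : (#|C|%:R * #|G|%:R ^+ r.+1 = m%:R ^+ npairs r * m%:R ^+ npairs r :> rat).
  by rewrite -!natrX -!natrM => /eqP; rewrite eqr_nat => /eqP.
(* Every [X] in [C] has [annsym X] partners, so these weights count [C]. By [key] they are
   proportional to 1/[annsym Y], and summing over [X] first then counts [D]. *)
have -> : (#|C|%:R = \sum_X \sum_(Y | E X Y) (annsym X)%:R^-1 :> rat).
  rewrite -sum1_card natr_sum big_mkcond; apply: eq_bigr => X _; case: ifP => XC.
    by rewrite sumr_const -[RHS]mulr_natr -sum1_card sumY // mulVf.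
  by rewrite big1 // => Y /EC; rewrite XC.
rewrite mulr_suml; under eq_bigr do rewrite mulr_suml.
transitivity (\sum_X \sum_(Y | E X Y) (m%:R ^+ npairs r / (annsym Y)%:R : rat)).
  apply: eq_bigr => X _; apply: eq_bigr => Y EXY.
  apply: (mulIf (a0 Y)); rewrite divfK // -mulrA [_ * (annsym Y)%:R]mulrC.
  rewrite -natrX -natrM (key X Y EXY) natrM natrX mulrCA mulVf ?mulr1 //.
rewrite (exchange_big_dep xpredT) //=.
transitivity (\sum_(Y in D) (m%:R ^+ npairs r : rat)).
  rewrite [RHS]big_mkcond; apply: eq_bigr => Y _; case: ifP => YD.
    by rewrite sumr_const -[LHS]mulr_natr -sum1_card sumX // divfK.
  by rewrite big1 // => X /ED; rewrite YD.
by rewrite sumr_const (card_gram h) -[LHS]mulr_natr [(m ^ npairs r)%:R]natrX.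
Qed.

End OnePairing.

Section TwoPairings.
Variables (G H : finZmodType) (dG : G -> G -> QmodZ) (dH : H -> H -> QmodZ).
Hypotheses (ddG : duality_pairing dG) (ddH : duality_pairing dH).
Hypotheses (Gm : forall x : G, x *+ m = 0) (Hm : forall x : H, x *+ m = 0).

(** By nondegeneracy the values of the pairing on generators determine their relations, so each
    family maps to the other. *)
Lemma gens_isometry r (h : 'I_r -> G) (k : 'I_r -> H) :
  gens p N h -> gens p N k -> (forall i j, dG (h i) (h j) = dH (k i) (k j)) ->
  exists f : G -> H, [/\ bijective f, {morph f : x y / x + y},
    forall x y, dH (f x) (f y) = dG x y & forall i, f (h i) = k i].
Proof.
move=> hg kg hk.
have pair u v : dG (lin h u) (lin h v) = dH (lin k (u : 'rV[A]_r)) (lin k (v : 'rV[A]_r)).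
  rewrite !pairing_lin //; apply: eq_bigr => i _; congr (_ *+ _).
  rewrite (duality_sym ddG) (duality_sym ddH) !pairing_lin //.
  by apply: eq_bigr => j _; rewrite hk.
have rel u : lin h (u : 'rV[A]_r) = 0 <-> lin k u = 0.
  split=> u0; [apply: (pairing_gens_eq0 ddH kg) | apply: (pairing_gens_eq0 ddG hg)] => j.
    rewrite -(lin_delta p_pr N_gt0 (killed_sq Hm) k j) -pair u0 pairing0l //.
  by rewrite -(lin_delta p_pr N_gt0 (killed_sq Gm) h j) pair u0 pairing0l.
have [f fD fE] := extend_gens p_pr N_gt0 (killed_sq Gm) (killed_sq Hm) hg
  (fun u => proj1 (rel u)).
have [g gD gE] := extend_gens p_pr N_gt0 (killed_sq Hm) (killed_sq Gm) kg
  (fun u => proj2 (rel u)).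
exists f; split=> //.
- exists g => x; first by have /gensP/(_ x)[u <-] := hg; rewrite fE gE.
  by have /gensP/(_ x)[u <-] := kg; rewrite gE fE.
- move=> x y; have /gensP/(_ x)[u <-] := hg; have /gensP/(_ y)[v <-] := hg.
  by rewrite !fE pair.
- move=> i; rewrite -{1}(lin_delta p_pr N_gt0 (killed_sq Gm) h i) fE.
  by rewrite (lin_delta p_pr N_gt0 (killed_sq Hm)).
Qed.

Lemma compat_isometry r X (h : 'I_r -> G) (k : 'I_r -> H) :
  gens p N h -> gens p N k -> compat dG X h -> compat dH X k ->
  exists f : G -> H, [/\ bijective f, {morph f : x y / x + y},
    forall x y, dH (f x) (f y) = dG x y & forall i, f (h i) = k i].
Proof.
move=> hg kg /compatP[Y XY /gramP hY] /compatP[Z XZ /gramP kZ].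
apply: gens_isometry => // i j; rewrite hY kZ; apply/eqP.
rewrite eq_sym zfrac_eq //; have /pdvdmxP/(_ i j) := compat_uniq_gram XY XZ.
by rewrite !mxE.
Qed.

Lemma isometry_transport r X (h : 'I_r -> G) (f : G -> H) :
  bijective f -> {morph f : x y / x + y} ->
  (forall x y, dH (f x) (f y) = dG x y) -> gens p N h -> compat dG X h ->
  gens p N (f \o h) /\ compat dH X (f \o h).
Proof.
move=> [g fK gK] fD fP hg /compatP[Y XY /gramP hY]; split; last first.
  by apply/compatP; exists Y => //; apply/gramP => i j; rewrite /= fP.
apply/gensP => y; have /gensP/(_ (g y))[u uE] := hg; exists u.
by rewrite -[RHS]gK -uE addmorph_lin.
Qed.

End TwoPairings.

(** The isometries act simply transitively on the generating families presented by [X], because [X]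
    fixes their Gram matrix modulo 1. *)
Lemma card_compat_gens (G : finZmodType) (d : G -> G -> QmodZ) r X (h : 'I_r -> G) :
  duality_pairing d -> (forall x : G, x *+ m = 0) -> gens p N h -> compat d X h ->
  #|[set k : {ffun 'I_r -> G} | gens p N k && compat d X k]%SET| = #|pairing_Aut d|.
Proof.
move=> dd Gm hg hX.
pose f (s : {perm G}) : {ffun 'I_r -> G} := [ffun i => s (h i)].
have AutP s : s \in pairing_Aut d ->
    {morph s : x y / x + y} /\ (forall x y, d (s x) (s y) = d x y).
  rewrite inE => /andP[/forallP sD /forallP sP]; split=> x y.
    by apply/eqP; apply: (forallP (sD x)).
  by apply/eqP; apply: (forallP (sP x)).
have sE (s : {perm G}) u : {morph s : x y / x + y} -> s (lin h u) = lin (f s) (u : 'rV[A]_r).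
  move=> sD; rewrite addmorph_lin //; apply: eq_lin => i.
  by rewrite ffunE.
have finj : {in pairing_Aut d &, injective f}.
  move=> s t /AutP[sD _] /AutP[tD _] st; apply/permP => x.
  by have /gensP/(_ x)[u <-] := hg; rewrite !sE // st.
rewrite -(card_in_imset finj); apply: eq_card => k; rewrite inE.
apply/andP/imsetP => [[kg kX]|[s sA ->]].
  have [t [tb tD tP th]] := compat_isometry dd dd Gm Gm hg kg hX kX.
  exists (perm (bij_inj tb)); last by apply/ffunP => i; rewrite ffunE permE th.
  rewrite inE; apply/andP; split; apply/forallP => x; apply/forallP => y.
    by rewrite !permE tD.
  by rewrite !permE tP.
have [sD sP] := AutP s sA.
have sb : bijective s by exists (s^-1)%g; [exact: permK | exact: permKV].
have [g c] := isometry_transport sb sD sP hg hX.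
have fs : s \o h =1 f s by move=> i; rewrite ffunE.
split.
  apply/gensP => y; have /gensP/(_ y)[u <-] := g; exists u.
  by apply: eq_lin => i; rewrite fs.
have /compatP[Y XY /gramP hY] := c; apply/compatP; exists Y => //.
by apply/gramP => i j; rewrite -!fs hY.
Qed.

(** A homomorphism is the image [F] of [h]; the rows of [X] generate the relations of [h], and
    surjectivity says that [F] generates. *)
Lemma card_Sur_compat (G K : finZmodType) (d : G -> G -> QmodZ) r X (h : 'I_r -> G) :
  duality_pairing d -> (forall x : G, x *+ m = 0) -> (forall x : K, x *+ m = 0) ->
  gens p N h -> compat d X h ->
  #|Sur G K| =
  #|[set F : {ffun 'I_r -> K} | gens p N F && [forall i, lin F (row i X) == 0]]%SET|.
Proof.
move=> dd Gm Km hg hX.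
pose f (s : {ffun G -> K}) : {ffun 'I_r -> K} := [ffun i => s (h i)].
have SurP (s : {ffun G -> K}) : s \in Sur G K ->
    {morph s : x y / x + y} /\ (forall y, exists x, s x = y).
  rewrite inE => /andP[/forallP sD /forallP sP]; split=> x.
    by move=> y; apply/eqP; apply: (forallP (sD x)).
  by have /existsP[y /eqP] := sP x; exists y.
have sE (s : {ffun G -> K}) u : {morph s : x y / x + y} ->
    s (lin h u) = lin (f s) (u : 'rV[A]_r).
  move=> sD; rewrite addmorph_lin //; apply: eq_lin => i.
  by rewrite ffunE.
have finj : {in Sur G K &, injective f}.
  move=> s t /SurP[sD _] /SurP[tD _] st; apply/ffunP => x.
  by have /gensP/(_ x)[u <-] := hg; rewrite !sE // st.
rewrite -(card_in_imset finj); apply: eq_card => F; rewrite inE.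
apply/imsetP/andP => [[s sS ->]|[Fg /forallP FX]].
  have [sD sP] := SurP s sS; split.
    apply/gensP => y; have [x <-] := sP y; have /gensP/(_ x)[u <-] := hg.
    by exists u; rewrite sE.
  apply/forallP => i; rewrite -sE //.
  have -> : lin h (row i X) = 0.
    by apply/(compat_rel dd _ hg hX); exists (delta_mx 0 i); rewrite rowE.
  by apply/eqP; apply: addmorph0.
have rel (u : 'rV[A]_r) : lin h u = 0 -> lin F u = 0.
  move=> /(compat_rel dd _ hg hX)[w ->].
  rewrite (lin_mul p_pr N_gt0 (killed_sq Km)) /lin big1 // => i _.
  by rewrite /linmx (eqP (FX i)) mul0rn.
have [g gD gE] := extend_gens p_pr N_gt0 (killed_sq Gm) (killed_sq Km) hg rel.
exists [ffun x => g x].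
  rewrite inE; apply/andP; split.
    by apply/forallP => x; apply/forallP => y; rewrite !ffunE gD.
  apply/forallP => y; have /gensP/(_ y)[u <-] := Fg.
  by apply/existsP; exists (lin h u); rewrite ffunE gE.
apply/ffunP => i; rewrite !ffunE -[in RHS](lin_delta p_pr N_gt0 (killed_sq Gm) h i) gE.
by rewrite (lin_delta p_pr N_gt0 (killed_sq Km)).
Qed.

End Compatible.

(** * The group with pairing presented by a given matrix *)

Section ImageGroup.
Variables (p e r : nat).
Local Notation A := 'Z_(p ^ (e + e)).
Variable Y : 'M[A]_r.

(** The image of u -> p^e u Y. When [Y] is a quasi-inverse of [X], the kernel of this map is the row
    space of [X], so the cokernel of [X] is realised as a subgroup instead of a quotient. *)
Definition im_pred : {pred 'rV[A]_r} :=
  [pred v | [exists u : 'rV[A]_r, v == (p ^ e)%:R *: (u *m Y)]].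

Lemma im_predP (v : 'rV[A]_r) :
  reflect (exists u : 'rV[A]_r, v = (p ^ e)%:R *: (u *m Y)) (v \in im_pred).
Proof.
apply: (iffP existsP) => -[u uE]; exists u; [exact/eqP | exact/eqP].
Qed.

Lemma im_closed : zmod_closed im_pred.
Proof.
split; first by apply/im_predP; exists 0; rewrite mul0mx scaler0.
move=> v w /im_predP[u ->] /im_predP[u' ->]; apply/im_predP; exists (u - u').
by rewrite mulmxBl scalerBr.
Qed.

HB.instance Definition _ := GRing.isZmodClosed.Build _ im_pred im_closed.

Record image_group := ImageGroup {
  image_val : 'rV[A]_r; image_valP : image_val \in im_pred }.

HB.instance Definition _ := [isSub for image_val].
HB.instance Definition _ := [Finite of image_group by <:].
HB.instance Definition _ := [SubChoice_isSubZmodule of image_group by <:].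

End ImageGroup.

Section Existence.
Variables (p e : nat).
Hypotheses (p_pr : prime p) (e_gt0 : (0 < e)%N).
Local Notation N := (e + e)%N.
Local Notation m := (p ^ e)%N.
Local Notation A := 'Z_(p ^ (e + e)).

Let N_gt0 : (0 < N)%N. Proof. by rewrite addn_gt0 e_gt0. Qed.
Let eN : (e <= N)%N. Proof. exact: leq_addr. Qed.

Variables (r : nat) (X Y : 'M[A]_r).
Hypothesis XY : quasi_inv X Y.

Local Notation G := (image_group Y).
Local Notation val := (@image_val p e r Y).

Let rep (v : G) : exists u : 'rV[A]_r, val v = m%:R *: (u *m Y).
Proof. exact/im_predP/image_valP. Qed.

Let pre (v : G) : 'rV[A]_r := projT1 (cid (rep v)).

Let preE (v : G) : val v = m%:R *: (pre v *m Y).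
Proof. exact: (projT2 (cid (rep v))). Qed.

Let d (v w : G) : QmodZ := zfrac ((pre v *m Y *m (pre w)^T) 0 0).

Let Ysym : Y^T = Y. Proof. by case: XY. Qed.

Let scale_pd (u u' : 'rV[A]_r) : m%:R *: (u *m Y) = m%:R *: (u' *m Y) ->
  pdvdmx e ((u - u') *m Y).
Proof.
by move=> E; apply: scale_ann => //; rewrite mulmxBl scalerBr E subrr.
Qed.

(** The pairing does not depend on the coordinates chosen by [pre]: two choices differ by a vector
    whose product with [Y] is divisible by p^e. *)
Let dE (v w : G) (u u' : 'rV[A]_r) : val v = m%:R *: (u *m Y) ->
  val w = m%:R *: (u' *m Y) -> d v w = zfrac ((u *m Y *m u'^T) 0 0).
Proof.
rewrite !preE => /scale_pd vu /scale_pd wu; apply/eqP; rewrite /d.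
have M1 : pre v *m Y *m (pre w)^T =
    (pre v - u) *m Y *m (pre w)^T + u *m Y *m (pre w)^T.
  by rewrite -!mulmxDl subrK.
have M2 : u *m Y *m (pre w)^T = u *m Y *m (pre w - u')^T + u *m Y *m u'^T.
  by rewrite -mulmxDr -linearD subrK.
have sw (a b : 'rV[A]_r) : (a *m Y *m b^T) 0 0 = (b *m Y *m a^T) 0 0.
  by rewrite -[in LHS](trmxK a) -{1}Ysym -!trmx_mul mxE mulmxA.
rewrite M1 mxE M2 [X in _ + X]mxE !zfracD // (sw u (pre w - u')).
have z0 (a b : 'rV[A]_r) : pdvdmx e (a *m Y) -> zfrac ((a *m Y *m b^T) 0 0) = 0.
  move=> aP; apply/eqP; rewrite zfrac_eq0 //.
  by have /pdvdmxP/(_ 0 0) := pdvdmx_mulr p_pr N_gt0 b^T eN aP.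
by rewrite (z0 _ _ vu) (z0 _ _ wu) !add0r.
Qed.

Let h (i : 'I_r) : G.
Proof.
apply: (@ImageGroup p e r Y (m%:R *: (delta_mx 0 i *m Y))).
by apply/im_predP; exists (delta_mx 0 i).
Defined.

Let valh i : val (h i) = m%:R *: (delta_mx 0 i *m Y). Proof. by []. Qed.

Let valD (v w : G) : val (v + w) = val v + val w. Proof. by []. Qed.

Let valMn (v : G) n : val (v *+ n) = val v *+ n.
Proof. by elim: n => [|n IH] //; rewrite !mulrS valD IH. Qed.

Let val_inj' (v w : G) : val v = val w -> v = w. Proof. exact: val_inj. Qed.

Let Gm (x : G) : x *+ m = 0.
Proof.
apply: val_inj'; rewrite valMn preE -scaler_nat scalerA -natrM -expnD.
by have /eqP -> : ((p ^ N)%:R == 0 :> A); rewrite ?scale0r // natZ_eq0.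
Qed.

Let Gq := killed_sq Gm.

Let val_lin (u : 'rV[A]_r) : val (lin h u) = m%:R *: (u *m Y).
Proof.
rewrite /lin (big_morph val valD (erefl : val 0 = 0)).
rewrite [in RHS](matrix_sum_delta u) big_ord1 mulmx_suml scaler_sumr.
apply: eq_bigr => i _; rewrite valMn valh -scaler_nat natZ_val.
by rewrite !scalerA -scalemxAl scalerA mulrC.
Qed.

Let hg : gens p N h.
Proof.
by apply/gensP => y; have [u uE] := rep y; exists u; apply: val_inj'; rewrite val_lin uE.
Qed.

Let dlin (u u' : 'rV[A]_r) : d (lin h u) (lin h u') = zfrac ((u *m Y *m u'^T) 0 0).
Proof. by apply: dE; rewrite val_lin. Qed.

Let dsym v w : d v w = d w v.
Proof.
rewrite /d; congr zfrac.
by rewrite -[in LHS](trmxK (pre v)) -{1}Ysym -!trmx_mul mxE mulmxA.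
Qed.

Let daddl v w x : d (v + w) x = d v x + d w x.
Proof.
have /gensP/(_ v)[u <-] := hg; have /gensP/(_ w)[u' <-] := hg.
have /gensP/(_ x)[u'' <-] := hg.
by rewrite -(linD p_pr N_gt0 Gq) !dlin !mulmxDl mxE zfracD.
Qed.

Let dh (u : 'rV[A]_r) j : d (lin h u) (h j) = zfrac ((u *m Y) 0 j).
Proof.
rewrite -(lin_delta p_pr N_gt0 Gq h j) dlin; congr zfrac.
rewrite mxE (bigD1 j) //= big1 => [|i ij].
  by rewrite !mxE !eqxx mulr1 addr0.
by rewrite !mxE (negbTE ij) andbF mulr0.
Qed.

Let dnondeg v : (forall j, d v (h j) = 0) -> v = 0.
Proof.
have /gensP/(_ v)[u <-] := hg => uP; apply: val_inj'; rewrite val_lin.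
have /(pdvdmx_scale p_pr e_gt0 eN)[w ->] : pdvdmx e (u *m Y).
  by apply/pdvdmxP => i j; rewrite (ord1 i) -zfrac_eq0 // -dh uP.
rewrite scalerA -natrM -expnD.
by have /eqP -> : ((p ^ N)%:R == 0 :> A); rewrite ?scale0r // natZ_eq0.
Qed.

Let dperf (phi : {additive G -> QmodZ}) : exists! g : G, forall x, d g x = phi x.
Proof.
have ex i : exists a : A, phi (h i) = zfrac a.
  by apply: zfrac_surj => //; rewrite -raddfMn Gm raddf0.
have [c cP] := fin_all_exists ex.
pose C : 'cV[A]_r := \col_i c i.
have phiE (u : 'rV[A]_r) : phi (lin h u) = zfrac ((u *m C) 0 0).
  rewrite (addmorph_lin _ _ (raddfD phi)) /lin mxE zfrac_sum //; apply: eq_bigr => i _.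
  by rewrite /= cP !mxE mulrC zfracM.
(* [phi] vanishes on the rows of [X], so X C = p^e t. Multiplying by [Y] gives Y t = C modulo p^e,
   and [t] holds the coordinates of the representing element. *)
have /(pdvdmx_scale p_pr e_gt0 eN)[t tE] : pdvdmx e (X *m C).
  apply/pdvdmxP => i j; rewrite (ord1 j).
  have -> : (X *m C) i 0 = (row i X *m C) 0 0.
    by rewrite !mxE; apply: eq_bigr => k _; rewrite !mxE.
  rewrite -zfrac_eq0 // -phiE.
  have -> : lin h (row i X) = 0; last by rewrite raddf0.
  apply: val_inj'; rewrite val_lin -row_mul; have [_ _ ->] := XY.
  apply/rowP => k; rewrite !mxE mulrnAr -natrM -expnD.
  by have /eqP -> : ((p ^ N)%:R == 0 :> A); rewrite ?mul0rn // natZ_eq0.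
have /scale_ann CY : m%:R *: (Y *m t - C) = 0.
  rewrite scalerBr scalemxAr -tE mulmxA (quasi_invC XY) mul_scalar_mx subrr //.
have {}CY : pdvdmx e (Y *m t - C) by apply: CY.
exists (lin h t^T); split=> [x|g gP].
  have /gensP/(_ x)[u <-] := hg; rewrite dsym dlin trmxK phiE; apply/eqP.
  rewrite zfrac_eq // -[X in X - _]/((u *m Y *m t) 0 0).
  have /pdvdmxP/(_ 0 0) := pdvdmx_mull p_pr N_gt0 u eN CY.
  by rewrite mulmxBr mulmxA mxE [X in _ + X]mxE.
apply/eqP; rewrite -subr_eq0; apply/eqP/dnondeg => j.
have := daddl (lin h t^T - g) g (h j); rewrite subrK gP => E.
apply: (addIr (phi (h j))); rewrite -E add0r dh; apply/eqP.
rewrite cP zfrac_eq //; have /pdvdmxP/(_ j 0) := CY.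
rewrite !mxE; congr (pdvd _ (_ - _)); apply: eq_bigr => k _.
by rewrite mxE mulrC -[in RHS]Ysym mxE.
Qed.

Let ddual : duality_pairing d.
Proof.
split=> // x y z; rewrite dsym daddl dsym [X in _ + X]dsym //.
Qed.

Let pG : p.-nat #|{: G}|.
Proof.
have := card_lin_fiber p_pr N_gt0 Gq 0 hg; rewrite -expnM => E.
apply: (@pnat_dvd _ (p ^ (N * r))); first by rewrite -E dvdn_mull.
by rewrite pnatX pnat_id.
Qed.

Lemma exists_compat : exists (B : paired_pgroup p) (k : 'I_r -> B),
  [/\ forall x : B, x *+ m = 0, gens p N k & compat (@pairing p B) X k].
Proof.
have [B isoB] := exists_paired_pgroup pG ddual; exists B.
have [f [fb fD fP]] := isometric_sym isoB.
have hX : compat d X h.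
  apply/compatP; exists Y => //; apply/gramP => i j.
  rewrite -{1}(lin_delta p_pr N_gt0 Gq h i) dh; congr zfrac.
  by rewrite -rowE mxE.
have [kg kX] := isometry_transport fb fD fP hg hX.
exists (f \o h); split=> // x.
have [g fK gK] := fb; rewrite -[x]gK.
by rewrite -(addmorphMn fD) Gm addmorph0.
Qed.

End Existence.

(** * Counting up to congruence *)

Section CongruenceCounting.
Variables (p N : nat).
Hypotheses (p_pr : prime p) (N_gt0 : (0 < N)%N).
Local Notation A := 'Z_(p ^ N).

Lemma card_congruence r (U : 'M[A]_r) (P Q : pred 'M[A]_r) : U \in unitmx ->
  (forall X, P X = Q (U^T *m X *m U)) ->
  #|[set X : 'M[A]_r | (X^T == X) && P X]%SET| =
  #|[set X : 'M[A]_r | (X^T == X) && Q X]%SET|.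
Proof.
move=> UU PQ; pose f (X : 'M[A]_r) := U^T *m X *m U.
have UTU : U^T \in unitmx by rewrite unitmx_tr.
have finj : injective f.
  by move=> Z Z' /(can_inj (mulmxK UU)) /(can_inj (mulKmx UTU)).
have fT X : (f X)^T = f X^T by rewrite /f !trmx_mul trmxK mulmxA.
rewrite -(card_imset _ finj); apply: eq_card => Z; rewrite inE.
apply/imsetP/andP => [[X]|[Zs QZ]].
  by rewrite inE PQ => /andP[/eqP Xs QX] ->; rewrite fT Xs.
have ZE : Z = f (invmx U^T *m Z *m invmx U).
  by rewrite /f !mulmxA mulmxV // mul1mx mulmxKV.
exists (invmx U^T *m Z *m invmx U) => //; rewrite inE PQ -/(f _) -ZE QZ andbT.
by rewrite -(inj_eq finj) -fT -ZE.
Qed.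

Lemma card_sym_pdvd r (k : 'I_r -> 'I_r -> nat) :
  (forall i j, k i j = k j i) -> (forall i j, (k i j <= N)%N) ->
  #|[set X : 'M[A]_r | (X^T == X) && [forall i, forall j, pdvd (k i j) (X i j)]]%SET|
  = (p ^ \sum_(i < r) \sum_(j < r | i <= j) (N - k i j))%N.
Proof.
move=> ks kN; pose S i j := [set a : A | pdvd (k i j) a]%SET.
rewrite expn_sum; under eq_bigr do rewrite expn_sum.
under eq_bigr do under eq_bigr do rewrite -card_pdvd //.
rewrite -card_symmetric; last by move=> i j; rewrite ks.
apply: eq_card => X; rewrite !inE; congr (_ && _).
by apply: eq_forallb => i; apply: eq_forallb => j; rewrite inE.
Qed.

Definition pad g k (f : 'I_g -> nat) (i : 'I_(g + k)) : nat :=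
  match fintype.split i with inl j => f j | inr _ => 0 end.

Lemma pad_lshift g k (f : 'I_g -> nat) (j : 'I_g) : pad f (lshift k j) = f j.
Proof. by rewrite /pad -[lshift k j]/(unsplit (inl j)) unsplitK. Qed.

Lemma pad_rshift g k (f : 'I_g -> nat) (j : 'I_k) : pad f (rshift g j) = 0%N.
Proof. by rewrite /pad -[rshift g j]/(unsplit (inr j)) unsplitK. Qed.

(** The congruence X -> U^T X U turns [F] into (b, 0). The condition then makes column [j] divisible
    by p^(f_j), and by symmetry row [j] too, so each entry has its own divisibility. *)
Lemma card_sym_killing (K : finZmodType) g k (b : 'I_g -> K) (f : 'I_g -> nat)
    (F : 'I_(g + k) -> K) :
  (forall x : K, x *+ (p ^ N) = 0) -> gens p N b ->
  (forall u : 'rV[A]_g, lin b u = 0 <-> forall j, pdvd (f j) (u 0 j)) ->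
  (forall j, (0 < f j <= N)%N) -> gens p N F ->
  #|[set X : 'M[A]_(g + k) | (X^T == X) &&
      (pdvdmx 1 X && [forall i, lin F (row i X) == 0])]%SET| =
  (p ^ \sum_(i < g + k) \sum_(j < g + k | i <= j)
     (N - maxn 1 (maxn (pad f i) (pad f j))))%N.
Proof.
move=> Kq bg brel f1 Fg.
have bm : mingens p N b.
  split=> // u /brel uP; apply/pdvdmxP => i j; rewrite (ord1 i).
  by apply: pdvd_leq (uP j); have /andP[] := f1 j.
have [k' [E [U UU FU]]] := gens_std p_pr N_gt0 Kq bm Fg.
have kk : k = k' by apply: (@addnI g).
subst k'; have {}FU : F =1 linmx (U *m stdmx p N g k) b.
  by move=> i; rewrite FU /linmx; congr (lin b (row _ _)); apply: val_inj.
have fN i : (pad f i <= N)%N.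
  by rewrite /pad; case: fintype.split => // j; have /andP[] := f1 j.
pose Q (Z : 'M[A]_(g + k)) := pdvdmx 1 Z && [forall i, lin b (row i (lsubmx Z)) == 0].
transitivity #|[set Z : 'M[A]_(g + k) | (Z^T == Z) && Q Z]%SET|; last first.
  rewrite -card_sym_pdvd; first last.
  - by move=> i j; rewrite !geq_max N_gt0 !fN.
  - by move=> i j; congr maxn; rewrite maxnC.
  apply: eq_card => Z; rewrite !inE; have [Zs|//] := eqVneq Z^T Z; rewrite /= /Q.
  apply/andP/forallP => [[/pdvdmxP Z1 /forallP Zb] i|ZP].
    apply/forallP => j; rewrite /maxn; case: ifP => _; last exact: Z1.
    have Zp a c : pdvd (pad f c) (Z a c).
      rewrite /pad; case: splitP => c' cE; last by rewrite /pdvd expn0 dvd1n.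
      have /brel/(_ c') := eqP (Zb a); rewrite !mxE.
      by rewrite (_ : lshift k c' = c) //; apply: val_inj.
    by case: ifP => _; [exact: Zp | rewrite -Zs mxE; exact: Zp].
  split; first by apply/pdvdmxP => i j; apply: pdvd_leq (forallP (ZP i) j); rewrite leq_maxl.
  apply/forallP => i; apply/eqP/brel => j; rewrite !mxE.
  apply: pdvd_leq (forallP (ZP i) (lshift k j)).
  by rewrite !leq_max pad_lshift leqnn !orbT.
apply: (card_congruence UU) => X.
have UTU : U^T \in unitmx by rewrite unitmx_tr.
have -> : pdvdmx 1 X = pdvdmx 1 (U^T *m X *m U).
  apply/idP/idP => XP; first by apply: pdvdmx_mulr => //; apply: pdvdmx_mull.
  have -> : X = invmx U^T *m (U^T *m X *m U) *m invmx U.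
    by rewrite mulmxA mulmxK // mulKmx.
  by apply: pdvdmx_mulr => //; apply: pdvdmx_mull.
rewrite /Q; set Z := U^T *m X *m U; congr (_ && _).
have H (L M : 'M[A]_(g + k)) : L *m M = 1%:M -> forall T : 'M[A]_(g + k, g),
    (forall i, lin b (row i (M *m T)) = 0) -> forall i, lin b (row i T) = 0.
  move=> LM T T0 i; rewrite -[T]mul1mx -LM -mulmxA -[lin _ _]/(linmx _ b i).
  rewrite (linmx_mul p_pr N_gt0 Kq); apply: big1 => j _.
  by rewrite /linmx T0 mul0rn.
have E' i : lin F (row i X) = lin b (row i (X *m U *m stdmx p N g k)).
  rewrite (eq_lin FU) -(lin_mul p_pr N_gt0 Kq) -row_mul mulmxA //.
have ZE : lsubmx Z = U^T *m (X *m U *m stdmx p N g k).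
  by rewrite -stdmx_mul /Z !mulmxA.
apply/forallP/forallP => [HX i|HZ i].
  rewrite ZE; apply/eqP; apply: (H U^T (invmx U^T)); first by rewrite mulmxV.
  by move=> j; rewrite mulKmx // -E'; apply/eqP.
rewrite E'; apply/eqP; apply: (H (invmx U^T) U^T); first by rewrite mulVmx.
by move=> j; rewrite -ZE; apply/eqP.
Qed.

End CongruenceCounting.

Lemma sum_pairs_hit r (i : 'I_r) :
  (\sum_(j < r) \sum_(k < r | j <= k) ((j == i) || (k == i)) = r)%N.
Proof.
have := sum_pairs_add (fun j : 'I_r => nat_of_bool (j == i)).
have -> : (\sum_(j < r) (j == i) = 1)%N.
  by rewrite (bigD1 i) //= eqxx big1 // => j /negbTE ->.
have H : (\sum_(j < r) \sum_(k < r | j <= k) ((j == i) && (k == i)) = 1)%N.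
  rewrite (bigD1 i) //= (bigD1 i) //= eqxx big1 => [|k /andP[_ /negbTE ->]] //.
  by rewrite big1 // => j /negbTE ->; rewrite big1.
rewrite muln1 => E; apply: (@addIn 1); rewrite [RHS]addn1 -E -[X in (_ + X)%N]H -big_split.
apply: eq_bigr => j _; rewrite -big_split; apply: eq_bigr => k _ /=.
by case: (j == i); case: (k == i).
Qed.

(** * Rarity of symmetric matrices without a quasi-inverse *)

Section BadMatrices.
Variables (p e : nat).
Hypotheses (p_pr : prime p) (e_gt0 : (0 < e)%N).
Local Notation N := (e + e)%N.
Local Notation m := (p ^ e)%N.
Local Notation A := 'Z_(p ^ (e + e)).

Let N_gt0 : (0 < N)%N. Proof. by rewrite addn_gt0 e_gt0. Qed.
Let eSN : (e < N)%N. Proof. by rewrite -addn1 leq_add2l. Qed.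
Let p_gt0 : (0 < p)%N. Proof. exact: prime_gt0. Qed.

(** A congruence moves [w] to the basis vector e_i, and the condition then bears on the [r] free
    entries in row or column [i]. *)
Lemma card_kill_vector r (i : 'I_r) (w : 'cV[A]_r) s : (s <= N)%N -> w i 0 = 1 ->
  (#|[set X : 'M[A]_r | (X^T == X) && pdvdmx s (X *m w)]%SET| * (p ^ s) ^ r
    = (p ^ N) ^ npairs r)%N.
Proof.
move=> sN wi.
(* As [w] has coordinate 1 at [i], [D] squares to zero, and 1 + D is invertible and sends e_i to
   [w]. *)
pose D : 'M[A]_r := (w - delta_mx i 0) *m (delta_mx 0 i : 'rV_r).
have D2 : D *m D = 0.
  rewrite /D mulmxA -(mulmxA _ _ (w - _)).
  have -> : (delta_mx 0 i : 'rV[A]_r) *m (w - delta_mx i 0) = 0.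
    rewrite mulmxBr mul_delta_mx -rowE; apply/matrixP => a b.
    by rewrite (ord1 a) (ord1 b) !mxE !eqxx wi subrr.
  by rewrite mulmx0 mul0mx.
pose U := 1%:M + D.
have UU : U \in unitmx.
  apply: (proj1 (@mulmx1_unit _ _ U (1%:M - D) _)).
  by rewrite mulmxDl mulmxBr mulmx1 mul1mx mulmxBr mulmx1 D2 subr0 subrK.
have Uw : U *m delta_mx i (0 : 'I_1) = w.
  rewrite /U /D mulmxDl mul1mx -mulmxA mul_delta_mx.
  have -> : delta_mx 0 0 = 1%:M :> 'M[A]_1.
    by apply/matrixP => a b; rewrite (ord1 a) (ord1 b) !mxE !eqxx.
  by rewrite mulmx1 addrC subrK.
pose k (a b : 'I_r) := if (a == i) || (b == i) then s else 0%N.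
have -> : #|[set X : 'M[A]_r | (X^T == X) && pdvdmx s (X *m w)]%SET| =
    #|[set X : 'M[A]_r | (X^T == X) && [forall a, forall b, pdvd (k a b) (X a b)]]%SET|.
  transitivity #|[set X : 'M[A]_r | (X^T == X) && pdvdmx s (X *m delta_mx i (0 : 'I_1))]%SET|.
    apply: (card_congruence UU) => X; rewrite -!mulmxA Uw.
    apply/idP/idP => XP; first by apply: pdvdmx_mull.
    have UTU : U^T \in unitmx by rewrite unitmx_tr.
    by rewrite -[X *m w](mulKmx UTU); apply: pdvdmx_mull.
  apply: eq_card => X; rewrite !inE; have [Xs|//] := eqVneq X^T X; rewrite /=.
  have XE a : (X *m delta_mx i (0 : 'I_1)) a 0 = X a i by rewrite -colE mxE.
  apply/pdvdmxP/forallP => [XP a|XP a b].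
    apply/forallP => b; rewrite /k; case: ifP => [/orP[]/eqP->|_].
    - by rewrite -Xs mxE -XE.
    - by rewrite -XE.
    by rewrite /pdvd expn0 dvd1n.
  rewrite (ord1 b) XE; have := forallP (XP a) i.
  by rewrite /k eqxx orbT.
have ks a b : k a b = k b a by rewrite /k orbC.
have kN a b : (k a b <= N)%N by rewrite /k; case: ifP.
rewrite card_sym_pdvd // -!expnM -expnD; congr (p ^ _)%N.
rewrite -[X in (s * X)%N](sum_pairs_hit i) /npairs !big_distrr -big_split /=; apply: eq_bigr => a _.
rewrite !big_distrr -big_split /=; apply: eq_bigr => b _.
by rewrite /k; case: ifP => _; rewrite ?muln1 ?muln0 ?subnK // subn0 addn0.
Qed.

Definition good r (X : 'M[A]_r) : bool :=
  [exists Y : 'M[A]_r, (Y^T == Y) && (X *m Y == (m%:R)%:M)].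

(** By [symmetric_quasi_inverse], a bad [X] kills modulo p^(e+1) a vector not divisible by [p].
    Scaling makes a unit coordinate 1, and the others matter only modulo p^(e+1), which leaves few
    vectors for a union bound. *)
Lemma goodPn r (X : 'M[A]_r) : X^T = X -> ~~ good X ->
  exists i (w : {ffun 'I_r -> 'I_(p ^ e.+1)}),
    (w i == 1 :> nat) && pdvdmx e.+1 (X *m (\col_j (w j : nat)%:R)).
Proof.
move=> Xs bad.
have P1 : (1 < p ^ e.+1)%N by rewrite -(exp1n e.+1) ltn_exp2r // prime_gt1.
have [v vX v1] : exists2 v : 'cV[A]_r, pdvdmx e.+1 (X *m v) & ~~ pdvdmx 1 v.
  apply: contrapT => H; case/negP: bad.
  have [v vX|Y Ys YX] := symmetric_quasi_inverse p_pr N_gt0 eSN Xs.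
    by apply: contrapT => /negP v1; apply: H; exists v.
  apply/existsP; exists Y; rewrite Ys eqxx /=; apply/eqP.
  by apply: (quasi_invC (X := Y) (Y := X)).
have [i iu] : exists i, v i 0 \is a GRing.unit.
  apply: contrapT => H; case/negP: v1; apply/pdvdmxP => i j; rewrite (ord1 j).
  by apply: contrapT => /negP vi; apply: H; exists i; rewrite unitZpow.
have [u uX ui] : exists2 u : 'cV[A]_r, pdvdmx e.+1 (X *m u) & u i 0 = 1.
  exists ((v i 0)^-1 *: v); last by rewrite mxE mulVr.
  rewrite -scalemxAr; apply/pdvdmxP => a b; rewrite mxE; apply: pdvdMl => //.
  by move/pdvdmxP: vX.
pose w : {ffun 'I_r -> 'I_(p ^ e.+1)} :=
  [ffun j => Ordinal (ltn_pmod (u j 0) (ltnW P1))].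
exists i, w; apply/andP; split.
  rewrite ffunE /= ui [nat_of_ord _](val_natZ p_pr N_gt0 1).
  by rewrite (modn_small (expp_gt1 p_pr N_gt0)) modn_small.
have wv : pdvdmx e.+1 (u - \col_j (w j : nat)%:R).
  apply/pdvdmxP => j b; rewrite (ord1 b) !mxE ffunE /= -[X in X - _]natZ_val.
  rewrite {1}(divn_eq (u j 0) (p ^ e.+1)) natrD addrK natrM mulrC.
  by apply/pdvdP => //; exists (u j 0 %/ p ^ e.+1)%:R.
have -> : X *m (\col_j (w j : nat)%:R) =
    X *m u - X *m (u - \col_j (w j : nat)%:R).
  by rewrite mulmxBr opprB addrC subrK.
apply/pdvdmxP => a b; rewrite mxE; apply: pdvdD => //; first by move/pdvdmxP: uX.
rewrite mxE pdvdN //; have := pdvdmx_mull p_pr N_gt0 X eSN wv.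
by move/pdvdmxP.
Qed.

(* Union bound over the vectors killed by [X] modulo [p ^ e.+1]. *)
Lemma card_bad r :
  (#|[set X : 'M[A]_r | (X^T == X) && ~~ good X]%SET| * p ^ e.+1
    <= r * (p ^ N) ^ npairs r)%N.
Proof.
set B := [set X | _]%SET; set P := (p ^ e.+1)%N.
have P0 : (0 < P)%N by rewrite expn_gt0 p_gt0.
have P1 : (1 < P)%N by rewrite -(exp1n e.+1) ltn_exp2r // prime_gt1.
pose T := {ffun 'I_r -> 'I_P}.
pose R i (w : T) (X : 'M[A]_r) := (w i == 1 :> nat) &&
  ((X^T == X) && pdvdmx e.+1 (X *m (\col_j (w j : nat)%:R))).
have le1 : (#|B| <= \sum_i \sum_(w : T) \sum_X R i w X)%N.
  under eq_bigr do rewrite exchange_big; rewrite exchange_big -sum1_card big_mkcond /=.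
  apply: leq_sum => X _; case: ifP => //; rewrite inE => /andP[/eqP Xs bad].
  have [i [w iw]] := goodPn Xs bad.
  rewrite (bigD1 i) //= (bigD1 w) //= /R Xs eqxx /=.
  by move: iw => /andP[-> ->].
(* For each [i] there are P^(r-1) vectors, each killed by a proportion P^-r of the symmetric
   matrices; hence the bound r/P. *)
have cW i : (#|[set w : T | w i == 1 :> nat]%SET| * P = P ^ r)%N.
  have -> : #|[set w : T | w i == 1 :> nat]%SET| =
      #|(family (fun j => [pred a : 'I_P | (j == i) ==> (a == 1 :> nat)]) : simpl_pred T)|.
    apply: eq_card => w; rewrite inE; apply/idP/familyP => [wi j|/(_ i)].
      by rewrite inE; apply/implyP => /eqP ->.
    by rewrite inE eqxx.
  rewrite card_family /image_mem foldrE big_map big_enum /= (bigD1 i) //=.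
  rewrite [X in (X * _ * _)%N](_ : _ = 1%N); last first.
    rewrite -(card1 (Ordinal P1)); apply: eq_card => a; rewrite !inE eqxx /=.
    by rewrite -val_eqE.
  rewrite mul1n (eq_bigr (fun=> P)) => [|j /negbTE ji]; last first.
    by rewrite -[RHS]card_ord; apply: eq_card => a; rewrite !inE ji.
  rewrite mulnC -[X in (X * _ = _)%N]/((fun=> P) i) -(bigD1 i (P := xpredT)) //=.
  by rewrite prod_nat_const card_ord.
have sR i w : ((\sum_X R i w X) * P ^ r = (w i == 1 :> nat) * (p ^ N) ^ npairs r)%N.
  rewrite /R; case: eqP => [wi|_]; last by rewrite big1 ?mul0n.
  rewrite mul1n -(@card_kill_vector r i (\col_j (w j : nat)%:R) e.+1) ?mxE ?wi //.
  by congr (_ * _)%N; rewrite -sum1dep_card [RHS]big_mkcond; apply: eq_bigr => X _ /=; case: ifP.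
have Pr0 : (0 < P ^ r)%N by rewrite expn_gt0 P0.
rewrite -(leq_pmul2r Pr0) -mulnA [(P * _)%N]mulnC mulnA.
apply: (@leq_trans ((\sum_i \sum_(w : T) \sum_X R i w X) * P ^ r * P)%N).
  by rewrite !leq_mul2r le1 !orbT.
rewrite [X in (X <= _)%N](_ : _ = \sum_(i < r) (P ^ r * (p ^ N) ^ npairs r))%N.
  by rewrite sum_nat_const card_ord -mulnA [(P ^ r * _)%N]mulnC.
rewrite big_distrl big_distrl /=; apply: eq_bigr => i _; rewrite -[in RHS](cW i).
rewrite big_distrl /=; under eq_bigr do rewrite sR.
rewrite -big_distrl /= mulnAC; congr (_ * _ * _)%N.
by rewrite -sum1dep_card [RHS]big_mkcond; apply: eq_bigr => w _; case: ifP.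
Qed.

End BadMatrices.

(** * Rank and numbers of generating families *)

Section Ranks.
Variable p : nat.

(** Natural coefficients make the notion of rank independent of the modulus, which varies with
    [e]. *)
Definition linn (H : zmodType) r (h : 'I_r -> H) (u : 'I_r -> nat) : H :=
  \sum_i h i *+ u i.

Definition gensn (H : zmodType) r (h : 'I_r -> H) : Prop :=
  forall y, exists u, linn h u = y.

Definition has_rank (H : zmodType) r : Prop := exists h : 'I_r -> H,
  gensn h /\ forall u, linn h u = 0 -> forall i, (p %| u i)%N.

Section Killed.
Variables (N : nat) (H : finZmodType).
Hypotheses (p_pr : prime p) (N_gt0 : (0 < N)%N).
Hypothesis Hq : forall x : H, x *+ (p ^ N) = 0.
Local Notation A := 'Z_(p ^ N).

Lemma lin_natrow r (h : 'I_r -> H) (u : 'I_r -> nat) :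
  lin h (\row_i ((u i)%:R : A)) = linn h u.
Proof. by apply: eq_bigr => i _; rewrite mxE (mulrn_natZ p_pr N_gt0 Hq). Qed.

Lemma gensnE r (h : 'I_r -> H) : gensn h <-> gens p N h.
Proof.
split=> [hP|/gensP hP y]; last first.
  by have [u <-] := hP y; exists (fun i => (u 0 i : nat)).
apply/gensP => y; have [u <-] := hP y.
by exists (\row_i (u i)%:R); rewrite lin_natrow.
Qed.

Lemma has_rankE r : has_rank H r <-> exists h : 'I_r -> H, mingens p N h.
Proof.
split=> -[h [hg hr]]; exists h; split.
- exact/gensnE.
- move=> u u0; apply/pdvdmxP => i j; rewrite (ord1 i) /pdvd expn1.
  exact: (hr (fun i => (u 0 i : nat)) u0 j).
- exact/gensnE.
- move=> u u0 i; have /hr/pdvdmxP/(_ 0 i) : lin h (\row_i ((u i)%:R : A)) = 0.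
    by rewrite lin_natrow.
  by rewrite mxE pdvd_nat // expn1.
Qed.

(* A relation with a coefficient prime to [p] makes one generator redundant. *)
Lemma has_rank_ex : exists r, has_rank H r.
Proof.
have ex : exists r, `[< exists h : 'I_r -> H, gens p N h >].
  exists #|H|; apply/asboolP; exists (fun i => enum_val i : H); apply/gensP => y.
  by exists (delta_mx 0 (enum_rank y)); rewrite (lin_delta p_pr N_gt0 Hq) enum_rankK.
have [r /asboolP[h hg] rmin] := ex_minnP ex.
exists r; apply/has_rankE; exists h; split=> // u u0.
apply/pdvdmxP => i j; rewrite (ord1 i); apply: contrapT => /negP; rewrite -unitZpow // => uj.
suff : (r <= r.-1)%N by have := ltn_ord j; lia.
apply: rmin; apply/asboolP.
case: r h hg u u0 j uj => [|r] h hg u u0 j uj; first by case: j uj.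
exists (fun i => h (lift j i)); apply/gensP => y.
have /gensP/(_ y)[v <-] := hg.
pose w := v - (v 0 j / u 0 j) *: u.
have wj : w 0 j = 0 by rewrite !mxE divrK // subrr.
exists (\row_i w 0 (lift j i)).
have -> : lin h v = lin h w.
  by rewrite (linB p_pr N_gt0 Hq) (linZ p_pr N_gt0 Hq) u0 mul0rn subr0.
rewrite /lin [RHS](bigD1_ord j) //= wj mulr0n add0r.
by apply: eq_bigr => k _; rewrite mxE.
Qed.

(** By [gens_std] a minimal family is no longer than any generating one. *)
Lemma has_rank_uniq r s : has_rank H r -> has_rank H s -> r = s.
Proof.
move=> /has_rankE[h hm] /has_rankE[k km]; apply/eqP; rewrite eqn_leq.
have [a [E _]] := gens_std p_pr N_gt0 Hq hm (proj1 km).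
have [b [E' _]] := gens_std p_pr N_gt0 Hq km (proj1 hm).
by rewrite {1}E leq_addr E' leq_addr.
Qed.

End Killed.
End Ranks.

Section RealCounts.
Variables (R : realType) (p : nat).
Hypothesis p_pr : prime p.

(** The proportion of invertible matrices among k x k matrices over Z/p^N, see [cardGL_real]. *)
Definition cpr k : R := \prod_(1 <= i < k.+1) (1 - (p%:R : R)^-1 ^+ i).

Lemma pR_gt0 : 0 < (p%:R : R).
Proof. by rewrite ltr0n prime_gt0. Qed.

Lemma pinv_lt1 i : (0 < i)%N -> (p%:R : R)^-1 ^+ i < 1.
Proof.
move=> i0; rewrite exprn_ilt1 -?lt0n // ?invr_ge0 ?ler0n //.
by rewrite invf_lt1 ?pR_gt0 // ltr1n prime_gt1.
Qed.

Lemma cpr_gt0 k : 0 < cpr k.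
Proof.
rewrite /cpr big_nat; apply: prodr_gt0 => i /andP[i0 _].
by rewrite subr_gt0 pinv_lt1.
Qed.

Lemma prod_pow_sub1 n :
  ((\prod_(1 <= i < n.+1) (p ^ i - 1))%N%:R : R) = p%:R ^+ 'C(n.+1, 2) * cpr n.
Proof.
elim: n => [|n IH]; first by rewrite /cpr !big_geq // expr0 mul1r.
have cS : cpr n.+1 = cpr n * (1 - (p%:R : R)^-1 ^+ n.+1) by rewrite /cpr big_nat_recr.
rewrite big_nat_recr //= natrM IH cS [in RHS]binS bin1 exprD -!mulrA.
congr (_ * _); rewrite [RHS]mulrCA; congr (_ * _).
rewrite natrB ?expn_gt0 ?prime_gt0 // natrX mulrBr mulr1 -exprMn divff ?expr1n //.
by rewrite gt_eqF // pR_gt0.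
Qed.

Lemma cardGL_real N n : (0 < N)%N ->
  ((cardGL p N n)%:R : R) = (p ^ N)%:R ^+ (n * n) * cpr n.
Proof.
move=> N0; rewrite card_unitmx // natrM prod_pow_sub1 natrX mulrA -exprD.
congr (_ * _); rewrite natrX -exprM; congr (_ ^+ _).
have H : ('C(n, 2) + 'C(n.+1, 2) = n * n)%N.
  elim: n => [|n IH] //; rewrite [in 'C(n.+2, 2)]binS bin1 [in 'C(n.+1, 2)]binS bin1.
  by move: IH; rewrite binS bin1; lia.
by rewrite -addnA H -{2}(prednK N0); lia.
Qed.

Lemma card_gens_real N (H : finZmodType) g k (b : 'I_g -> H) : (0 < N)%N ->
  (forall y : H, y *+ (p ^ N) = 0) -> mingens p N b ->
  (#|[set F : {ffun 'I_(g + k) -> H} | gens p N F]%SET|%:R : R) =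
  #|H|%:R ^+ (g + k) * cpr (g + k) / cpr k.
Proof.
move=> N0 Hq bm; have /(congr1 (fun n => n%:R : R)) := card_gens p_pr N0 Hq k bm.
have q0 : (p%:R : R) ^+ N != 0 by rewrite expf_neq0 // gt_eqF // pR_gt0.
have c0 : cpr k != 0 by rewrite gt_eqF // cpr_gt0.
rewrite !natrM !cardGL_real // !natrX => E; apply: (mulIf c0); rewrite divfK //.
apply: (mulIf (expf_neq0 ((g + k) * (g + k)) q0)).
transitivity (p%:R ^+ N ^+ ((g + k) * (g + k)) * cpr (g + k) * #|H|%:R ^+ (g + k)).
  rewrite -E; have -> : ((g + k) * (g + k) = g * (g + k) + g * k + k * k)%N by lia.
  by rewrite !(exprD (p%:R ^+ N)); ring.
ring.
Qed.

End RealCounts.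

(** * Summation over the classes of given rank and exponent *)

Section Level.
Variables (R : realType) (p : nat).
Hypothesis p_pr : prime p.
Variables (e r : nat).
Hypothesis e_gt0 : (0 < e)%N.
Variable K : finZmodType.
Hypothesis Km : forall y : K, y *+ (p ^ e) = 0.
Local Notation N := (e + e)%N.
Local Notation m := (p ^ e)%N.
Local Notation A := 'Z_(p ^ (e + e)).
Local Notation rp x := (generic_quotient.repr x : paired_pgroup p).

Let N_gt0 : (0 < N)%N. Proof. by rewrite addn_gt0 e_gt0. Qed.

Definition presents (x : Ap p) (X : 'M[A]_r) : Prop :=
  exists h : 'I_r -> rp x, [/\ forall y : rp x, y *+ m = 0, gens p N h &
    compat (@pairing p (rp x)) X h].

Definition level (x : Ap p) : Prop :=
  has_rank p (rp x) r /\ forall y : rp x, y *+ m = 0.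

Definition goodset : {set 'M[A]_r} :=
  [set X : 'M[A]_r | [&& X^T == X, pdvdmx 1 X & good X]]%SET.

Definition killing (X : 'M[A]_r) : nat :=
  #|[set F : {ffun 'I_r -> K} | gens p N F && [forall i, lin F (row i X) == 0]]%SET|.

Lemma presents_good x X : presents x X -> (X \in goodset) = pdvdmx 1 X.
Proof.
move=> [h [_ _ /compatP[Y [Xs Ys XY] _]]]; rewrite inE Xs eqxx /=.
have -> : good X by apply/existsP; exists Y; rewrite Ys XY !eqxx.
by rewrite andbT.
Qed.

Lemma presents_level x X : presents x X -> X \in goodset <-> level x.
Proof.
move=> xX; rewrite (presents_good xX); have [h [xm hg hX]] := xX.
have xq := killed_sq xm; have dd := pairing_duality (rp x).
split=> [X1|[/(has_rankE p_pr N_gt0 xq)[k km] _]].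
  split=> //; apply/(has_rankE p_pr N_gt0 xq); exists h.
  exact/(compat_mingens p_pr e_gt0 dd hg hX).
apply/(compat_mingens p_pr e_gt0 dd hg hX).
exact: (mingens_all p_pr N_gt0 xq km hg).
Qed.

Lemma presents_uniq x y X : presents x X -> presents y X -> x = y.
Proof.
move=> [h [xm hg hX]] [k [ym kg kX]].
have [f [fb fD fP _]] := compat_isometry p_pr e_gt0 (pairing_duality (rp x))
  (pairing_duality (rp y)) xm ym hg kg hX kX.
rewrite -[x]reprK -[y]reprK; apply/eqmodP/asboolP.
by exists f.
Qed.

Lemma presents_ex X : X \in goodset -> exists x, presents x X.
Proof.
rewrite inE => /and3P[/eqP Xs X1 /existsP[Y /andP[/eqP Ys /eqP XY]]].
have XYP : quasi_inv X Y by split.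
have [B [k [Bm kg kX]]] := exists_compat p_pr e_gt0 XYP.
exists (\pi_(Ap p)%qT B); have [f [fb fD fP]] := isometric_sym (isometric_repr B).
have [hg hX] := isometry_transport fb fD fP kg kX.
exists (f \o k); split=> // x.
have [g fK gK] := fb; rewrite -[x]gK.
by rewrite -(addmorphMn fD) Bm addmorph0.
Qed.

(** Double count of the pairs (h, X) in which [X] presents the class through [h]: [card_compat]
    counts the [X] for each generating [h], [card_compat_gens] the [h] for each [X]. *)
Lemma card_presents x : level x ->
  (#|[set X in goodset | `[< presents x X >]]%SET| *
     #|pairing_Aut (@pairing p (rp x))| * #|rp x| ^ r.+1 =
   #|[set h : {ffun 'I_r -> rp x} | gens p N h]%SET| * (p ^ N) ^ npairs r)%N.
Proof.
move=> xl; have [xr xm] := xl; have xq := killed_sq xm.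
have dd := pairing_duality (rp x).
have /(has_rankE p_pr N_gt0 xq)[k km] := xr.
pose Q (h : {ffun 'I_r -> rp x}) (X : 'M[A]_r) :=
  gens p N h && compat (@pairing p (rp x)) X h.
have QP h X : Q h X -> presents x X.
  by case/andP => hg hX; exists h.
have E1 : (\sum_h \sum_X Q h X * #|rp x| ^ r.+1 =
    #|[set h : {ffun 'I_r -> rp x} | gens p N h]%SET| * (p ^ N) ^ npairs r)%N.
  rewrite -sum1dep_card big_distrl /= [RHS]big_mkcond; apply: eq_bigr => h _.
  rewrite -big_distrl /=; case: ifP => hg; last first.
    by rewrite big1 ?mul0n // => X _; rewrite /Q hg.
  have -> : ((p ^ N) ^ npairs r = m ^ npairs r * m ^ npairs r)%N by rewrite -expnMn -expnD.
  rewrite mul1n -(card_compat p_pr e_gt0 dd xm (mingens_all p_pr N_gt0 xq km hg)).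
  congr (_ * _)%N; rewrite -sum1dep_card [RHS]big_mkcond; apply: eq_bigr => X _.
  by rewrite /Q hg /=; case: ifP.
rewrite -E1; under eq_bigr do rewrite -big_distrl; rewrite -big_distrl /=.
congr (_ * _)%N; rewrite exchange_big /= -sum1dep_card big_distrl /=.
rewrite [LHS]big_mkcond; apply: eq_bigr => X _; case: ifP => [/andP[Xg /asboolP xX]|nX].
  rewrite mul1n; have [h [_ hg hX]] := xX.
  rewrite -(card_compat_gens p_pr e_gt0 dd xm hg hX) -sum1dep_card [LHS]big_mkcond.
  by apply: eq_bigr => h' _; rewrite /Q; case: ifP.
rewrite big1 // => h _; case: (boolP (Q h X)) => // /QP xX; move: nX.
by rewrite (asboolT xX) andbT; have /(presents_level xX) -> := xl.
Qed.

Lemma presents_Sur x X : presents x X -> num_Sur K x = killing X.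
Proof.
move=> [h [xm hg hX]].
exact: (card_Sur_compat p_pr e_gt0 (pairing_duality (rp x)) xm Km hg hX).
Qed.

Lemma level_presents x : level x -> exists2 X, X \in goodset & presents x X.
Proof.
move=> xl; have [xr xm] := xl; have xq := killed_sq xm.
have dd := pairing_duality (rp x).
have /(has_rankE p_pr N_gt0 xq)[k km] := xr.
have : (0 < #|[set X : 'M[A]_r | compat (@pairing p (rp x)) X k]%SET|)%N.
  rewrite lt0n; apply/negP => /eqP E.
  have := card_compat p_pr e_gt0 dd xm km; rewrite E mul0n => /esym/eqP.
  by rewrite muln_eq0 !expn_eq0 (gtn_eqF (prime_gt0 p_pr)).
move=> /card_gt0P[X]; rewrite inE => kX.
have xX : presents x X by exists k; split=> //; case: km.
by exists X => //; apply/(presents_level xX).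
Qed.

Lemma cpr0 : cpr R p 0 = 1. Proof. by rewrite /cpr big_geq. Qed.

Lemma sym_gt0 : 0 < ((p ^ N) ^ npairs r)%:R :> R.
Proof. by rewrite ltr0n !expn_gt0 prime_gt0. Qed.

Lemma card_presents_real x : level x ->
  (#|[set X in goodset | `[< presents x X >]]%SET|%:R : R) =
  ((p ^ N) ^ npairs r)%:R * cpr R p r /
    (#|rp x|%:R * #|pairing_Aut (@pairing p (rp x))|%:R).
Proof.
move=> xl; have [xr xm] := xl; have xq := killed_sq xm.
have /(has_rankE p_pr N_gt0 xq)[k km] := xr.
have := card_presents xl.
have := @card_gens_real R p p_pr N (rp x) r 0 k N_gt0 xq km.
rewrite addn0 cpr0 divr1; move: #|[set h : {ffun _ -> _} | _]%SET| => n nE.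
move=> /(congr1 (fun n => n%:R : R)); rewrite !natrM nE.
have x0 : (#|rp x|%:R : R) != 0.
  by rewrite pnatr_eq0 -lt0n; apply/card_gt0P; exists 0.
have a0 : (#|pairing_Aut (@pairing p (rp x))|%:R : R) != 0.
  rewrite pnatr_eq0 -lt0n; apply/card_gt0P; exists (1%g).
  by rewrite inE; apply/andP; split; apply/forallP => a; apply/forallP => b; rewrite !permE.
move=> E; apply: (mulIf (mulf_neq0 x0 a0)); rewrite divfK ?mulf_neq0 //.
apply: (mulIf (expf_neq0 r x0)).
rewrite natrX exprS in E.
transitivity (#|[set X in goodset | `[< presents x X >]]%SET|%:R *
  #|pairing_Aut (@pairing p (rp x))|%:R * (#|rp x|%:R * #|rp x|%:R ^+ r) : R); first ring.
rewrite E; ring.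
Qed.

(** The matrices presenting a class are in number proportional to its weight, and the number of
    surjections can be read on any of them. Enumerating classes through the good matrices also shows
    that a level is finite. *)
Lemma level_sum : exists s : seq (Ap p), [/\ uniq s, forall x, x \in s <-> level x &
  \sum_(x <- s) weight R (rp x) * (num_Sur K x)%:R =
  weight_const R p / (((p ^ N) ^ npairs r)%:R * cpr R p r) *
    (\sum_(X in goodset) killing X)%N%:R].
Proof.
have [cls clsP] : exists cls : 'M[A]_r -> Ap p, forall X, X \in goodset -> presents (cls X) X.
  have H X : exists x, X \in goodset -> presents x X.
    case: (boolP (X \in goodset)) => [/presents_ex[x xX]|_]; first by exists x.
    by exists point.
  exact: fin_all_exists H.
pose s := undup [seq cls X | X <- enum goodset].
have sP x : x \in s <-> level x.
  rewrite mem_undup; split=> [/mapP[X]|/level_presents[X Xg xX]].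
    by rewrite mem_enum => Xg ->; apply/(presents_level (clsP X Xg)).
  by apply/mapP; exists X; rewrite ?mem_enum //; apply: presents_uniq xX (clsP X Xg).
exists s; split=> //; first exact: undup_uniq.
have term x : x \in s -> weight R (rp x) * (num_Sur K x)%:R =
    weight_const R p / (((p ^ N) ^ npairs r)%:R * cpr R p r) *
    \sum_(X in goodset | cls X == x) (killing X)%:R.
  move=> /sP xl.
  have -> : \sum_(X in goodset | cls X == x) (killing X)%:R =
      #|[set X in goodset | `[< presents x X >]]%SET|%:R * (num_Sur K x)%:R :> R.
    rewrite -sum1dep_card natr_sum mulr_suml.
    rewrite [RHS](eq_bigl (fun X => (X \in goodset) && (cls X == x))) => [|X].
      by apply: eq_bigr => X /andP[Xg /eqP E]; rewrite mul1r -E (presents_Sur (clsP X Xg)).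
    case: (boolP (X \in goodset)) => //= Xg; apply/asboolP/eqP => [xX|<-]; last exact: clsP.
    by apply: presents_uniq (clsP X Xg) xX.
  rewrite card_presents_real // /weight mulrA; congr (_ * _).
  have s0 := sym_gt0; have c0 : 0 < cpr R p r by apply: cpr_gt0.
  by rewrite mulrA mulfVK // mulf_neq0 // gt_eqF.
rewrite (eq_big_seq _ term) -mulr_sumr; congr (_ * _).
rewrite natr_sum [RHS](bigID xpredT) /= [X in _ = _ + X]big_pred0 ?addr0 => [|X]; last by rewrite andbF.
under [RHS]eq_bigl do rewrite andbT.
under eq_bigr do rewrite big_mkcondr.
rewrite exchange_big /=; apply: eq_bigr => X Xg; rewrite -big_mkcond /=.
have cs : cls X \in s by rewrite mem_undup map_f // mem_enum.
by rewrite (big_rem _ cs) /= eqxx big1_seq ?addr0 // => x; rewrite mem_rem_uniq ?undup_uniq // => /andP[/eqP <-]; rewrite inE eqxx.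
Qed.

End Level.

Lemma npairsS r : npairs r.+1 = (npairs r + r.+1)%N.
Proof.
have E n : (2 * npairs n = n.+1 * n)%N.
  have := sum_pairs_add (fun _ : 'I_n => 1%N); rewrite sum_nat_const card_ord muln1 => <-.
  by rewrite big_distrr; apply: eq_bigr => i _; rewrite big_distrr.
by have := E r; have := E r.+1; lia.
Qed.

Lemma npairs0 : npairs 0 = 0%N.
Proof. by rewrite /npairs big_ord0. Qed.

(** Since [f] is nondecreasing, the pairs i <= j in the first block contribute f_j, hence (j + 1)
    f_j in all with indices from 0; the second sum on the left completes this to g f_j and becomes
    the exponent of the answer. *)
Lemma sum_max_pad g k (f : 'I_g -> nat) : (forall j, (0 < f j)%N) ->
  (forall i j : 'I_g, (i <= j)%N -> (f i <= f j)%N) ->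
  (\sum_(i < g + k) \sum_(j < g + k | i <= j) maxn 1 (maxn (pad f i) (pad f j)) +
     \sum_(j < g) (g - j.+1) * f j
   = (g + k) * \sum_(j < g) f j + npairs k)%N.
Proof.
move=> f0 fle.
have E1 (a : 'I_g) : (\sum_(j < g + k | lshift k a <= j)
    maxn 1 (maxn (pad f (lshift k a)) (pad f j)) =
    \sum_(c < g | a <= c) f c + k * f a)%N.
  rewrite big_split_ord /=; congr (_ + _)%N.
    apply: eq_bigr => c ac; rewrite !pad_lshift.
    by have := f0 c; have := fle _ _ ac; lia.
  rewrite (eq_big xpredT (fun=> f a)) => [|c|c _].
  - by rewrite sum_nat_const card_ord.
  - by rewrite /= (leq_trans (ltnW (ltn_ord a))) // leq_addr.
  - by rewrite pad_lshift pad_rshift; have := f0 a; lia.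
have E2 (b : 'I_k) : (\sum_(j < g + k | rshift g b <= j)
    maxn 1 (maxn (pad f (rshift g b)) (pad f j)) = \sum_(c < k | b <= c) 1)%N.
  rewrite big_split_ord /= big_pred0 => [|c]; last first.
    by apply/negbTE; rewrite -ltnNge (leq_trans (ltn_ord c)) // leq_addr.
  apply: eq_big => [c|c _]; first by rewrite leq_add2l.
  by rewrite !pad_rshift.
rewrite big_split_ord /=; under eq_bigr do rewrite E1.
under [X in (_ + X + _)%N]eq_bigr do rewrite E2.
rewrite big_split /= -big_distrr /= -/(npairs k).
have E3 : (\sum_(a < g) \sum_(c < g | a <= c) f c + \sum_(j < g) (g - j.+1) * f j =
    g * \sum_(j < g) f j)%N.
  rewrite (exchange_big_dep xpredT) //= big_distrr -big_split /=.
  apply: eq_bigr => c _; rewrite sum_nat_const.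
  have -> : #|[pred a : 'I_g | a <= c]%N| = c.+1.
    rewrite -sum1_card (eq_bigl (fun a : 'I_g => a < c.+1)%N) // -(big_ord_widen _ (fun=> 1%N)) //.
    by rewrite sum_nat_const card_ord muln1.
  by rewrite -mulnDl subnKC // ltn_ord.
by rewrite mulnDl -E3 addnAC [X in (X + _)%N = _]addnAC.
Qed.

(** * Average number of killed generating families, with its error *)

Section Bounds.
Variables (R : realType) (p : nat).
Hypothesis p_pr : prime p.
Variables (K : finZmodType) (g : nat) (b : 'I_g -> K) (f : 'I_g -> nat).
Hypotheses (bgen : gensn b)
  (brel : forall u, linn b u = 0 <-> forall j, (p ^ f j %| u j)%N)
  (f_gt0 : forall j, (0 < f j)%N)
  (f_nd : forall i j : 'I_g, (i <= j)%N -> (f i <= f j)%N).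

(** Indices start at 0, so this is (g-1) f_1 + (g-2) f_2 + ... + f_(g-1) in the usual numbering. *)
Definition moment_exp : nat := (\sum_(j < g) (g - j.+1) * f j)%N.

Definition rank_moment k : R :=
  (p%:R : R)^-1 ^+ npairs k / cpr R p k.

(** It is 0 for [r < g], as a group of rank [r] has no quotient of larger rank. *)
Definition moment (r : nat) : R :=
  if (g <= r)%N then p%:R ^+ moment_exp * rank_moment (r - g) else 0.

Section AtLevel.
Variable e : nat.
Hypotheses (e_gt0 : (0 < e)%N) (fe : forall j, (f j <= e)%N).
Local Notation N := (e + e)%N.
Local Notation A := 'Z_(p ^ (e + e)).

Let N_gt0 : (0 < N)%N. Proof. by rewrite addn_gt0 e_gt0. Qed.

Lemma struct_killed (y : K) : y *+ (p ^ e) = 0.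
Proof.
have [u <-] := bgen y; rewrite /linn -sumrMnl.
have -> : \sum_i b i *+ u i *+ p ^ e = linn b (fun i => u i * p ^ e)%N.
  by apply: eq_bigr => i _; rewrite mulrnA.
by apply/brel => j; rewrite dvdn_mull // dvdn_exp2l.
Qed.

Let Kq := killed_sq struct_killed.

Lemma struct_gens : gens p N b. Proof. exact/(gensnE p_pr N_gt0 Kq). Qed.

Lemma struct_rel (u : 'rV[A]_g) : lin b u = 0 <-> forall j, pdvd (f j) (u 0 j).
Proof. exact: (brel (fun j => (u 0 j : nat))). Qed.

Let fN j : (f j <= N)%N. Proof. by rewrite (leq_trans (fe j)) // leq_addr. Qed.

Lemma struct_mingens : mingens p N b.
Proof.
split; first exact: struct_gens.
move=> u /struct_rel uP; apply/pdvdmxP => i j; rewrite (ord1 i).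
by apply: pdvd_leq (uP j).
Qed.

Lemma struct_card : #|K| = (p ^ \sum_(j < g) f j)%N.
Proof.
have := card_lin_fiber p_pr N_gt0 Kq 0 struct_gens.
have -> : #|[set u : 'rV[A]_g | lin b u == 0]%SET| = (\prod_(j < g) p ^ (N - f j))%N.
  under eq_bigr do rewrite -card_pdvd //.
  rewrite -card_rows; apply: eq_card => u; rewrite !inE.
  apply/eqP/forallP => [/struct_rel H j|H]; first by rewrite inE.
  by apply/struct_rel => j; have := H j; rewrite inE.
move=> E; have P0 : (0 < \prod_(j < g) p ^ (N - f j))%N.
  by apply: prodn_gt0 => j; rewrite expn_gt0 prime_gt0.
apply/eqP; rewrite -(eqn_pmul2l P0) E expn_sum -big_split /=; apply/eqP.
under eq_bigr do rewrite -expnD subnK //.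
by rewrite prod_nat_const card_ord.
Qed.

Definition sym1 r : {set 'M[A]_r} := [set X : 'M[A]_r | (X^T == X) && pdvdmx 1 X]%SET.

(** Exchanging the sums, every generating family is killed by the same number of matrices. All
    symmetric X divisible by [p] take part here, good or not, which is what makes the count
    exact. *)
Lemma total_killing r :
  ((\sum_(X in sym1 r) killing K X)%N%:R : R) =
  ((p ^ N) ^ npairs r)%:R * cpr R p r * moment r.
Proof.
rewrite /moment; case: leqP => gr; last first.
  rewrite mulr0 big1 // => X _; apply/eqP; rewrite cards_eq0; apply/eqP/setP => F.
  rewrite !inE; apply/negbTE; rewrite negb_and; apply/orP; left; apply/negP => Fg.
  have [k [E _]] := gens_std p_pr N_gt0 Kq struct_mingens Fg.
  by move: gr; rewrite E ltnNge leq_addr.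
move: (r - g)%N (subnKC gr) => k E; subst r.
have -> : (\sum_(X in sym1 (g + k)) killing K X =
    #|[set F : {ffun 'I_(g + k) -> K} | gens p N F]%SET| *
    p ^ \sum_(i < g + k) \sum_(j < g + k | i <= j)
     (N - maxn 1 (maxn (pad f i) (pad f j))))%N.
  rewrite -sum1dep_card big_distrl /=.
  transitivity (\sum_(X in sym1 (g + k)) \sum_(F : {ffun 'I_(g + k) -> K} | gens p N F)
      nat_of_bool [forall i, (lin F (row i X) == 0)%R])%N.
    apply: eq_bigr => X _; rewrite /killing -sum1dep_card big_mkcondr /=.
    by apply: eq_bigr => F _; case: ifP.
  rewrite exchange_big /=; apply: eq_bigr => F Fg; rewrite mul1n.
  rewrite -(@card_sym_killing p N p_pr N_gt0 K g k b f F Kq struct_gens struct_rel _ Fg).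
    rewrite -sum1dep_card [LHS]big_mkcond [RHS]big_mkcond; apply: eq_bigr => X _.
    by rewrite inE andbA; case: ifP => //= _; case: ifP.
  by move=> j; rewrite f_gt0 fN.
rewrite natrM (card_gens_real R p_pr k N_gt0 Kq struct_mingens) struct_card.
have p0 : (p%:R : R) != 0 by rewrite gt_eqF // pR_gt0.
have c0 n : cpr R p n != 0 by rewrite gt_eqF // cpr_gt0.
set S := (\sum_(i < g + k) \sum_(j < g + k | i <= j) (N - _))%N.
have SE : (S + (\sum_(j < g) f j) * (g + k) + npairs k =
    N * npairs (g + k) + moment_exp)%N.
  have := sum_max_pad k f_gt0 f_nd; rewrite -/moment_exp.
  set M := (\sum_(i < g + k) _)%N => ME.
  have SM : (S + M = N * npairs (g + k))%N.
    rewrite /S /M -big_split /npairs big_distrr /=; apply: eq_bigr => i _.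
    rewrite -big_split big_distrr /=; apply: eq_bigr => j _; rewrite muln1 subnK //.
    rewrite !geq_max N_gt0 /= /pad.
    by case: fintype.split => a; case: fintype.split => c //; rewrite ?fN.
  by move: ME SM; rewrite [((g + k) * _)%N]mulnC; lia.
rewrite /rank_moment !natrX -!exprM exprVn.
have key : (p%:R : R) ^+ S * p%:R ^+ ((\sum_(j < g) f j) * (g + k)) * p%:R ^+ npairs k =
    p%:R ^+ (N * npairs (g + k)) * p%:R ^+ moment_exp.
  by rewrite -!exprD SE.
apply: (mulIf (mulf_neq0 (expf_neq0 (npairs k) p0) (c0 k))).
transitivity (p%:R ^+ S * p%:R ^+ ((\sum_(j < g) f j) * (g + k)) * p%:R ^+ npairs k *
    cpr R p (g + k)).
  by field; rewrite c0.
rewrite key; field; rewrite c0 /=; exact: expf_neq0.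
Qed.

(** The bad matrices are a proportion at most r/p^(e+1) of the symmetric ones, and each kills at
    most #K^r families. *)
Lemma good_bounds r :
  ((p ^ N) ^ npairs r)%:R * cpr R p r * moment r -
    ((p ^ N) ^ npairs r)%:R * (r%:R * #|K|%:R ^+ r / p%:R ^+ e.+1)
   <= ((\sum_(X in goodset p e r) killing K X)%N%:R : R)
   <= ((p ^ N) ^ npairs r)%:R * cpr R p r * moment r.
Proof.
rewrite -total_killing; set q := ((p ^ N) ^ npairs r)%:R.
pose B : {set 'M[A]_r} := [set X : 'M[A]_r | (X^T == X) && ~~ good X]%SET.
have E : (\sum_(X in sym1 r) killing K X = \sum_(X in goodset p e r) killing K X +
   \sum_(X in sym1 r | ~~ good X) killing K X)%N.
  rewrite (bigID (@good p e r)) /=; congr (_ + _)%N; apply: eq_bigl => X.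
  by rewrite !inE andbA.
rewrite E natrD; apply/andP; split; last by rewrite lerDl ler0n.
rewrite lerBlDr lerD2l.
have pe0 : 0 < (p%:R : R) ^+ e.+1 by rewrite exprn_gt0 // pR_gt0.
have le1 : (\sum_(X in sym1 r | ~~ good X) killing K X <= #|B| * #|K| ^ r)%N.
  rewrite -sum_nat_const [leqRHS](bigID (@pdvdmx p N 1 r r)) /=.
  apply: leq_trans (leq_addr _ _).
  rewrite [leqLHS](eq_bigl (fun X => (X \in B) && pdvdmx 1 X)) => [|X]; last first.
    by rewrite !inE andbAC.
  apply: leq_sum => X _; rewrite /killing (leq_trans (max_card _)) //.
  by rewrite card_ffun card_ord.
have le2 := card_bad p_pr e_gt0 r; rewrite -/B in le2.
apply: (@le_trans _ _ ((#|B| * #|K| ^ r)%N%:R)); first by rewrite ler_nat.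
rewrite mulrA ler_pdivlMr // /q -!natrX -!natrM ler_nat.
rewrite mulnAC mulnA leq_mul2r; apply/orP; right.
by rewrite [X in (_ <= X)%N]mulnC.
Qed.

End AtLevel.
End Bounds.

(** * Euler's identity *)

Section EulerIdentity.
Variables (R : realType) (p : nat).
Hypothesis p_pr : prime p.
Local Notation x := ((p%:R : R)^-1).
Local Notation c := (cpr R p).
Local Notation rm := (rank_moment R p).

Let x_ge0 : 0 <= x. Proof. by rewrite invr_ge0. Qed.
Let x_half : x <= 2^-1.
Proof. by rewrite lef_pV2 ?posrE ?pR_gt0 ?ltr0n // ler_nat prime_gt1. Qed.
Let xn_ge0 n : 0 <= x ^+ n. Proof. exact: exprn_ge0. Qed.
Let x_le1 : x <= 1. Proof. by apply: le_trans x_half _; rewrite invf_le1 ?ler1n. Qed.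
Let xn_le1 n : x ^+ n <= 1. Proof. exact: exprn_ile1. Qed.
Let xS n : 2 * x ^+ n.+1 <= x ^+ n.
Proof. by rewrite exprS; have := xn_ge0 n; have := x_half; nra. Qed.

Lemma cprS n : c n.+1 = c n * (1 - x ^+ n.+1).
Proof. by rewrite /cpr big_nat_recr. Qed.

Let c_gt0 n : 0 < c n. Proof. exact: cpr_gt0. Qed.

(** The extra x^(n+j) carries the induction: as x <= 1/2, lowering it to x^(n+j+1) pays for the next
    factor. *)
Lemma cpr_tail n j : c n * (1 - x ^+ n + x ^+ (n + j)) <= c (n + j).
Proof.
elim: j => [|j IH]; first by rewrite addn0 subrK mulr1.
rewrite addnS cprS; have H := xS (n + j); have h1 := xn_le1 n.
have h2 := xn_ge0 (n + j).+1; have h3 := xn_le1 (n + j).+1; have h4 := xn_ge0 n.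
have h5 : x ^+ (n + j) <= x ^+ n by apply: ler_wiXn2l => //; rewrite leq_addr.
have h6 := xn_ge0 (n + j).
apply: le_trans (_ : c n * (1 - x ^+ n + x ^+ (n + j)) * (1 - x ^+ (n + j).+1) <= _).
  rewrite -mulrA ler_pM2l //; nra.
by rewrite ler_wpM2r // subr_ge0.
Qed.

Lemma cpr_nincr n j : c (n + j) <= c n.
Proof.
elim: j => [|j IH]; rewrite ?addn0 // addnS cprS.
by apply: le_trans IH; apply: ler_piMr; [exact: ltW | rewrite lerBlDr lerDl].
Qed.

Lemma rank_momentS k : rm k.+1 = rm k * (x ^+ k.+1 / (1 - x ^+ k.+1)).
Proof. by rewrite /rank_moment npairsS exprD cprS invfM mulrACA. Qed.

Lemma rank_moment_ge0 k : 0 <= rm k.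
Proof. by rewrite divr_ge0 // ltW. Qed.

Let qprod n k : R := \prod_(i < k) (1 - x ^+ (n - i)).

Let qprodE n k : (k <= n)%N -> qprod n k * c (n - k) = c n.
Proof.
elim: k => [|k IH] kn; first by rewrite /qprod big_ord0 mul1r subn0.
rewrite -(IH (ltnW kn)) /qprod big_ord_recr /= -mulrA; congr (_ * _).
by rewrite -(subnSK kn) cprS mulrC.
Qed.

(** x^(k(k+1)/2) times the Gaussian binomial coefficient of n over k at x; [bb_rec] is its Pascal
    rule. *)
Let bb n k := rm k * qprod n k.

Let bb_rec n k : (k <= n)%N -> bb n.+1 k.+1 = bb n k.+1 + x ^+ n.+1 * bb n k.
Proof.
move=> kn; rewrite /bb rank_momentS.
have -> : qprod n.+1 k.+1 = (1 - x ^+ n.+1) * qprod n k.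
  by rewrite /qprod big_ord_recl /= subn0.
have -> : qprod n k.+1 = qprod n k * (1 - x ^+ (n - k)) by rewrite /qprod big_ord_recr.
have d0 : 1 - x ^+ k.+1 != 0 by rewrite gt_eqF // subr_gt0 pinv_lt1.
have -> : x ^+ n.+1 = x ^+ k.+1 * x ^+ (n - k) by rewrite -exprD addSn subnKC.
move: (x ^+ k.+1) (x ^+ (n - k)) d0 => a b d0; field.
by [].
Qed.

Let bb0 n : bb n 0 = 1.
Proof. by rewrite /bb /qprod big_ord0 mulr1 /rank_moment npairs0 expr0 cpr0 divr1. Qed.

(** The finite q-binomial theorem, whose limit is Euler's identity. *)
Let qbinomial n : \prod_(1 <= i < n.+1) (1 + x ^+ i) = \sum_(k < n.+1) bb n k.
Proof.
elim: n => [|n IH]; first by rewrite big_geq // big_ord1 bb0.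
rewrite big_nat_recr //= mulrDr mulr1 IH [in RHS]big_ord_recl bb0 /=.
rewrite [in RHS](eq_bigr (fun k : 'I_n.+1 => bb n k.+1 + x ^+ n.+1 * bb n k)); last first.
  by move=> k _; rewrite -bb_rec // -ltnS.
rewrite big_split /= addrA -mulr_sumr [x ^+ n.+1 * _]mulrC; congr (_ + _).
have -> : 1 + \sum_(k < n.+1) bb n k.+1 = \sum_(k < n.+2) bb n k.
  by rewrite [RHS]big_ord_recl bb0.
have z : bb n n.+1 = 0.
  by rewrite /bb /qprod big_ord_recr /= subnn expr0 subrr !mulr0.
by rewrite [RHS]big_ord_recr /= z addr0.
Qed.

Let Cn n : R := \prod_(1 <= i < n.+1) (1 - x ^+ (2 * i).-1).

Let CnS n : Cn n.+1 = Cn n * (1 - x ^+ (n + n).+1).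
Proof.
rewrite /Cn big_nat_recr //=; congr (_ * (1 - x ^+ _)); lia.
Qed.

(** Among the factors of c(2n), the even ones split as 1 - x^(2i) = (1 - x^i)(1 + x^i) and the odd
    ones form [Cn]. *)
Let Cn_prod n : Cn n * \prod_(1 <= i < n.+1) (1 + x ^+ i) * c n = c (n + n).
Proof.
elim: n => [|n IH]; first by rewrite /Cn !big_geq // !mul1r.
rewrite CnS big_nat_recr //= addSn addnS !cprS -IH.
have -> : x ^+ (n + n).+2 = x ^+ n.+1 * x ^+ n.+1 by rewrite -exprD addSn addnS.
ring.
Qed.

Let weight_constE : weight_const R p = limn Cn.
Proof.
rewrite /weight_const; congr (limn _); apply/funext => n.
rewrite big_nat [RHS]big_nat; apply: eq_bigr => i /andP[i0 _].
congr (1 - _); have -> : (1 - 2 * i%:Z)%R = - ((2 * i).-1)%:Z by lia.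
by rewrite -exprnN exprVn.
Qed.

(** Telescoping as in [cpr_tail]; it keeps the infinite product above (1 - x)(1 - x^2), hence
    nonzero. *)
Let Cn_lb n : (1 - x) * (1 - x ^+ 2 + x ^+ (n.+1 + n.+1)) <= Cn n.+1.
Proof.
elim: n => [|n IH].
  by rewrite /Cn big_nat1 expr1 subrK mulr1.
rewrite CnS; set y := x ^+ (n.+1 + n.+1) in IH *.
have -> : x ^+ (n.+1 + n.+1).+1 = x * y by rewrite exprS.
have -> : x ^+ (n.+2 + n.+2) = x ^+ 2 * y by rewrite -exprD; congr (_ ^+ _); lia.
have y0 : 0 <= y by exact: xn_ge0.
 have y1 : y <= x ^+ 2 by apply: ler_wiXn2l => //; lia.
apply: le_trans (_ : (1 - x) * (1 - x ^+ 2 + y) * (1 - x * y) <= _); last first.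
  rewrite ler_wpM2r // subr_ge0; have := x_le1; have := xn_le1 2; nra.
rewrite -mulrA ler_wpM2l ?subr_ge0 //.
have h := x_half; have h0 := x_ge0; rewrite !expr2 in y1 *.
have k1 : x * x <= 4^-1 by nra.
have k2 : x * (1 - x * x + y) <= x by rewrite ler_piMr // -addrA gerDl; lra.
have : 0 <= y * (1 - x * x - x * (1 - x * x + y)) by rewrite mulr_ge0 //; lra.
by lra.
Qed.

Let Cn_ge0 n : 0 <= Cn n.
Proof.
rewrite /Cn big_nat; apply: prodr_ge0 => i _; by rewrite subr_ge0.
Qed.

Let Cn_dec : nonincreasing_seq Cn.
Proof.
apply/nonincreasing_seqP => n; rewrite CnS; apply: ler_piMr; first exact: Cn_ge0.
by rewrite lerBlDr lerDl.
Qed.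

Let Cn_cvg : cvgn Cn.
Proof. by apply: nonincreasing_is_cvgn => //; exists 0 => _ [n _ <-]. Qed.

Local Notation C := (weight_const R p).

Let C_le n : C <= Cn n.
Proof. by rewrite weight_constE; apply: nonincreasing_cvgn_ge. Qed.

Lemma weight_const_gt0 : 0 < C.
Proof.
have h := x_half; have h0 := x_ge0.
apply: (@lt_le_trans _ _ ((1 - x) * (1 - x ^+ 2))); first by rewrite expr2; nra.
rewrite weight_constE; apply: limr_ge => //; exists 1%N => // -[//|n] _ /=.
apply: le_trans (Cn_lb n); rewrite ler_wpM2l ?subr_ge0 // lerDl //.
Qed.

Let Cn_gt0 n : 0 < Cn n. Proof. exact: lt_le_trans weight_const_gt0 (C_le n). Qed.

Let P n : R := \prod_(1 <= i < n.+1) (1 + x ^+ i).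

Let CP_le n : Cn n * P n <= 1.
Proof. by rewrite -(ler_pM2r (c_gt0 n)) mul1r Cn_prod cpr_nincr. Qed.

Let CP_ge n : 1 - x ^+ n <= Cn n * P n.
Proof.
rewrite -(ler_pM2r (c_gt0 n)) Cn_prod; apply: le_trans (cpr_tail n n).
by rewrite mulrC ler_pM2l // lerDl.
Qed.

Let s n : R := \sum_(k < n) rm k.

Let P_le n : P n <= s n.+1.
Proof.
rewrite /P qbinomial; apply: ler_sum => k _; rewrite /bb ler_piMr ?rank_moment_ge0 //.
have kn : (k <= n)%N by rewrite -ltnS.
rewrite -(ler_pM2r (c_gt0 (n - k))) mul1r qprodE //.
by rewrite -{1}(subnK kn) cpr_nincr.
Qed.

Let P_ge n j : s n * (1 - x ^+ j) <= P (n + j).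
Proof.
have qge k : (k <= n)%N -> 1 - x ^+ j <= qprod (n + j) k.
  (* [qprod] is the quotient c(n+j)/c(n+j-k), which [cpr_tail] bounds below by 1 - x^(n+j-k), hence
     by 1 - x^j. *)
  move=> kn; have knj : (k <= n + j)%N by rewrite (leq_trans kn) // leq_addr.
  rewrite -(ler_pM2r (c_gt0 (n + j - k))) qprodE //.
  have -> : c (n + j) = c (n + j - k + k) by rewrite subnK.
  apply: le_trans (cpr_tail _ _); rewrite mulrC ler_pM2l //.
  have : x ^+ (n + j - k) <= x ^+ j by apply: ler_wiXn2l => //; lia.
  by have := xn_ge0 (n + j - k + k); lra.
rewrite /P qbinomial /s mulr_suml -addSn big_split_ord /=.
have -> : \sum_(i < n.+1) bb (n + j) i = \sum_(i < n) bb (n + j) i + bb (n + j) n.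
  by rewrite big_ord_recr.
have bb_ge0 k : (k <= n + j)%N -> 0 <= bb (n + j) k.
  move=> kn; rewrite mulr_ge0 ?rank_moment_ge0 //.
  by rewrite -(pmulr_lge0 _ (c_gt0 (n + j - k))) qprodE // ltW.
rewrite -addrA ler_wpDr ?addr_ge0 ?bb_ge0 ?leq_addr //.
  by apply: sumr_ge0 => k _; apply: bb_ge0; have := ltn_ord k; lia.
apply: ler_sum => k _; rewrite ler_wpM2l ?rank_moment_ge0 // qge //.
exact: ltnW.
Qed.

Local Open Scope classical_set_scope.

Let expx_cvg0 : (fun n => x ^+ n) @ \oo --> 0.
Proof.
apply: cvg_expr; rewrite ger0_norm //; apply: le_lt_trans x_half _.
by rewrite invf_lt1 ?ltr1n.
Qed.

Lemma sum_rank_moment_le1 n : C * s n <= 1.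
Proof.
have s0 : 0 <= s n by apply: sumr_ge0 => k _; exact: rank_moment_ge0.
have H : (fun j => C * s n * (1 - x ^+ j)) @ \oo --> C * s n * (1 - 0).
  by apply: cvgM; [exact: cvg_cst | apply: cvgB; [exact: cvg_cst | exact: expx_cvg0]].
rewrite subr0 mulr1 in H; rewrite -(cvg_lim _ H) //; apply: limr_le.
  by apply/cvg_ex; eexists; exact: H.
apply: nearW => j; rewrite -mulrA.
apply: le_trans (CP_le (n + j)); apply: le_trans (_ : C * P (n + j) <= _).
  by rewrite ler_wpM2l ?P_ge // ltW // weight_const_gt0.
by rewrite ler_wpM2r // prodr_ge0 // => i _; rewrite addr_ge0.
Qed.

(** A squeeze: C s(n+1) >= C P(n) >= (1 - x^n) C / Cn(n), which tends to 1 because [Cn] tends to C >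
    0. *)
Lemma sum_rank_moment : (fun n => C * \sum_(k < n) rm k) @ \oo --> (1 : R).
Proof.
rewrite -(cvg_shiftS (fun n => C * s n)).
have lim1 : (fun n => (1 - x ^+ n) * (C / Cn n)) @ \oo --> (1 - 0) * (C / C).
  apply: cvgM; first by apply: cvgB; [exact: cvg_cst | exact: expx_cvg0].
  apply: cvgM; first exact: cvg_cst.
  by apply: cvgV; [rewrite gt_eqF // weight_const_gt0 | rewrite weight_constE].
rewrite subr0 mul1r divff ?gt_eqF ?weight_const_gt0 // in lim1.
apply: squeeze_cvgr lim1 (cvg_cst (1 : R)); apply: nearW => n.
rewrite sum_rank_moment_le1 andbT mulrA ler_pdivrMr // [leLHS]mulrC -[leRHS]mulrA.
rewrite ler_pM2l ?weight_const_gt0 // [leRHS]mulrC; apply: le_trans (CP_ge n) _.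
by rewrite ler_wpM2l // P_le.
Qed.

End EulerIdentity.

(** * The integral *)

Section Structure.
Variable p : nat.
Hypothesis p_pr : prime p.

Definition pbasis (K : zmodType) g (b : 'I_g -> K) (f : 'I_g -> nat) : Prop :=
  [/\ gensn b, forall u, linn b u = 0 <-> forall j, (p ^ f j %| u j)%N &
      forall i j : 'I_g, (i <= j)%N -> (f i <= f j)%N].

Lemma pbasis_prod_cyclic (K : finZmodType) r (f : 'I_r -> nat) :
  (forall i j : 'I_r, (i <= j)%N -> (f i <= f j)%N) ->
  isog_prod_cyclic K (fun i => (p ^ f i)%N) ->
  exists b : 'I_r -> K, pbasis b f.
Proof.
move=> fle [F [[F' FK F'K] FD]].
pose one j : {dffun forall i : 'I_r, 'I_(p ^ f i).-1.+1} :=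
  finfun (fun i => if j == i then inZp 1 else 0).
pose b j := F' (one j); exists b.
have FDi i : {morph (fun y => F y i) : y z / y + z} by move=> y z; rewrite FD.
have F0 i : F 0 i = 0 := addmorph0 (FDi i).
have FMn y n i : F (y *+ n) i = F y i *+ n := addmorphMn (FDi i) y n.
have Fsum (u : 'I_r -> nat) i : F (linn b u) i = inZp (u i).
  have -> : F (linn b u) i = \sum_j F (b j *+ u j) i.
    exact: (big_morph (fun y => F y i) (fun y z => FD y z i) (F0 i)).
  rewrite (bigD1 i) //= big1 => [|j /negbTE ji].
    rewrite addr0 FMn F'K ffunE eqxx Zp_mulrn; apply: val_inj.
    by rewrite /= modnMml mul1n.
  by rewrite FMn F'K ffunE ji mul0rn.
have pK i : (p ^ f i).-1.+1 = (p ^ f i)%N by rewrite prednK // expn_gt0 prime_gt0.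
split=> //.
  move=> y; exists (fun i => F y i : nat); apply: (can_inj FK).
  by apply/ffunP => i; rewrite Fsum valZpK.
move=> u; split=> [u0 j|uP].
  have := Fsum u j; rewrite u0 F0 => /(congr1 val) /= /esym/eqP.
  by rewrite pK.
apply: (can_inj FK); apply/ffunP => i; rewrite Fsum F0; apply: val_inj => /=.
by apply/eqP; rewrite -/(dvdn _ _) pK.
Qed.

(** Trivial factors come first in a nondecreasing list. Dropping one loses a zero term and keeps the
    coefficients of the others, which count the indices to their right. *)
Lemma pbasis_positive (K : zmodType) g (b : 'I_g -> K) (f : 'I_g -> nat) :
  pbasis b f -> exists g' (b' : 'I_g' -> K) (f' : 'I_g' -> nat),
  [/\ pbasis b' f', forall j, (0 < f' j)%N & moment_exp f' = moment_exp f].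
Proof.
elim: g b f => [|g IH] b f bf; first by exists 0%N, b, f; split=> // -[].
have [bg br fle] := bf.
have [f0|f0] := posnP (f ord0); last first.
  by exists g.+1, b, f; split=> // j; apply: leq_trans f0 (fle _ _ _).
have ext (v : 'I_g -> nat) c : exists2 u : 'I_g.+1 -> nat,
    u ord0 = c & forall j, u (lift ord0 j) = v j.
  exists (fun i => if unlift ord0 i is Some j then v j else c).
    by rewrite unlift_none.
  by move=> j; rewrite liftK.
have b0 : b ord0 = 0.
  have [u u0 uS] := ext (fun=> 0%N) 1%N.
  have : linn b u = 0.
    apply/br => j; case: (unliftP ord0 j) => [i|] ->; first by rewrite uS dvdn0.
    by rewrite u0 f0.
  rewrite /linn big_ord_recl u0 mulr1n big1 ?addr0 // => i _.
  by rewrite uS mulr0n.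
have linS u : linn b u = linn (fun j => b (lift ord0 j)) (fun j => u (lift ord0 j)).
  by rewrite /linn big_ord_recl b0 mul0rn add0r.
have [|g' [b' [f' [bf' f'0 E]]]] := IH (fun j => b (lift ord0 j)) (fun j => f (lift ord0 j)).
  split.
  - by move=> y; have [u <-] := bg y; exists (fun j => u (lift ord0 j)); rewrite -linS.
  - move=> v; have [u u0 uS] := ext v 0%N.
    have -> : linn (fun j => b (lift ord0 j)) v = linn b u.
      by rewrite linS; apply: eq_bigr => j _; rewrite uS.
    split=> [/br uP j|vP]; first by rewrite -uS.
    apply/br => j; case: (unliftP ord0 j) => [i|] ->; first by rewrite uS.
    by rewrite u0 dvdn0.
  - by move=> i j ij; apply: fle; rewrite /= /bump /= ltnS.
exists g', b', f'; split=> //; rewrite E /moment_exp [RHS]big_ord_recl f0 muln0 add0n.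
by apply: eq_bigr => j _.
Qed.

End Structure.

Section Integral.
Variables (R : realType) (p : nat).
Hypothesis p_pr : prime p.
Local Notation rp x := (generic_quotient.repr x : paired_pgroup p).
Local Open Scope classical_set_scope.
Local Open Scope ereal_scope.

Lemma esum_natmul (S : set (Ap p)) (w : Ap p -> R) k : (forall x, (0 <= w x)%R) ->
  \esum_(x in S) (w x * k%:R)%:E = k%:R%:E * \esum_(x in S) (w x)%:E.
Proof.
move=> w0; elim: k => [|k IH].
  by rewrite mul0e esum1 // => x _; rewrite mulr0.
transitivity (\esum_(x in S) ((w x * k%:R)%:E + (w x)%:E)).
  by apply: eq_esum => x _; rewrite -EFinD -natr1 mulrDr mulr1.
rewrite esumD; [|by move=> x _; rewrite lee_fin mulr_ge0|by move=> x _; rewrite lee_fin].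
rewrite IH -natr1 EFinD ge0_muleDl ?mul1e // lee_fin //.
Qed.

(** A function with natural values is constant on countably many level sets, all measurable for the
    discrete structure. *)
Lemma integral_mu (F : Ap p -> nat) :
  \int[@mu R p]_x ((F x)%:R : R)%:E = \esum_(x in [set: Ap p]) (weight R (rp x) * (F x)%:R)%:E.
Proof.
pose S k := [set x | F x = k].
have ST : \bigcup_k S k = setT by apply/seteqP; split=> // x _; exists (F x).
have tS : trivIset setT S by move=> i j _ _ [x [<- <-]].
rewrite -ST ge0_integral_bigcup //.
rewrite nneseries_sum_bigcup //; last first.
  by move=> x; rewrite lee_fin mulr_ge0 // weight_ge0.
apply: eq_eseriesr => k _.
rewrite (eq_integral (cst (k%:R : R)%:E)); last by move=> x; rewrite inE => <-.
rewrite integral_cst // /mu -esum_natmul; last by move=> x; exact: weight_ge0.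
by apply: eq_esum => x <-.
Qed.

Lemma class_killed (x : Ap p) (y : rp x) e : (logn p #|rp x| <= e)%N ->
  (y *+ (p ^ e) = 0)%R.
Proof.
move=> le; have card0 : (y *+ #|rp x| = 0)%R.
  (* Translation by [y] permutes the group, so adding [y] to each term leaves the sum of all
     elements unchanged. *)
  apply: (addrI (\sum_(z : rp x) z)%R).
  rewrite addr0 -[#|_|]cardsT cardsE -sumr_const -big_split /=.
  by rewrite [RHS](reindex_inj (addIr y)).
have /p_natP[k kE] := carrier_pgroup (rp x).
rewrite kE pfactorK // in le; rewrite -(subnKC le) expnD mulrnA -kE card0.
by rewrite mul0rn.
Qed.

Variables (K : finZmodType) (g : nat) (b : 'I_g -> K) (f : 'I_g -> nat).
Hypotheses (bgen : gensn b)
  (brel : forall u, linn b u = 0%R <-> forall j, (p ^ f j %| u j)%N)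
  (f_gt0 : forall j, (0 < f j)%N)
  (f_nd : forall i j : 'I_g, (i <= j)%N -> (f i <= f j)%N).

Let T (x : Ap p) : R := (weight R (rp x) * (num_Sur K x)%:R)%R.

Let T_ge0 x : (0 <= T x)%R.
Proof. by rewrite mulr_ge0 // weight_ge0. Qed.

Let M r : R := (weight_const R p * moment R p f r)%R.

Let rank_sum_le e r : (0 < e)%N -> (forall j, (f j <= e)%N) ->
  exists s : seq (Ap p), [/\ uniq s, forall x, x \in s <-> level e r x,
  (\sum_(x <- s) T x <= M r)%R &
  (M r - weight_const R p * (r%:R * #|K|%:R ^+ r / cpr R p r) / p%:R ^+ e.+1
    <= \sum_(x <- s) T x)%R].
Proof.
move=> e0 fe; have Km := struct_killed bgen brel fe.
have [s [us sl sE]] := level_sum R p_pr r e0 Km; exists s; split=> //.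
all: rewrite [(\sum_(x <- s) T x)%R]sE.
all: have /andP[lo hi] := good_bounds R p_pr bgen brel f_gt0 f_nd e0 fe r.
all: have q0 := sym_gt0 R p_pr e r; have c0 := cpr_gt0 R p_pr r.
all: have C0 := weight_const_gt0 R p_pr.
all: set n := ((\sum_(X in goodset p e r) killing K X)%N%:R)%R in lo hi *.
all: set q := (((p ^ (e + e)) ^ npairs r)%N%:R)%R in lo hi q0 *.
all: have pe : (0 < (p%:R : R) ^+ e.+1)%R by rewrite exprn_gt0 // pR_gt0.
all: have qc : (0 < q * cpr R p r)%R by rewrite mulr_gt0.
  rewrite /M -mulrA ler_pM2l // mulrC ler_pdivrMr //.
  by rewrite mulrC.
rewrite /M -!mulrA -mulrBr ler_pM2l // [leRHS]mulrC ler_pdivlMr //.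
apply: le_trans lo; rewrite mulrBl lerB //; first by rewrite mulrC.
rewrite [leRHS](_ : _ = q * (r%:R * #|K|%:R ^+ r / p%:R ^+ e.+1))%R //.
by field; rewrite !gt_eqF.
Qed.

(** From above, finitely many classes of rank [r] all lie in one level. From below, a single level
    of large [e] already comes within any given error. *)
Lemma rank_esum r :
  \esum_(x in [set x : Ap p | has_rank p (rp x) r]) (T x)%:E = (M r)%:E.
Proof.
pose e0 := (\max_j f j).+1.
have fe0 e j : (e0 <= e)%N -> (f j <= e)%N.
  by move=> le; rewrite (leq_trans _ le) // ltnW // ltnS leq_bigmax.
apply/eqP; rewrite eq_le; apply/andP; split.
  apply: ge_ereal_sup => _ [X [finX XS] <-].
  pose e := maxn e0 (\max_(x <- finmap.enum_fset (fset_set X)) logn p #|rp x|).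
  have e0e : (e0 <= e)%N by rewrite leq_maxl.
  have [s [us sl hi _]] := rank_sum_le r (leq_trans (ltn0Sn _) e0e) (fun j => fe0 e j e0e).
  apply: (@le_trans _ _ (\sum_(x \in [set` s]) (T x)%:E)).
    apply: lee_fsum_nneg_subset => //.
    - exact: finite_seq.
    - move=> x; rewrite !inE => Xx; apply/sl; split; first exact: XS.
      move=> y; apply: class_killed; rewrite leq_max; apply/orP; right.
      apply: (@leq_bigmax_seq _ (finmap.enum_fset (fset_set X)) xpredT (fun x => logn p #|rp x|)) => //.
      by rewrite in_fset_set // inE.
    - by move=> x _; rewrite lee_fin.
  by rewrite -fsbig_seq // sumEFin lee_fin.
apply/lee_addgt0Pr => eps eps0.
pose c : R := (weight_const R p * (r%:R * #|K|%:R ^+ r / cpr R p r))%R.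
have c0 : (0 <= c)%R.
  rewrite mulr_ge0 ?weight_const_ge0 // mulr_ge0 ?mulr_ge0 ?exprn_ge0 //.
  by rewrite invr_ge0 ltW // cpr_gt0.
(* This choice gives c/eps < e + 1 < p^(e+1), so the error c/p^(e+1) stays below [eps]. *)
pose e := maxn e0 (Num.truncn (c / eps)).
have e0e : (e0 <= e)%N by rewrite leq_maxl.
have [s [us sl _ lo]] := rank_sum_le r (leq_trans (ltn0Sn _) e0e) (fun j => fe0 e j e0e).
apply: (@le_trans _ _ ((\sum_(x <- s) T x)%:E + eps%:E)); last first.
  apply: leeD2r; apply: esum_ge; exists [set` s].
    by split; [exact: finite_seq | move=> x /sl[]].
  by rewrite -fsbig_seq // sumEFin.
rewrite -EFinD lee_fin -lerBlDr; apply: le_trans lo; rewrite lerD2l lerN2.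
have pe : (0 < (p%:R : R) ^+ e.+1)%R by rewrite exprn_gt0 // pR_gt0.
rewrite -/c ler_pdivrMr // mulrC -ler_pdivrMr //.
have /andP[_ /ltW le1] := truncn_itv (divr_ge0 c0 (ltW eps0)).
apply: le_trans le1 _; rewrite -natrX ler_nat.
have /leq_trans : ((Num.truncn (c / eps)).+1 <= e.+1)%N by rewrite ltnS leq_maxr.
by apply; apply: ltnW; apply: ltn_expl; exact: prime_gt1.
Qed.

Lemma moment_series : \sum_(0 <= r <oo) (M r)%:E = (p%:R ^+ moment_exp f)%:E.
Proof.
have cv : (fun n => \sum_(0 <= r < n) M r)%R @ \oo --> (p%:R ^+ moment_exp f : R)%R.
  rewrite -(cvg_shiftn g).
  (* The ranks below [g] contribute nothing, and the shift by [g] leaves the series of Euler's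
     identity. *)
  have -> : [sequence (\sum_(0 <= r < n + g) M r)%R]_n =
      (fun n => p%:R ^+ moment_exp f *
        (weight_const R p * \sum_(k < n) rank_moment R p k))%R.
    apply/funext => n /=; rewrite addnC (big_cat_nat _ (n := g)) ?leq_addr //=.
    rewrite big_nat big1 ?add0r => [|r /andP[_ rg]]; last first.
      by rewrite /M /moment leqNgt rg mulr0.
    rewrite -{1}[g]add0n big_addn addKn big_mkord mulr_sumr mulr_sumr.
    apply: eq_bigr => k _; rewrite /M /moment leq_addl addnK.
    by rewrite mulrCA.
  have := cvgM (cvg_cst (p%:R ^+ moment_exp f : R)%R) (@sum_rank_moment R p p_pr).
  by rewrite mulr1; apply.
apply/cvg_lim => //; apply: cvg_EFin.
  by apply: nearW => n; rewrite sumEFin.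
by apply: cvg_trans cv; apply: near_eq_cvg; apply: nearW => n /=; rewrite sumEFin.
Qed.

Lemma integral_num_Sur :
  \int[@mu R p]_x ((num_Sur K x)%:R : R)%:E = (p%:R ^+ moment_exp f)%:E.
Proof.
rewrite integral_mu.
pose S r := [set x : Ap p | has_rank p (rp x) r].
have killed (x : Ap p) : exists2 N, (0 < N)%N & forall y : rp x, (y *+ (p ^ N) = 0)%R.
  by exists (logn p #|rp x|).+1 => // y; apply: class_killed.
have ST : \bigcup_r S r = setT.
  apply/seteqP; split=> // x _; have [N N0 xN] := killed x.
  by have [r xr] := has_rank_ex p_pr N0 xN; exists r.
have tS : trivIset setT S.
  move=> i j _ _ [x [xi xj]]; have [N N0 xN] := killed x.
  exact: (has_rank_uniq p_pr N0 xN xi xj).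
rewrite -ST nneseries_sum_bigcup //.
by rewrite -moment_series; apply: eq_eseriesr => r _; exact: rank_esum.
Qed.

End Integral.

Theorem theorem3p4 (R : realType) (p : nat) (p_prime : prime p)
    (r : nat) (e : 'I_r -> nat)
    (e_nondecreasing : forall i j : 'I_r, (i <= j)%N -> (e i <= e j)%N)
    (G' : finZmodType)
    (isoG' : isog_prod_cyclic G' (fun i : 'I_r => (p ^ e i)%N)) :
  (\int[@mu R p]_x ((num_Sur G' x)%:R : R)%:E =
    ((p%:R : R) ^+ (\sum_(i < r) (r - i.+1) * e i)%N)%:E)%E.
Proof.
have [b be] := pbasis_prod_cyclic p_prime e_nondecreasing isoG'.
have [g [b' [f [[bg br fle] f0 fE]]]] := pbasis_positive be.
by rewrite (integral_num_Sur R p_prime bg br f0 fle) fE.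
Qed.
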